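(* There exists a numerical constant $L>0$ with the following property. Let $d\ge 1$ and let $f_1,\ldots,f_d:\mathbb{R}_0\to\mathbb{R}_0$ be convex, increasing functions such that $f_i(0)=0$ for each $i$. Let $$B:=\Big\{x\in\mathbb{R}_0^d:\ \sum_{i=1}^d f_i(x(i))\le 1\Big\}.$$ Let $X=(X_1,\ldots,X_d)$ be a random vector uniformly distributed on the convex body $B$. Let $X_1',\ldots,X_d'$ be independent random variables such that for each $i\le d$, $X_i'$ has the same distribution as $X_i$. Then for any $T\subset\mathbb{R}_0^d$ $$\mathbf{E}\sup_{t\in T}\sum_{i=1}^d t_iX_i\ \le\ L\,\mathbf{E}\sup_{t\in T}\sum_{i=1}^d t_iX_i'.$$
   Context: $\mathbb{R}_0=[0,\infty)$; $x(i)$ denotes the $i$-th coordinate of $x\in\mathbb{R}^d$. The constant $L$ does not depend on $d$, $f_1,\ldots,f_d$ or $T$. ''Uniformly distributed on $B$'' means with respect to normalized Lebesgue measure on $B$; ''increasing'' is understood strictly. *)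

(* Defs.v *)
From HB Require Import structures.
From mathcomp Require Import all_boot all_order all_algebra.
From mathcomp Require Import all_classical all_reals all_analysis.

Set Implicit Arguments.
Unset Strict Implicit.
Unset Printing Implicit Defensive.

Import Order.TTheory GRing.Theory Num.Theory.
Import numFieldNormedType.Exports.

Local Open Scope classical_set_scope.
Local Open Scope ring_scope.

(* R^n is [n.-tuple R], with the product sigma-algebra of the library. *)

Section cons_measure.
Context (R : realType) (n : nat).
Variable m : {sigma_finite_measure set (n.-tuple R) -> \bar R}.

Definition tuple_cons (p : R * n.-tuple R) : n.+1.-tuple R :=
  [tuple of p.1 :: p.2].

Lemma measurable_tuple_cons : measurable_fun setT tuple_cons.
Proof. exact: measurable_cons. Qed.

(* lebesgue_measure \x m, transported along R * R^n ~ R^(n+1). *)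
Definition cons_measure : set (n.+1.-tuple R) -> \bar R :=
  pushforward (@lebesgue_measure R \x m)%E tuple_cons.

Let mpreimage (A : set (n.+1.-tuple R)) :
  measurable A -> measurable (tuple_cons @^-1` A).
Proof.
by move=> mA; rewrite -[X in measurable X]setTI; exact: measurable_tuple_cons.
Qed.

Let cons_measure0 : cons_measure set0 = 0%E.
Proof. by rewrite /cons_measure /pushforward preimage_set0 measure0. Qed.

Let cons_measure_ge0 A : (0 <= cons_measure A)%E.
Proof. by rewrite /cons_measure /pushforward measure_ge0. Qed.

Let cons_measure_sigma_additive : semi_sigma_additive cons_measure.
Proof.
move=> F mF tF mUF; rewrite /cons_measure /pushforward preimage_bigcup.
apply: (@measure_semi_sigma_additive _ _ _ (@lebesgue_measure R \x m)%E)
  => [i||]; first exact: (mpreimage (mF i)).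
- apply/trivIsetP => /= i j _ _ ij; rewrite -preimage_setI.
  by move/trivIsetP : tF => /(_ _ _ _ _ ij) ->//; rewrite preimage_set0.
- by rewrite -preimage_bigcup; exact: mpreimage.
Qed.

HB.instance Definition _ := isMeasure.Build _ _ _ cons_measure
  cons_measure0 cons_measure_ge0 cons_measure_sigma_additive.

Let cons_measure_sigma_finite : sigma_finite setT cons_measure.
Proof.
have /sigma_finiteP[F [TF ndF Foo]] := sigma_finiteT (@lebesgue_measure R).
have /sigma_finiteP[G [TG ndG Goo]] := sigma_finiteT m.
pose u (t : n.+1.-tuple R) : R * n.-tuple R :=
  (tnth t ord0, [tuple of behead t]).
have consu p : u (tuple_cons p) = p.
  by case: p => x t; congr pair; apply: val_inj.
have mu : measurable_fun setT u.
  apply: measurable_fun_pair; first exact: measurable_tnth.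
  exact: measurable_behead.
exists (fun i => u @^-1` (F i `*` G i)).
  apply/esym/seteqP; split=> // t _.
  have [/= i _ Fi] : (\bigcup_i F i) (u t).1 by rewrite -TF.
  have [/= j _ Gj] : (\bigcup_i G i) (u t).2 by rewrite -TG.
  exists (maxn i j) => //; split.
  - by have /subsetPset := ndF _ _ (leq_maxl i j); exact.
  - by have /subsetPset := ndG _ _ (leq_maxr i j); exact.
move=> i; have [mF Fi] := Foo i; have [mG Gi] := Goo i; split.
  by rewrite -[X in measurable X]setTI; apply: mu => //; exact: measurableX.
rewrite /cons_measure /pushforward -comp_preimage.
rewrite (_ : u \o tuple_cons = id) ?preimage_id; last first.
  by apply/funext => p /=.
by rewrite product_measure1E// lte_mul_pinfty// ge0_fin_numE.
Qed.

HB.instance Definition _ := Measure_isSigmaFinite.Build _ _ _ cons_measure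
  cons_measure_sigma_finite.

End cons_measure.

Fixpoint lebesgue_measure_tuple (R : realType) (n : nat) :
    {sigma_finite_measure set (n.-tuple R) -> \bar R} :=
  if n is k.+1 then cons_measure (lebesgue_measure_tuple R k)
  else \d_[tuple].

Lemma lebesgue_measure_tuple_box (R : realType) (n : nat) (A : 'I_n -> set R) :
    (forall i, measurable (A i)) ->
  lebesgue_measure_tuple R n [set t | forall i, A i (tnth t i)] =
  (\prod_(i < n) lebesgue_measure (A i))%E.
Proof.
elim: n A => [|n ih] A mA.
  by rewrite big_ord0 /= diracE mem_set//= => -[].
rewrite big_ord_recl -ih// /= /cons_measure /pushforward.
rewrite -product_measure1E//.
  congr (_ _); apply/seteqP; split => [[x t] /= h|[x t] [/= h0 h] i].
    split; first exact: (h ord0).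
    by move=> i; have := h (lift ord0 i); rewrite tnthS.
  by case: (unliftP ord0 i) => [j|] ->; rewrite ?tnthS//; exact: h.
  exact: mA.
rewrite (_ : mkset _ =
    \bigcap_(i in [set: 'I_n]) ((@tnth n R)^~ i @^-1` A (lift ord0 i))).
  apply: fin_bigcap_measurable => // i _.
  by rewrite -[X in measurable X]setTI; exact: measurable_tnth.
by apply/seteqP; split => t /= h i => [_|]; exact: h.
Qed.

(* The functions f i : [0, +oo[ -> [0, +oo[ are total functions on R, of which
   only the values on [0, +oo[ matter. *)
Definition orlicz_body (R : realType) (d : nat) (f : 'I_d -> R -> R) :
    set (d.-tuple R) :=
  [set x | (forall i, 0 <= tnth x i) /\ \sum_(i < d) f i (tnth x i) <= 1].

Definition uniform_on (R : realType) (disp : measure_display)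
    (Omega : measurableType disp) (P : probability Omega R) (n : nat)
    (B : set (n.-tuple R)) (X : {RV P >-> n.-tuple R}) : Prop :=
  forall A : set (n.-tuple R), measurable A ->
    distribution P X A =
    (lebesgue_measure_tuple R n (A `&` B) / lebesgue_measure_tuple R n B)%E.

Definition mutually_independent (R : realType) (disp : measure_display)
    (Omega : measurableType disp) (P : probability Omega R) (I : finType)
    (Y : I -> {RV P >-> R}) : Prop :=
  forall (J : {set I}) (A : I -> set R), (forall i, measurable (A i)) ->
    P (\bigcap_(i in [set j | j \in J]) (Y i @^-1` A i)) =
    (\prod_(i in J) P (Y i @^-1` A i))%E.

Definition same_distribution (R : realType) (disp disp' : measure_display)
    (Omega : measurableType disp) (P : probability Omega R)
    (Omega' : measurableType disp') (P' : probability Omega' R)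
    (Y : Omega -> R) (Y' : Omega' -> R) : Prop :=
  forall A : set R, measurable A -> P (Y @^-1` A) = P' (Y' @^-1` A).

(* Extended-real valued, since T may be unbounded. *)
Definition sup_linear (R : realType) (d : nat) (T : set (d.-tuple R))
    (x : 'I_d -> R) : \bar R :=
  ereal_sup [set (\sum_(i < d) tnth t i * x i)%:E | t in T].

(* Main.v *)
(* After replacing [f i] by [l * f i], let [Y i] be independent with density
   proportional to [exp (- F i)] on the half-line, [F i := l * f i], and
   [S := sum_i F i (Y i)]; then [B] is the sublevel set [sum_i F i <= l].  The
   law of [Y] weighted by [soft l S := 1 - exp (- (l - S)^+)] (resp. by
   [1 - soft l S]) is a mixture of the uniform laws on the sublevel sets at
   heights [s <= l] (resp. [s >= l]), and by Efron's monotonicity theorem the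
   uniform law on a sublevel set increases stochastically with its height.  So
   when [l] is chosen with [E soft l S] between 1/2 and 2/3, a monotone
   functional of [X] is dominated by 3 times its value on [Y], while the weighted
   [Y] is dominated by [X].

   To compare each [Y i] with [X' i], choose [b i] with [F i (b i) = v], [v] being
   the smallest level, not below 1/8, for which [sum_i P (Y i >= b i)] is bounded by
   a constant; a second moment argument, applied to the shifts of single
   coordinates by [b i], shows that [E soft (l - v) S] remains bounded below,
   whence [P (Y i in . , Y i <= b i) <= 20 P (X' i in .)] on increasing functions.
   Monotonicity, convexity and homogeneity of the supremum [h] then give
   [E h (Y /\ b) <= K E h (X')], one coordinate at a time.  What exceeds [b] is
   at most [sum_i c i (X i - b i)^+], [c i := sup_T t i], whose expectation
   only involves the marginals and which is bounded by [E h (X')] because on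
   average boundedly many coordinates of [X'] exceed their threshold. *)

Require Import Defs.
From HB Require Import structures.
From mathcomp Require Import all_boot all_order all_algebra.
From mathcomp Require Import all_classical all_reals all_analysis.
From mathcomp Require Import measurable_realfun ring lra.

Set Implicit Arguments.
Unset Strict Implicit.
Unset Printing Implicit Defensive.

Import Order.TTheory GRing.Theory Num.Theory.
Import numFieldNormedType.Exports.

Local Open Scope classical_set_scope.
Local Open Scope ring_scope.

(** * Gauges *)

(** The obstacle is dimension: a comparison of expectations with a constant in front loses that
    constant once per coordinate. In the passage from [Y] to the marginals every loss is therefore
    turned into a dilation of the argument, by convexity at 0; a common dilation of all coordinates
    is paid only once, through homogeneity. The truncation is forced because [X' i] is bounded while
    [Y i] is not, so that no such comparison can hold on the whole half-line.

    Both weights of [Y] come from one identity, [exp (- S) = \int_(s >= S) exp (- s) ds], cut at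
    [s = l]. It involves full sublevel sets only, never their boundaries. The window for
    [E soft l S] serves twice: the bound 2/3 leaves mass 1/3 to the heights above [l], whence the
    factor 3, and the bound 1/2 feeds the second moment argument.

    Efron's theorem is proved by induction on the dimension with an explicit coupling. The induction
    needs the volume of a sublevel set to be a log-concave function of its height; this too is
    obtained from the coupling, one coordinate at a time. *)

Section integral_mono.
Context {d : measure_display} {T : measurableType d} {R : realType}.
Variable m : {measure set T -> \bar R}.
Local Open Scope ereal_scope.

(* Measurability is not required, the integral of a nonnegative function being
   the supremum of the integrals of the simple functions below it. *)
Lemma le_integral_ge0 (f g : T -> \bar R) : (forall x, 0 <= f x) ->
  (forall x, f x <= g x) -> \int[m]_x f x <= \int[m]_x g x.
Proof.
move=> f0 fg; have g0 x : 0 <= g x by exact: le_trans (f0 x) (fg x).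
rewrite !ge0_integralTE//; apply: ge_ereal_sup => _ [h /= hf <-].
apply: ereal_sup_ubound; exists h => // x; exact: le_trans (hf x) (fg x).
Qed.

Lemma measurable_patch (f : T -> \bar R) (D : set T) : measurable D ->
  measurable_fun setT f -> measurable_fun setT (f \_ D).
Proof.
by move=> mD mf; apply/(measurable_restrictT f mD); exact: measurable_funTS.
Qed.

End integral_mono.

Section gauge.
Context {R : realType}.
Implicit Types f : R -> R.

(** An Orlicz function extended by 0 to the negative half-line. The extension stays convex on the
    whole line, so convexity can be used without domain conditions. *)
Definition gauge f :=
  [/\ forall x, x <= 0 -> f x = 0, forall x, 0 < x -> 0 < f x &
      forall x y t, 0 <= t -> t <= 1 ->
        f (t * x + (1 - t) * y) <= t * f x + (1 - t) * f y].

Lemma gauge0 f : gauge f -> f 0 = 0. Proof. by case=> f0 _ _; exact: f0. Qed.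

Lemma gauge_ge0 f x : gauge f -> 0 <= f x.
Proof.
case=> f0 fp _; have [x0|x0] := leP x 0; first by rewrite f0.
exact/ltW/fp.
Qed.

(** The three chord inequality with denominators cleared, the form in which convexity is used from
    here on. *)
Lemma gauge_slope f x y z : gauge f -> x < y -> y < z ->
  (f y - f x) * (z - y) <= (f z - f y) * (y - x).
Proof.
move=> [_ _ cf] xy yz.
have zx : 0 < z - x by lra.
have t0 : 0 <= (z - y) / (z - x) by rewrite divr_ge0//; lra.
have t1 : (z - y) / (z - x) <= 1 by rewrite ler_pdivrMr//; lra.
have := cf x z _ t0 t1.
have -> : (z - y) / (z - x) * x + (1 - (z - y) / (z - x)) * z = y.
  by field; rewrite gt_eqF.
rewrite -(ler_pM2r zx).
have -> : ((z - y) / (z - x) * f x + (1 - (z - y) / (z - x)) * f z) * (z - x) =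
   (z - y) * f x + (y - x) * f z by field; rewrite gt_eqF.
by nra.
Qed.

Lemma gauge_nd f x y : gauge f -> x <= y -> f x <= f y.
Proof.
move=> gf; rewrite le_eqVlt => /predU1P[->//|xy].
have [x0|x0] := leP x 0.
  by case: (gf) => f0 _ _; rewrite (f0 x)//; exact: gauge_ge0.
have := gauge_slope gf x0 xy; rewrite (gauge0 gf) => H.
have fx : 0 <= f x * (y - x) by rewrite mulr_ge0 ?(gauge_ge0 x gf)// subr_ge0 ltW.
rewrite !subr0 in H; have := le_trans fx H.
by rewrite pmulr_lge0// subr_ge0.
Qed.

Lemma gauge_inc f x y : gauge f -> 0 <= x -> x < y -> f x < f y.
Proof.
move=> gf; rewrite le_eqVlt => /predU1P[<- y0|x0 xy].
  by rewrite (gauge0 gf); case: gf => _ fp _; exact: fp.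
have fx : 0 < f x by case: gf => _ fp _; exact: fp.
have := gauge_slope gf x0 xy; rewrite (gauge0 gf) => H.
have fp : 0 < f x * (y - x) by rewrite mulr_gt0//; lra.
rewrite !subr0 in H; have := lt_le_trans fp H.
by rewrite pmulr_lgt0// subr_gt0.
Qed.

Lemma gauge_incr f x y e : gauge f -> x <= y -> 0 <= e ->
  f (x + e) - f x <= f (y + e) - f y.
Proof.
move=> gf; rewrite le_eqVlt => /predU1P[->//|xy].
rewrite le_eqVlt => /predU1P[<-|e0]; first by rewrite !addr0 !subrr.
have H1 : x < x + e by lra.
case: (ltgtP (x + e) y) => [xey|yxe|exy].
- have := gauge_slope gf H1 xey; have h2 : y < y + e by lra.
  have := gauge_slope gf xey h2.
  rewrite [in X in _ -> X -> _](_ : x + e - x = e); last by ring.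
  rewrite [in X in X -> _](_ : y + e - y = e); last by ring.
  set a := f (x + e); set b := f y; set c := f (y + e); set d := f x.
  set u := y - _ => P1 P2; have u0 : 0 < u by rewrite /u; lra.
  rewrite -(ler_pM2r u0); exact: le_trans P2 P1.
(* The intervals overlap: the outer pieces [[x, y]] and [[x + e, y + e]], of equal length, are
   compared through the overlap [[y, x + e]]. *)
- have ye : x + e < y + e by lra.
  have P1 := gauge_slope gf xy yxe; have P2 := gauge_slope gf yxe ye.
  set a := f (x + e) in P1 P2 *; set b := f y in P1 P2 *.
  set c := f (y + e) in P2 *; set d := f x in P1 *.
  set u := x + e - y in P1 P2; set v := y - x in P1.
  have u0 : 0 < u by rewrite /u; lra.
  rewrite (_ : y + e - (x + e) = v) in P2; last by rewrite /v; ring.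
  have v0 : 0 < v by rewrite /v; lra.
  suff : (b - d) * u <= (c - a) * u by rewrite ler_pM2r//; lra.
  exact: le_trans P1 P2.
- have ye : y < y + e by lra.
  rewrite exy; have := gauge_slope gf xy ye.
  rewrite (_ : y + e - y = e); last by ring.
  by rewrite (_ : y - x = e) ?ler_pM2r// -exy; ring.
Qed.

Lemma gauge_superadd f x y : gauge f -> 0 <= x -> 0 <= y ->
  f x + f y <= f (x + y).
Proof.
move=> gf x0 y0; have := gauge_incr gf y0 x0.
by rewrite add0r (gauge0 gf) [y + x]addrC; lra.
Qed.

Lemma gauge_scale f c x : gauge f -> 0 <= x -> 1 <= c -> c * f x <= f (c * x).
Proof.
move=> gf; rewrite le_eqVlt => /predU1P[<-|x0].
  by rewrite mulr0 (gauge0 gf) mulr0.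
rewrite le_eqVlt => /predU1P[<-|c1]; first by rewrite !mul1r.
have xc : x < c * x by rewrite ltr_pMl.
have := gauge_slope gf x0 xc; rewrite (gauge0 gf) !subr0.
rewrite (_ : f x * (c * x - x) = ((c - 1) * f x) * x); last by ring.
rewrite ler_pM2r//; lra.
Qed.

Lemma gauge_mulr f c : gauge f -> 0 < c -> gauge (fun x => c * f x).
Proof.
move=> [f0 fp cf] c0; split=> [x x0|x x0|x y t t0 t1].
- by rewrite f0// mulr0.
- by rewrite mulr_gt0// fp.
- have := cf x y _ t0 t1; rewrite -(ler_pM2l c0) => /le_trans; apply.
  by rewrite le_eqVlt; apply/orP; left; apply/eqP; ring.
Qed.

Lemma gauge_surj f (v : R) : gauge f -> 0 <= v -> exists2 b, 0 <= b & f b = v.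
Proof.
move=> gf v0.
(* As [z >= 1], convexity gives [f z >= z * f 1 = f 1 + v > v]. *)
pose z := 1 + v / f 1.
have f1 : 0 < f 1 by case: gf => _ + _; apply.
have z1 : 1 <= z by rewrite /z lerDl divr_ge0// ltW.
have fz : v < f z.
  have := gauge_scale gf (@ler01 R) z1; rewrite mulr1.
  by rewrite /z mulrDl mul1r divfK ?gt_eqF//; lra.
have cf : {within `[0, z], continuous f}.
  apply: continuous_subspaceT => x.
  apply/cvgrPdist_le => e e0.
  (* A local Lipschitz constant: chords with one end at [x] and the other less than 1 away are no
     steeper than the chord over [[x, x + 1]]. The extra 1 makes [K] positive. *)
  pose K := f (x + 1) - f x + 1.
  have xx1 : x <= x + 1 by rewrite lerDl.
  have K0 : 0 < K by rewrite /K; have := gauge_nd gf xx1; lra.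
  near=> y.
  have d1 : `|x - y| < 1 by near: y; apply: (@cvgr_dist_lt _ R^o _ (nbhs x) _ id x).
  have d2 : `|x - y| < e / K.
    by near: y; apply: (@cvgr_dist_lt _ R^o _ (nbhs x) _ id x) => //; rewrite divr_gt0.
  have : `|f x - f y| <= `|x - y| * K.
    have [xy|yx|->] := ltgtP x y; last by rewrite !subrr !normr0 mul0r.
    - have yx1 : y < x + 1 by rewrite distrC gtr0_norm in d1; lra.
      have P1 := gauge_slope gf xy yx1.
      have P2 := gauge_nd gf (ltW xy); have P3 := gauge_nd gf (ltW yx1).
      rewrite !ler0_norm; [|lra|lra].
      by rewrite /K; nra.
    - have x1 : x < x + 1 by lra.
      have P1 := gauge_slope gf yx x1.
      have P2 := gauge_nd gf (ltW yx); have P3 := gauge_nd gf (ltW x1).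
      rewrite !ger0_norm; [|lra|lra].
      by rewrite /K; nra.
  move=> /le_trans; apply; rewrite -ler_pdivlMr//; exact: ltW.
have [|c cz fc] := IVT (le_trans ler01 z1) cf (v := v).
  rewrite (gauge0 gf); apply/andP; split; first by rewrite ge_min v0.
  by rewrite le_max (ltW fz) orbT.
by exists c => //; move: cz; rewrite in_itv/= => /andP[].
Unshelve. all: by end_near.
Qed.

Lemma measurable_gauge f : gauge f -> measurable_fun setT f.
Proof.
by move=> gf; apply: nondecreasing_measurable => // x y; exact: gauge_nd.
Qed.

End gauge.

Section integral_shift.
Context {R : realType}.
Local Notation mu := (@lebesgue_measure R).
Local Open Scope ereal_scope.

Lemma integral_shift (b : R) (g : R -> \bar R) : measurable_fun setT g ->
  (forall x, 0 <= g x) -> \int[mu]_x g (x + b)%R = \int[mu]_x g x.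
Proof.
move=> mg g0; pose phi (x : R) : measurableTypeR R := (x + b)%R.
have mphi : measurable_fun setT phi by exact: measurable_funD.
pose phiM : {mfun _ >-> _} :=
  HB.pack phi (isMeasurableFun.Build _ _ _ _ _ mphi).
transitivity (\int[pushforward mu phiM]_x g x); last first.
  apply: eq_measure_integral => //= A mA _.
  apply/esym/lebesgue_measure_unique => //= _ [[u v]] _ <-.
  rewrite /pushforward (_ : _ @^-1` _ = `](u - b)%R, (v - b)%R]%classic).
    rewrite !lebesgue_measure_itv/= !lte_fin ltrD2r.
    by case: ifP => // _; congr EFin; ring.
  by apply/seteqP; split => x; rewrite /= !in_itv/= /phi ltrBlDr lerBrDr.
by rewrite ge0_integral_pushforward.
Qed.

End integral_shift.

(** * Laws on the line given by a density, and the quantile transform *)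

Section pdf_prob.
Context {R : realType}.
Local Notation mu := (@lebesgue_measure R).
Variables (k : R -> R) (k0 : forall x, 0 <= k x).
Variables (mk : measurable_fun setT k) (k1 : (\int[mu]_x (k x)%:E = 1)%E).
Local Open Scope ereal_scope.

(** The proofs are arguments so that the probability structure can be inferred from the term
    itself. *)
Definition pdf_prob (_ : forall x, (0 <= k x)%R) (_ : measurable_fun setT k)
    (_ : \int[mu]_x (k x)%:E = 1) : set R -> \bar R :=
  fun A => \int[mu]_(x in A) (k x)%:E.

Local Notation p := (pdf_prob k0 mk k1).

Let pdf_prob0 : p set0 = 0.
Proof. by rewrite /pdf_prob integral_set0. Qed.

Let pdf_prob_ge0 U : 0 <= p U.
Proof. by apply: integral_ge0 => x _; rewrite lee_fin. Qed.

Let pdf_prob_sigma_additive : semi_sigma_additive p.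
Proof.
move=> F mF tF mUF; rewrite /pdf_prob; apply: cvg_toP.
  apply: ereal_nondecreasing_is_cvgn => m n mn.
  apply: lee_sum_nneg_natr => // i _ _.
  by apply: integral_ge0 => /= x Fkx; rewrite lee_fin.
rewrite ge0_integral_bigcup//=.
- exact/measurable_funTS/measurable_EFinP.
- by move=> x _; rewrite lee_fin.
Qed.

HB.instance Definition _ := isMeasure.Build _ _ _ p
  pdf_prob0 pdf_prob_ge0 pdf_prob_sigma_additive.

Let pdf_prob_setT : p setT = 1.
Proof. exact: k1. Qed.

HB.instance Definition _ := @Measure_isProbability.Build _ _ R p pdf_prob_setT.

Import HBNNSimple.

Let integral_pdf_nnsfun (f : {nnsfun R >-> R}) :
  \int[p]_x (f x)%:E = \int[mu]_x ((f x)%:E * (k x)%:E).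
Proof.
rewrite integralT_nnsfun sintegralE.
under [RHS]eq_integral.
  move=> x _; rewrite fimfunE -fsumEFin// ge0_mule_fsuml; last first.
    by move=> r; rewrite EFinM nnfun_muleindic_ge0.
  over.
rewrite ge0_integral_fsum//; last 2 first.
  - move=> r; have m1 : measurable_fun setT (\1_(f @^-1` [set r]) : R -> R).
      exact: measurable_indic.
    under eq_fun do rewrite -EFinM.
    by apply/measurable_EFinP; do 2 apply: measurable_funM => //.
  - by move=> r x _; rewrite mule_ge0 ?lee_fin// -lee_fin EFinM nnfun_muleindic_ge0.
apply: eq_fsbigr => r _.
have [r0|r0] := leP 0%R r; last first.
  rewrite preimage_nnfun0// measure0 mule0; apply/esym/integral0_eq => x _.
  by rewrite indicE memNset//= mulr0 mul0e.
transitivity (r%:E * \int[mu]_x ((\1_(f @^-1` [set r]) x)%:E * (k x)%:E)).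
  congr (_ * _); rewrite -[LHS]/(\int[mu]_(x in f @^-1` [set r]) (k x)%:E) integral_mkcond.
  apply: eq_integral => x _.
  rewrite patchE indicE; case: ifPn => //; first by rewrite mul1e.
  by rewrite mul0e.
rewrite -ge0_integralZl//.
- by apply: eq_integral => x _; rewrite EFinM muleA.
- apply: emeasurable_funM; apply/measurable_EFinP; last exact: mk.
  exact: (@measurable_indic _ R R setT).
- by move=> x _; rewrite -EFinM lee_fin mulr_ge0.
Qed.

Lemma integral_pdf_prob (g : R -> \bar R) : measurable_fun setT g ->
  (forall x, 0 <= g x) -> \int[p]_x g x = \int[mu]_x (g x * (k x)%:E).
Proof.
move=> mg g0; pose g_ := nnsfun_approx measurableT mg.
have gE x : limn (EFin \o g_ ^~ x) = g x.
  by apply/cvg_lim => //; exact: cvg_nnsfun_approx.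
transitivity (limn (fun n => \int[p]_x (g_ n x)%:E)).
  rewrite -monotone_convergence//.
  - by apply: eq_integral => x _; rewrite -gE.
  - by move=> n; exact/measurable_EFinP.
  - by move=> n x _; rewrite lee_fin.
  - by move=> x _ m n mn; rewrite lee_fin; exact/lefP/nd_nnsfun_approx.
transitivity (limn (fun n => \int[mu]_x ((g_ n x)%:E * (k x)%:E))).
  by congr (limn _); apply/funext => n; exact: integral_pdf_nnsfun.
rewrite -monotone_convergence//.
- apply: eq_integral => x _; rewrite -gE; apply/cvg_lim => //.
  apply: cvgeZr => //; rewrite gE; exact: cvg_nnsfun_approx.
- move=> n; apply: emeasurable_funM; apply/measurable_EFinP; last exact: mk.
  exact: (measurable_funP (g_ n)).
- by move=> n x _; rewrite -EFinM lee_fin mulr_ge0.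
- move=> x _ m n mn; apply: lee_pmul; rewrite ?lee_fin//.
  by have /lefP := nd_nnsfun_approx measurableT mg mn; apply.
Qed.

End pdf_prob.

Section quantile.
Context {R : realType} (p : probability R R).
Local Notation mu := (@lebesgue_measure R).
Local Open Scope ereal_scope.

Local Notation F x := (p `]-oo, x]%classic).

(* The level is reset to 1/2 outside ]0, 1[, so that the infimum is always a
   minimum. *)
Definition level (t : R) : R := if (0 < t < 1)%R then t else 2^-1%R.

Definition quantile (t : R) : R := inf [set x | (level t)%:E <= F x].

Lemma level_gt0 t : (0 < level t)%R.
Proof. by rewrite /level; case: ifPn => // /andP[]. Qed.

Lemma level_lt1 t : (level t < 1)%R.
Proof. by rewrite /level; case: ifPn => [/andP[]//|_]; rewrite invf_lt1 ?ltr1n. Qed.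

Let F_nd x y : (x <= y)%R -> F x <= F y.
Proof. by move=> xy; rewrite le_measure ?inE//; exact: subitvPr. Qed.

Let F_sup t : (t < 1)%R -> exists x, t%:E <= F x.
Proof.
move=> t1; apply: contrapT => /forallNP H.
have : F n%:R @[n --> \oo] --> p (\bigcup_n `]-oo, n%:R]%classic).
  apply: nondecreasing_cvg_mu => //; first exact: bigcup_measurable.
  by move=> n m nm; apply/subsetPset; apply: subitvPr; rewrite bnd_simp ler_nat.
rewrite (_ : \bigcup_n _ = setT); last first.
  apply/seteqP; split=> // x _; exists (Num.truncn x).+1 => //=.
  by rewrite in_itv/= ltW// truncnS_gt.
rewrite probability_setT => H1.
have : (1 <= t%:E).
  apply: (cvge_le _ H1); near=> n; rewrite leNgt; apply/negP => /ltW.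
  exact: H.
by rewrite lee_fin leNgt t1.
Unshelve. all: by end_near.
Qed.

Let F_inf t : (0 < t)%R -> exists x, F x < t%:E.
Proof.
move=> t0; apply: contrapT => /forallNP H.
have : F (- n%:R)%R @[n --> \oo] --> p (\bigcap_n `]-oo, (- n%:R)%R]%classic).
  apply: nonincreasing_cvg_mu => //=.
  - by rewrite (le_lt_trans (probability_le1 _ _)) ?ltry.
  - exact: bigcap_measurable.
  - move=> m n mn; apply/subsetPset => x/=; rewrite !in_itv => /le_trans; apply.
    by rewrite lerN2 ler_nat.
rewrite (_ : \bigcap_n _ = set0); last first.
  rewrite -subset0 => x /(_ (Num.truncn (- x)).+1 I).
  by rewrite /= in_itv/= leNgt => /negP; apply; rewrite ltrNl truncnS_gt.
rewrite measure0 => H1.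
have : t%:E <= 0.
  apply: (cvge_ge _ H1); near=> n; rewrite leNgt; apply/negP; exact: H.
by rewrite lee_fin leNgt t0.
Unshelve. all: by end_near.
Qed.

(** Right continuity of the distribution function puts the infimum in the set. Inequalities between
    quantiles thus become inequalities between distribution functions. *)
Lemma quantileP t x : (quantile t <= x)%R = ((level t)%:E <= F x).
Proof.
have [y0 y0t] := F_sup (level_lt1 t).
have [z0 z0t] := F_inf (level_gt0 t).
have hl : has_lbound [set x | (level t)%:E <= F x].
  exists z0 => y /= ty; rewrite leNgt; apply/negP => /ltW /F_nd yz.
  by have := lt_le_trans z0t (le_trans ty yz); rewrite ltxx.
apply/idP/idP => [qx|]; last by move=> tx; exact: ge_inf.
suff qF : (level t)%:E <= F (quantile t) by exact: le_trans qF (F_nd qx).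
have : F (quantile t + n.+1%:R^-1)%R @[n --> \oo] -->
    p (\bigcap_n `]-oo, (quantile t + n.+1%:R^-1)%R]%classic).
  apply: nonincreasing_cvg_mu => //=.
  - by rewrite (le_lt_trans (probability_le1 _ _)) ?ltry.
  - exact: bigcap_measurable.
  - move=> m n mn; apply/subsetPset => y/=; rewrite !in_itv => /le_trans; apply.
    by rewrite lerD2l lef_pV2 ?posrE// ler_nat.
rewrite -itvNycEbigcap => H1.
apply: (cvge_ge _ H1); near=> n.
have [|y /= ty yq] := @inf_adherent _ _ n.+1%:R^-1%R _ (conj (ex_intro _ y0 y0t) hl).
  by rewrite invr_gt0.
exact: le_trans ty (F_nd (ltW yq)).
Unshelve. all: by end_near.
Qed.

Lemma measurable_level : measurable_fun setT level.
Proof.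
apply: measurable_fun_ifT => //.
by apply: measurable_and; exact: measurable_fun_ltr.
Qed.

Lemma measurable_quantile : measurable_fun setT quantile.
Proof.
apply: (measurability (@RGenOInfty.G R)) => [|/= _ [_] [r] -> <-].
  exact: RGenOInfty.measurableE.
rewrite setTI (_ : _ @^-1` _ = level @^-1` `]fine (F r), +oo[); last first.
  apply/seteqP; split=> t /=; rewrite !in_itv/= !andbT !ltNge quantileP.
    by rewrite -lee_fin fineK// fin_num_measure.
  by rewrite -lee_fin fineK// fin_num_measure.
by rewrite -[X in measurable X]setTI; exact: measurable_level.
Qed.

Local Notation U := (@uniform_prob R 0 1 ltr01).

(** Inverse transform sampling. As every law on the line is an image of the same uniform law, two
    laws are coupled by taking both quantile functions at the same [t]. *)
Lemma integral_quantile (g : R -> \bar R) : measurable_fun setT g ->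
  (forall x, 0 <= g x) -> \int[p]_x g x = \int[U]_t g (quantile t).
Proof.
move=> mg g0.
pose Q : {mfun _ >-> _} :=
  HB.pack quantile (isMeasurableFun.Build _ _ _ _ _ measurable_quantile).
transitivity (\int[pushforward U Q]_x g x); last first.
  rewrite ge0_integral_pushforward//; exact: measurable_quantile.
have ray x : pushforward U Q `]-oo, x]%classic = F x.
  have F01 : (0 <= fine (F x) <= 1)%R.
    by rewrite fine_ge0//= -lee_fin fineK ?fin_num_measure// probability_le1.
  have -> : F x = (fine (F x))%:E by rewrite fineK// fin_num_measure.
  set a := fine _ in F01 *; rewrite /pushforward.
  have -> : Q @^-1` `]-oo, x] = [set t | (level t <= a)%R].
    apply/seteqP; split=> t /=; rewrite in_itv/= quantileP;
    by rewrite -lee_fin fineK// fin_num_measure.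
  rewrite /uniform_prob integral_uniform_pdf.
  transitivity (\int[mu]_(t in [set t | (level t <= a)%R] `&` `[0%R, 1%R]) cst 1 t).
    apply: eq_integral => t /set_mem[_ /=]; rewrite in_itv/= => t01.
    by rewrite /uniform_pdf t01 subr0 invr1.
  have ma : measurable [set t | (level t <= a)%R].
    rewrite -[X in measurable X]setTI -[X in _ `&` X]/(level @^-1` [set t | t <= a]%R).
    by apply: measurable_level => //; rewrite -set_itvNyc.
  rewrite integral_cst; last exact: measurableI.
  rewrite mul1e.
  (* [level] is the identity on []0, 1[] and 1/2 elsewhere, so the set lies between []0, a[] and
     [[0, a]] with the point 1 added. *)
  apply/eqP; rewrite eq_le; apply/andP; split.
    apply: (@le_trans _ _ (mu (`[0%R, a]%classic `|` [set 1%R]))).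
      apply: le_measure; rewrite ?inE; [exact: measurableI|exact: measurableU|].
      move=> t [/= ta]; rewrite in_itv/= => /andP[t0 t1].
      have [->|t1'] := eqVneq t 1%R; [by right|left].
      rewrite /= in_itv/= t0/=; have [->|tn0] := eqVneq t 0%R.
        by case/andP : F01.
      by move: ta; rewrite /level !lt_neqAle eq_sym tn0 t0 t1' t1.
    rewrite (le_trans (measureU2 _ _ _))//= lebesgue_measure_set1 adde0.
    rewrite lebesgue_measure_itv/= lte_fin oppr0 addr0; case: ifPn => // _.
    by rewrite lee_fin; case/andP : F01.
  apply: (@le_trans _ _ (mu (`]0%R, a[%classic))).
    rewrite lebesgue_measure_itv/= lte_fin oppr0 addr0; case: ifPn => //.
    by rewrite -leNgt => a0; rewrite lee_fin.
  apply: le_measure; rewrite ?inE//; first exact: measurableI.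
  move=> t /=; rewrite in_itv/= => /andP[t0 ta]; case/andP : F01 => _ a1.
  have t1 := lt_le_trans ta a1.
  by rewrite /level t0 t1 in_itv/= !ltW.
apply: eq_measure_integral => [|mQ A mA _]; first exact: measurable_quantile.
have ocE (m : {measure set R -> \bar R}) u v : m setT < +oo -> (u <= v)%R ->
    m `]u, v]%classic = m `]-oo, v]%classic - m `]-oo, u]%classic.
  move=> mT uv; have : `]u, v]%classic = `]-oo, v] `\` `]-oo, u] => [|->].
    by rewrite -[RHS]setCK setCD setCitvl setUC -[LHS]setCK setCitv.
  rewrite measureD ?setIidr//; first exact: subset_itvl.
  by apply: le_lt_trans mT; apply: le_measure; rewrite ?inE.
refine (@measure_unique _ R R (@ocitv R)
  (fun n => `](- n%:R)%R, n%:R]%classic) erefl _ _ _ p (pushforward U Q) _ _ A mA).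
- exact: ocitvI.
- by move=> n; exact: is_ocitv.
- apply/seteqP; split=> // x _; exists (Num.truncn `|x|).+1 => //=.
  rewrite in_itv/=; have : (`|x| < (Num.truncn `|x|).+1%:R)%R by rewrite truncnS_gt.
  by rewrite ltr_norml => /andP[-> /ltW].
- move=> _ [[u v]] _ <-; have [uv|vu] := leP u v; last first.
    by rewrite set_itv_ge ?measure0// bnd_simp -leNgt ltW.
  have U1 : pushforward U Q setT < +oo.
    by rewrite /pushforward preimage_setT probability_setT ltry.
  have p1 : p setT < +oo by rewrite probability_setT ltry.
  by rewrite (ocE _ _ _ p1 uv) (ocE _ _ _ U1 uv); congr (_ - _); exact/esym/ray.
- by move=> n; rewrite (le_lt_trans (probability_le1 _ _)) ?ltry.
Qed.

End quantile.

(** * Efron's monotonicity in one dimension *)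

Section efron_step.
Context {R : realType}.
Local Notation mu := (@lebesgue_measure R).

(** Log-concavity as the monotonicity of [W (r + d) / W r] in [r], cross-multiplied so that zeros
    are allowed. *)
Definition logconcave (W : R -> R) := forall u v d, v <= u -> 0 <= d ->
  W (u + d) * W v <= W u * W (v + d).

(** The properties of the volume of a sublevel set as a function of its height. [W 0] is left free:
    it is 1 in dimension 0 and 0 in positive dimension. *)
Definition volume_like (W : R -> R) :=
  [/\ forall r, r < 0 -> W r = 0, forall r, 0 < r -> 0 < W r,
      {homo W : x y / x <= y} & logconcave W].

Variables (f W : R -> R) (gf : gauge f) (vW : volume_like W).

Lemma volume_like_ge0 r : 0 <= W r.
Proof.
case: vW => W0 _ Wnd _; have [r0|r0] := ltP r 0; first by rewrite W0.
apply: (@le_trans _ _ (W (-1))); first by rewrite W0//; lra.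
by apply: Wnd; lra.
Qed.

Lemma measurable_volume_like : measurable_fun setT W.
Proof. by case: vW => _ _ Wnd _; apply: nondecreasing_measurable. Qed.

(** The volume of the section at [x] of a sublevel set of height [s], when [W] is the volume
    function of the other coordinates. Its integral [vol] is then the volume function with one
    coordinate more. *)
Definition fiber (s x : R) : R := if 0 <= x then W (s - f x) else 0.

Lemma fiber_ge0 s x : 0 <= fiber s x.
Proof. by rewrite /fiber; case: ifP => // _; exact: volume_like_ge0. Qed.

Lemma measurable_fiber s : measurable_fun setT (fiber s).
Proof.
apply: measurable_fun_ifT => //; first exact: measurable_fun_ler.
apply: (measurableT_comp measurable_volume_like).
by apply: measurable_funB => //; exact: measurable_gauge.
Qed.

Let mefiber s : measurable_fun setT (fun x => (fiber s x)%:E).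
Proof. by apply/measurable_EFinP; exact: measurable_fiber. Qed.

Let fiber_nd s s' x : s <= s' -> fiber s x <= fiber s' x.
Proof.
move=> ss'; rewrite /fiber; case: ifP => // _.
by case: vW => _ _ Wnd _; apply: Wnd; lra.
Qed.

Let fiber0 s x : x < 0 -> fiber s x = 0.
Proof. by rewrite /fiber leNgt => ->. Qed.

Local Open Scope ereal_scope.

Definition evol s := \int[mu]_x (fiber s x)%:E.
Definition vol s := fine (evol s).

Lemma evol_fin s : evol s \is a fin_num.
Proof.
rewrite ge0_fin_numE; last first.
  by apply: integral_ge0 => x _; rewrite lee_fin fiber_ge0.
have [s0|s0] := ltP s 0%R.
  rewrite /evol integral0_eq ?ltry// => x _; rewrite /fiber.
  case: ifP => // x0; case: vW => W0 _ _ _; rewrite W0//.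
  by have := gauge_ge0 x gf; lra.
have [b b0 fb] := gauge_surj gf s0.
apply: (@le_lt_trans _ _ (\int[mu]_(x in `[0%R, b]) (W s)%:E)); last first.
  rewrite integral_cst//= lebesgue_measure_itv/= lte_fin.
  by case: ifP => _; rewrite ?mule0 ?ltry// -EFinD -EFinM ltry.
rewrite [leRHS]integral_mkcond; apply: le_integral_ge0 => x.
  by rewrite lee_fin fiber_ge0.
rewrite patchE; case: ifPn => [_|].
  rewrite lee_fin /fiber; case: ifP => _; last exact: volume_like_ge0.
  by case: vW => _ _ Wnd _; apply: Wnd; have := gauge_ge0 x gf; lra.
rewrite notin_setE/= in_itv/= => /negP; rewrite negb_and -!ltNge => /orP[x0|bx].
  by rewrite fiber0.
rewrite /fiber; case: ifP => // _.
case: vW => W0 _ _ _; rewrite W0//.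
by have := gauge_inc gf b0 bx; lra.
Qed.

Lemma volE s : (vol s)%:E = evol s.
Proof. by rewrite fineK// evol_fin. Qed.

Lemma vol_ge0 s : (0 <= vol s)%R.
Proof.
apply: fine_ge0; apply: integral_ge0 => x _.
by rewrite lee_fin fiber_ge0.
Qed.

Lemma vol_le0 s : (s <= 0)%R -> vol s = 0%R.
Proof.
move=> s0; suff : evol s = 0 by rewrite /vol => ->.
(* At height 0 the fiber can be nonzero at the point 0 only, which is negligible. *)
transitivity (\int[mu]_(x in [set 0%R]) (fiber s x)%:E); last first.
  exact: integral_set1.
rewrite integral_mkcond; apply: eq_integral => x _; rewrite patchE.
case: ifPn => //; rewrite notin_setE/= => x0.
rewrite /fiber; case: ifP => // x0'; case: vW => W0 _ _ _; rewrite W0//.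
have xp : (0 < x)%R by rewrite lt_neqAle x0' andbT eq_sym; apply/eqP.
by have := gauge_inc gf (lexx _) xp; rewrite (gauge0 gf); lra.
Qed.

Lemma vol_gt0 s : (0 < s)%R -> (0 < vol s)%R.
Proof.
move=> s0; rewrite -lte_fin volE.
have s2 : (0 <= s / 2)%R by lra.
have [b b0 fb] := gauge_surj gf s2.
have bp : (0 < b)%R.
  rewrite lt_neqAle b0 andbT; apply/eqP => b0'.
  by move: fb; rewrite -b0' (gauge0 gf); lra.
have W2 : (0 < W (s / 2))%R by case: vW => _ Wp _ _; apply: Wp; lra.
apply: (@lt_le_trans _ _ (\int[mu]_(x in `[0%R, b]) (W (s / 2))%:E)).
  rewrite integral_cst//= lebesgue_measure_itv/= lte_fin bp oppr0 addr0.
  by rewrite -EFinM lte_fin mulr_gt0.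
rewrite integral_mkcond; apply: le_integral_ge0 => x; rewrite patchE.
  by case: ifPn => // _; rewrite lee_fin ltW.
case: ifPn => [|_]; last by rewrite lee_fin fiber_ge0.
rewrite inE/= in_itv/= => /andP[x0 xb]; rewrite lee_fin /fiber x0.
case: vW => _ _ Wnd _; apply: Wnd.
by have := gauge_nd gf xb; lra.
Qed.

Lemma vol_nd : {homo vol : x y / (x <= y)%R}.
Proof.
move=> s s' ss'; rewrite -lee_fin !volE; apply: le_integral_ge0 => x.
  by rewrite lee_fin fiber_ge0.
by rewrite lee_fin fiber_nd.
Qed.

End efron_step.

(** Here [a], [b] are the masses to the left and right of a cut of total [V], and [c], [e] those of
    a cut of total [V']. A smaller right part of a larger total is a smaller proportion. *)
Lemma head_le_of_tail {R : realFieldType} (V V' a b c e : R) : 0 <= e -> e <= b ->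
  0 <= V -> V <= V' -> a + b = V -> c + e = V' -> a * V' <= c * V.
Proof.
move=> e0 eb V0 VV' ab ce.
have -> : a = V - b by lra.
have -> : c = V' - e by lra.
have := ler_pM e0 V0 eb VV'; lra.
Qed.

Lemma lee_mul_swap {R : realDomainType} (v v' : R) (I I' : \bar R) :
  0 <= v -> 0 <= v' -> (I <= I' -> v%:E * I * v'%:E <= v'%:E * I' * v%:E)%E.
Proof.
move=> v0 v0' II; rewrite muleAC [leRHS]muleAC [(v'%:E * v%:E)%E]muleC.
by apply: lee_wpmul2l => //; rewrite -EFinM lee_fin mulr_ge0.
Qed.

Section efron_coupling.
Context {R : realType}.
Local Notation mu := (@lebesgue_measure R).
Variables (f W : R -> R) (gf : gauge f) (vW : volume_like W).
Local Notation fiber := (fiber f W).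
Local Notation evol := (evol f W).
Local Notation vol := (vol f W).
Local Open Scope ereal_scope.

Let Wnd : {homo W : x y / (x <= y)%R}. Proof. by case: vW. Qed.

Let mfiber s : measurable_fun setT (fun x => (fiber s x)%:E).
Proof. by apply/measurable_EFinP; exact: measurable_fiber. Qed.

Let efiber_ge0 s x : 0 <= (fiber s x)%:E.
Proof. by rewrite lee_fin (fiber_ge0 f vW). Qed.

Definition fiber_head s a := \int[mu]_(x in `]-oo, a]) (fiber s x)%:E.
Definition fiber_tail s a := \int[mu]_(x in `]a, +oo[) (fiber s x)%:E.

Let head_ge0 s a : 0 <= fiber_head s a.
Proof. exact: integral_ge0. Qed.

Let tail_ge0 s a : 0 <= fiber_tail s a.
Proof. exact: integral_ge0. Qed.

Let head_tail s a : fiber_head s a + fiber_tail s a = evol s.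
Proof.
rewrite -ge0_integral_setU//.
- by congr (integral _ _ _); apply/seteqP; split=> // x _ /=;
    rewrite !in_itv/= andbT; case: leP; [left|right].
- exact: (measurable_funTS (mfiber s)).
- apply/disj_set2P; apply/seteqP; split => // x [/=]; rewrite !in_itv/= andbT.
  by case: leP.
Qed.

(* Translation by x0' - x0: the increments of f are larger to the right. *)
Lemma fiber_tail_le s s' x0 x0' : (0 <= x0 -> x0 <= x0' ->
  s' - s <= f x0' - f x0)%R -> (0 <= x0)%R -> (x0 <= x0')%R ->
  fiber_tail s' x0' <= fiber_tail s x0.
Proof.
move=> ds x00 x0x; have {}ds := ds x00 x0x.
rewrite /fiber_tail integral_mkcond [leRHS]integral_mkcond.
rewrite -(integral_shift (x0' - x0)%R); last 2 first.
  - by apply: (measurable_patch _ (mfiber s')).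
  - by move=> x; rewrite patchE; case: ifP.
apply: le_integral_ge0 => x; first by rewrite patchE; case: ifP.
rewrite !patchE; case: ifPn => [|_]; last by case: ifP.
rewrite inE/= in_itv/= andbT => xx.
have x0lt : (x0 < x)%R by lra.
rewrite mem_set/= ?in_itv/= ?andbT// lee_fin /fiber.
rewrite (le_trans x00 (ltW x0lt)) ifT; last by lra.
apply: Wnd.
have e0 : (0 <= x0' - x0)%R by lra.
have := gauge_incr gf (ltW x0lt) e0; rewrite (_ : x0 + (x0' - x0) = x0')%R; lra.
Qed.

(** Likelihood ratio order: [fiber s' / fiber s] is nondecreasing in [x], because [W] is log-concave
    and [f] nondecreasing. The pointwise form [key] is integrated over [x <= a < y]; adding the
    product of the two heads to both sides turns the tails into totals. *)
Lemma fiber_head_le s s' a : (s <= s')%R ->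
  fiber_head s' a * evol s <= fiber_head s a * evol s'.
Proof.
move=> ss'.
have key x y : (x <= a)%R -> (a < y)%R ->
    (fiber s' x * fiber s y <= fiber s x * fiber s' y)%R.
  move=> xa ay; rewrite /fiber.
  case: ifP => [x0|_]; last by rewrite !mul0r.
  have -> : (0 <= y)%R by lra.
  case: vW => _ _ _ /(_ (s - f x) (s - f y) (s' - s))%R.
  have := gauge_nd gf (le_trans xa (ltW ay)) => fxy.
  rewrite (_ : s - f x + (s' - s) = s' - f x)%R; last by ring.
  rewrite (_ : s - f y + (s' - s) = s' - f y)%R; last by ring.
  by apply; lra.
have key2 y : (a < y)%R ->
    fiber_head s' a * (fiber s y)%:E <= fiber_head s a * (fiber s' y)%:E.
  move=> ay; rewrite -!ge0_integralZr//; try exact: (measurable_funTS (mfiber _)).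
  rewrite integral_mkcond [leRHS]integral_mkcond.
  apply: le_integral_ge0 => x; rewrite !patchE; case: ifPn => //.
    by move=> _; rewrite mule_ge0.
  by rewrite inE/= in_itv/= => xa; rewrite -!EFinM lee_fin key.
have key3 : fiber_head s' a * fiber_tail s a <= fiber_head s a * fiber_tail s' a.
  rewrite -!ge0_integralZl//; try exact: (measurable_funTS (mfiber _)).
  rewrite integral_mkcond [leRHS]integral_mkcond.
  apply: le_integral_ge0 => x; rewrite !patchE; case: ifPn => //.
    by move=> _; rewrite mule_ge0.
  by rewrite inE/= in_itv/= andbT; exact: key2.
rewrite -(head_tail s a) -(head_tail s' a).
move: (head_ge0 s a) (head_ge0 s' a) (tail_ge0 s a) (tail_ge0 s' a) key3.
move: (fiber_head s a) (fiber_head s' a) (fiber_tail s a) (fiber_tail s' a).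
move=> A A' B B' A0 A0' B0 B0' AB; rewrite !ge0_muleDr//.
by rewrite [A' * A]muleC; exact: leeD.
Qed.

Section prob.
Variables (s : R) (s0 : (0 < s)%R).

Definition fiber_pdf x : R := (fiber s x / vol s)%R.

Lemma fiber_pdf_ge0 x : (0 <= fiber_pdf x)%R.
Proof. by rewrite divr_ge0// ?(fiber_ge0 f vW)// vol_ge0. Qed.

Lemma measurable_fiber_pdf : measurable_fun setT fiber_pdf.
Proof. by apply: measurable_funM => //; exact: measurable_fiber. Qed.

Lemma integral_fiber_pdf : \int[mu]_x (fiber_pdf x)%:E = 1.
Proof.
under eq_integral do rewrite /fiber_pdf EFinM.
rewrite ge0_integralZr//; [|exact: mfiber|by rewrite lee_fin invr_ge0 vol_ge0].
by rewrite -/(evol s) -volE// -EFinM divff// gt_eqF// vol_gt0.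
Qed.

Definition fiber_prob : probability R R :=
  pdf_prob fiber_pdf_ge0 measurable_fiber_pdf integral_fiber_pdf.

Lemma fiber_probE a :
  fiber_prob `]-oo, a]%classic = fiber_head s a * (vol s)^-1%:E.
Proof.
rewrite /= /pdf_prob /fiber_head -ge0_integralZr//.
- exact: (measurable_funTS (mfiber s)).
- by rewrite lee_fin invr_ge0 vol_ge0.
Qed.

Lemma integral_fiber_prob (g : R -> \bar R) : measurable_fun setT g ->
  (forall x, 0 <= g x) ->
  \int[mu]_x (g x * (fiber s x)%:E) = (vol s)%:E * \int[fiber_prob]_x g x.
Proof.
move=> mg g0; rewrite integral_pdf_prob// -ge0_integralZl//.
- apply: eq_integral => x _; rewrite muleCA -EFinM; congr (_ * _%:E).
  by rewrite mulrC divfK// gt_eqF// vol_gt0.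
- apply: emeasurable_funM => //.
  by apply/measurable_EFinP; exact: measurable_fiber_pdf.
- by move=> x _; rewrite mule_ge0// lee_fin fiber_pdf_ge0.
- by rewrite lee_fin vol_ge0.
Qed.

Lemma fiber_quantile_ge0 t : (0 <= quantile fiber_prob t)%R.
Proof.
rewrite leNgt; apply/negP => q0.
have := quantileP fiber_prob t (quantile fiber_prob t).
rewrite lexx fiber_probE => /esym.
rewrite /fiber_head integral0_eq ?mul0e ?lee_fin ?leNgt ?level_gt0//.
by move=> x /=; rewrite in_itv/= => xq; rewrite /fiber leNgt (le_lt_trans xq).
Qed.

End prob.

Variables (s s' : R) (s0 : (0 < s)%R) (ss' : (s <= s')%R).
Let s0' : (0 < s')%R := lt_le_trans s0 ss'.
Local Notation p := (fiber_prob s0).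
Local Notation p' := (fiber_prob s0').

Lemma fiber_quantile_le t : (quantile p t <= quantile p' t)%R.
Proof.
rewrite quantileP.
have : (level t)%:E <= p' `]-oo, quantile p' t]%classic by rewrite -quantileP.
move=> /le_trans; apply; rewrite !fiber_probE.
have vs := vol_gt0 gf vW s0; have vs' := vol_gt0 gf vW s0'.
rewrite lee_pdivrMr// muleAC lee_pdivlMr// !volE//; exact: fiber_head_le.
Qed.

(** Let [f y = f q + (s' - s)]. By translation the fiber of height [s'] has no more mass beyond [y]
    than the fiber of height [s] has beyond [q], while its total is larger; hence [y] already lies
    beyond the quantile at height [s']. *)
Lemma fiber_quantile_ge t :
  (f (quantile p' t) <= f (quantile p t) + (s' - s))%R.
Proof.
set q := quantile p t; have q0 : (0 <= q)%R := fiber_quantile_ge0 s0 t.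
have fq : (0 <= f q + (s' - s))%R by rewrite addr_ge0 ?subr_ge0// (gauge_ge0 q gf).
have [y y0 fy] := gauge_surj gf fq.
have qy : (q <= y)%R.
  rewrite leNgt; apply/negP => yq; have := gauge_inc gf y0 yq.
  by rewrite fy ltNge lerDl subr_ge0 ss'.
suff qy' : (quantile p' t <= y)%R by apply: le_trans (gauge_nd gf qy') _; rewrite fy.
rewrite quantileP.
have : (level t)%:E <= p `]-oo, q]%classic by rewrite -quantileP.
move=> /le_trans; apply; rewrite !fiber_probE.
have vs := vol_gt0 gf vW s0; have vs' := vol_gt0 gf vW s0'.
rewrite lee_pdivrMr// muleAC lee_pdivlMr//.
have tl : fiber_tail s' y <= fiber_tail s q.
  by apply: fiber_tail_le => // _ _; rewrite fy; lra.
have vv : (vol s <= vol s')%R by exact: vol_nd.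
have h1 := head_tail s q; have h2 := head_tail s' y.
rewrite -volE// in h1; rewrite -volE// in h2.
have fin (a b : \bar R) (v : R) : 0 <= a -> 0 <= b -> a + b = v%:E ->
  a \is a fin_num /\ b \is a fin_num.
  by case: a => [a| |]//; case: b => [b| |].
have [f1 f2] := fin _ _ _ (head_ge0 _ _) (tail_ge0 _ _) h1.
have [f3 f4] := fin _ _ _ (head_ge0 _ _) (tail_ge0 _ _) h2.
have t0 := tail_ge0 s' y.
move: h1 h2 tl t0; rewrite -(fineK f1) -(fineK f2) -(fineK f3) -(fineK f4).
set a := fine _; set b := fine _; set c := fine _; set e := fine _.
rewrite -!EFinD -!EFinM !lee_fin => -[ab] [ce] eb e0.
exact: (head_le_of_tail e0 eb (ltW vs) vv ab ce).
Qed.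

(* Efron's coupling: as s grows to s', the point of the fiber moves to the right
   by less than what s' - s allows. *)
Lemma efron_le (g g' : R -> \bar R) :
  measurable_fun setT g -> measurable_fun setT g' ->
  (forall x, 0 <= g x) -> (forall x, 0 <= g' x) ->
  (forall x y, (0 <= x -> x <= y -> f y <= f x + (s' - s) -> (g x <= g' y)%E)%R) ->
  \int[mu]_x (g x * (fiber s x)%:E) * (vol s')%:E <=
  \int[mu]_x (g' x * (fiber s' x)%:E) * (vol s)%:E.
Proof.
move=> mg mg' g0 g0' gg.
rewrite (integral_fiber_prob s0)// (integral_fiber_prob s0')//.
apply: (lee_mul_swap (vol_ge0 f vW _) (vol_ge0 f vW _)).
rewrite (integral_quantile p mg g0) (integral_quantile p' mg' g0').
apply: le_integral_ge0 => // t; apply: gg.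
- exact: fiber_quantile_ge0.
- exact: fiber_quantile_le.
- exact: fiber_quantile_ge.
Qed.

(** The same coupling for functions that decrease along it, as the growth ratio of [W] does in the
    proof of log-concavity. *)
Lemma efron_ge (g g' : R -> \bar R) :
  measurable_fun setT g -> measurable_fun setT g' ->
  (forall x, 0 <= g x) -> (forall x, 0 <= g' x) ->
  (forall x y, (0 <= x -> x <= y -> f y <= f x + (s' - s) -> (g' y <= g x)%E)%R) ->
  \int[mu]_x (g' x * (fiber s' x)%:E) * (vol s)%:E <=
  \int[mu]_x (g x * (fiber s x)%:E) * (vol s')%:E.
Proof.
move=> mg mg' g0 g0' gg.
rewrite (integral_fiber_prob s0)// (integral_fiber_prob s0')//.
apply: (lee_mul_swap (vol_ge0 f vW _) (vol_ge0 f vW _)).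
rewrite (integral_quantile p' mg' g0') (integral_quantile p mg g0).
apply: le_integral_ge0 => // t; apply: gg.
- exact: fiber_quantile_ge0.
- exact: fiber_quantile_le.
- exact: fiber_quantile_ge.
Qed.

End efron_coupling.

(** * Log-concavity of the volume function *)

Section vol_volume_like.
Context {R : realType}.
Local Notation mu := (@lebesgue_measure R).
Variables (f W : R -> R) (gf : gauge f) (vW : volume_like W).
Local Notation fiber := (fiber f W).
Local Notation evol := (evol f W).
Local Notation vol := (vol f W).
Local Open Scope ereal_scope.

Let Wnd : {homo W : x y / (x <= y)%R}. Proof. by case: vW. Qed.

Let mfiber s : measurable_fun setT (fun x => (fiber s x)%:E).
Proof. by apply/measurable_EFinP; exact: measurable_fiber. Qed.

Let efiber_ge0 s x : 0 <= (fiber s x)%:E.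
Proof. by rewrite lee_fin (fiber_ge0 f vW). Qed.

Section growth.
Variables (d : R) (d0 : (0 <= d)%R).

(** The value [+oo] where [W] vanishes keeps [growth] nonincreasing. What the points with
    [+oo * 0 = 0] lose in the product with the fiber is restored by [excess_fiber]. *)
Definition growth (r : R) : \bar R :=
  if (0 < W r)%R then (W (r + d) / W r)%:E else +oo.

Definition excess_fiber s x : R :=
  if (W (s - f x) == 0)%R then fiber (s + d) x else 0%R.

Lemma growth_ge0 r : 0 <= growth r.
Proof.
rewrite /growth; case: ifPn => [_|_]; last exact: leey.
by rewrite lee_fin divr_ge0// volume_like_ge0.
Qed.

Lemma growth_ni r r' : (r <= r')%R -> growth r' <= growth r.
Proof.
move=> rr'; rewrite /growth; case: (ltP 0%R (W r)) => Wr; last exact: leey.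
have Wr' : (0 < W r')%R by exact: lt_le_trans Wr (Wnd rr').
rewrite Wr' lee_fin ler_pdivrMr// mulrAC ler_pdivlMr//.
case: vW => _ _ _ lc; have := lc r' r d rr' d0.
by rewrite [X in (_ <= X)%R]mulrC.
Qed.

Lemma measurable_growth s : measurable_fun setT (fun x => growth (s - f x)).
Proof.
have mg : measurable_fun setT (fun x => s - f x)%R.
  by apply: measurable_funB => //; exact: measurable_gauge.
have mW := measurable_volume_like vW.
apply: (measurable_fun_ifT (g := fun x => (W (s - f x + d) / W (s - f x))%:E)) => //.
- apply: measurable_fun_ltr => //; exact: (measurableT_comp mW).
- apply/measurable_EFinP; apply: measurable_funM.
    by apply: (measurableT_comp mW); exact: measurable_funD.
  under eq_fun do rewrite -powR_inv1 ?volume_like_ge0//.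
  apply: (measurableT_comp (measurable_powR (-1)%R)).
  exact: (measurableT_comp mW).
Qed.

Lemma excess_fiber_ge0 s x : (0 <= excess_fiber s x)%R.
Proof. by rewrite /excess_fiber; case: ifP => // _; exact: (fiber_ge0 f vW). Qed.

Lemma measurable_excess_fiber s : measurable_fun setT (excess_fiber s).
Proof.
have mg : measurable_fun setT (fun x => s - f x)%R.
  by apply: measurable_funB => //; exact: measurable_gauge.
apply: measurable_fun_ifT => //; last exact: measurable_fiber.
apply: measurable_fun_eqr => //.
exact: (measurableT_comp (measurable_volume_like vW)).
Qed.

Lemma fiberD s x : (fiber (s + d) x)%:E =
  growth (s - f x) * (fiber s x)%:E + (excess_fiber s x)%:E.
Proof.
rewrite /excess_fiber /growth /fiber; case: (leP 0%R x) => [x0|_]; last first.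
  by rewrite mule0 if_same adde0.
case: ltP => [Wp|]; first by rewrite gt_eqF// adde0 -EFinM divfK ?gt_eqF// addrAC.
rewrite le_eqVlt ltNge volume_like_ge0// orbF => /eqP ->.
by rewrite eqxx mule0 add0e.
Qed.

Lemma evolD s : evol (s + d) =
  \int[mu]_x (growth (s - f x) * (fiber s x)%:E) +
  \int[mu]_x (excess_fiber s x)%:E.
Proof.
rewrite /evol -ge0_integralD//.
- by apply: eq_integral => x _; exact: fiberD.
- by move=> x _; rewrite mule_ge0// growth_ge0.
- by apply: emeasurable_funM; [exact: measurable_growth|exact: mfiber].
- by move=> x _; rewrite lee_fin excess_fiber_ge0.
- by apply/measurable_EFinP; exact: measurable_excess_fiber.
Qed.

(** The excess at height [v] lives on [x >= x0] with [f x0 = v], that at height [u] on [x >= y0]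
    with [f y0 = u]. A translation by [y0 - x0] superposes the two, and [f] gains at least [u - v]
    under it. *)
Lemma integral_excess_fiber_le u v : (0 <= v)%R -> (v <= u)%R ->
  \int[mu]_x (excess_fiber u x)%:E <= \int[mu]_x (excess_fiber v x)%:E.
Proof.
move=> v0 vu; have [x0 x00 fx0] := gauge_surj gf v0.
have [y0 y00 fy0] := gauge_surj gf (le_trans v0 vu).
have xy : (x0 <= y0)%R.
  rewrite leNgt; apply/negP => yx; have := gauge_inc gf y00 yx.
  by rewrite fx0 fy0 ltNge vu.
rewrite -(integral_shift (y0 - x0)%R); last 2 first.
  - by apply/measurable_EFinP; exact: measurable_excess_fiber.
  - by move=> x; rewrite lee_fin excess_fiber_ge0.
apply: le_integral_ge0 => x; rewrite lee_fin ?excess_fiber_ge0//.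
rewrite {1}/excess_fiber; case: eqP => [Wu|_]; last exact: excess_fiber_ge0.
have [xx0|x0x] := ltP x x0.
  have [xn|xp] := ltP (x + (y0 - x0))%R 0%R.
    by rewrite {1}/fiber ifN ?excess_fiber_ge0// -ltNge.
  have xy0 : (x + (y0 - x0) < y0)%R by lra.
  have fx := gauge_inc gf xp xy0.
  case: vW => _ Wp _ _; have := Wp (u - f (x + (y0 - x0)))%R.
  by rewrite Wu ltxx subr_gt0 -fy0 fx => /(_ isT).
have e0 : (0 <= y0 - x0)%R by lra.
have inc := gauge_incr gf x0x e0.
rewrite (_ : x0 + (y0 - x0) = y0)%R in inc; last by ring.
rewrite fx0 fy0 in inc.
rewrite /excess_fiber.
have -> : W (v - f x) = 0%R.
  (* At [x = x0] both heights left are 0, and [Wu] itself says that [W 0 = 0]. *)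
  move: x0x; rewrite le_eqVlt => /predU1P[xx|x0x].
    by move: Wu; rewrite -xx [(x0 + _)%R]addrC subrK fx0 fy0 !subrr.
  case: vW => W0 _ _ _; apply: W0; rewrite subr_lt0 -fx0.
  exact: gauge_inc.
rewrite eqxx /fiber (le_trans x00 x0x) ifT; last by lra.
by apply: Wnd; lra.
Qed.

End growth.

(** The ratio [vol (s + d) / vol s] is the mean of [growth (s - f x)] under the law of the fiber,
    plus the excess divided by [vol s]. The mean decreases in [s] by the coupling, the excess by
    translation, and [vol] increases. *)
Lemma vol_logconcave : logconcave vol.
Proof.
move=> u v d vu d0; have [v0|v0] := leP v 0%R.
  by rewrite (vol_le0 gf vW v0) mulr0 mulr_ge0// vol_ge0.
rewrite -lee_fin !EFinM !volE// (evolD d u) (evolD d v).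
have key x y : (0 <= x -> x <= y -> f y <= f x + (u - v) ->
    (growth d (u - f y) <= growth d (v - f x))%E)%R.
  by move=> _ _ fxy; apply: (growth_ni d0); lra.
have := efron_ge gf vW v0 vu (measurable_growth d v) (measurable_growth d u)
  (fun x => growth_ge0 d _) (fun x => growth_ge0 d _) key.
rewrite !volE//.
have := integral_excess_fiber_le d (ltW v0) vu.
have : evol v <= evol u by rewrite -!volE// lee_fin vol_nd.
have : 0 <= evol v by rewrite -volE// lee_fin vol_ge0.
have : 0 <= evol u by rewrite -volE// lee_fin vol_ge0.
have : 0 <= \int[mu]_x (growth d (u - f x) * (fiber u x)%:E).
  by apply: integral_ge0 => x _; rewrite mule_ge0// growth_ge0.
have : 0 <= \int[mu]_x (growth d (v - f x) * (fiber v x)%:E).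
  by apply: integral_ge0 => x _; rewrite mule_ge0// growth_ge0.
have : 0 <= \int[mu]_x (excess_fiber d u x)%:E.
  by apply: integral_ge0 => x _; rewrite lee_fin excess_fiber_ge0.
have : 0 <= \int[mu]_x (excess_fiber d v x)%:E.
  by apply: integral_ge0 => x _; rewrite lee_fin excess_fiber_ge0.
move: (\int[mu]_x (excess_fiber d v x)%:E) (\int[mu]_x (excess_fiber d u x)%:E).
move: (\int[mu]_x (growth d (v - f x) * _)) (\int[mu]_x (growth d (u - f x) * _)).
move: (evol u) (evol v) => Vu Vv Iv Iu Ev Eu Ev0 Eu0 Iv0 Iu0 Vu0 Vv0 VV EE II.
rewrite ge0_muleDl// [leRHS]muleC ge0_muleDl//; apply: leeD => //.
exact: lee_pmul.
Qed.

Lemma vol_volume_like : volume_like vol.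
Proof.
split; [|exact: vol_gt0|exact: vol_nd|exact: vol_logconcave].
by move=> r r0; apply: vol_le0 => //; exact: ltW.
Qed.

End vol_volume_like.

(** * Products of measures on the line *)

Section mcons.
Context {R : realType} {n : nat}.
Variable m0 : {sigma_finite_measure set R -> \bar R}.
Variable m : {sigma_finite_measure set (n.-tuple R) -> \bar R}.

(** [cons_measure] with an arbitrary first factor, since the laws of the coordinates differ. *)
Definition mcons : set (n.+1.-tuple R) -> \bar R :=
  pushforward (m0 \x m)%E (@tuple_cons R n).

Let mpreimage (A : set (n.+1.-tuple R)) :
  measurable A -> measurable (@tuple_cons R n @^-1` A).
Proof.
by move=> mA; rewrite -[X in measurable X]setTI; exact: measurable_tuple_cons.
Qed.

Let mcons0 : mcons set0 = 0%E.
Proof. by rewrite /mcons /pushforward preimage_set0 measure0. Qed.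

Let mcons_ge0 A : (0 <= mcons A)%E.
Proof. by rewrite /mcons /pushforward measure_ge0. Qed.

Let mcons_sigma_additive : semi_sigma_additive mcons.
Proof.
move=> F mF tF mUF; rewrite /mcons /pushforward preimage_bigcup.
apply: (@measure_semi_sigma_additive _ _ _ (m0 \x m)%E) => [i||].
- exact: (mpreimage (mF i)).
- apply/trivIsetP => /= i j _ _ ij; rewrite -preimage_setI.
  by move/trivIsetP : tF => /(_ _ _ _ _ ij) ->//; rewrite preimage_set0.
- by rewrite -preimage_bigcup; exact: mpreimage.
Qed.

HB.instance Definition _ := isMeasure.Build _ _ _ mcons
  mcons0 mcons_ge0 mcons_sigma_additive.

Let mcons_sigma_finite : sigma_finite setT mcons.
Proof.
have /sigma_finiteP[F [TF ndF Foo]] := sigma_finiteT m0.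
have /sigma_finiteP[G [TG ndG Goo]] := sigma_finiteT m.
pose u (t : n.+1.-tuple R) : R * n.-tuple R :=
  (tnth t ord0, [tuple of behead t]).
have consu p : u (tuple_cons p) = p.
  by case: p => x t; congr pair; apply: val_inj.
have mu : measurable_fun setT u.
  apply: measurable_fun_pair; first exact: measurable_tnth.
  exact: measurable_behead.
exists (fun i => u @^-1` (F i `*` G i)).
  apply/esym/seteqP; split=> // t _.
  have [/= i _ Fi] : (\bigcup_i F i) (u t).1 by rewrite -TF.
  have [/= j _ Gj] : (\bigcup_i G i) (u t).2 by rewrite -TG.
  exists (maxn i j) => //; split.
  - by have /subsetPset := ndF _ _ (leq_maxl i j); exact.
  - by have /subsetPset := ndG _ _ (leq_maxr i j); exact.
move=> i; have [mF Fi] := Foo i; have [mG Gi] := Goo i; split.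
  by rewrite -[X in measurable X]setTI; apply: mu => //; exact: measurableX.
rewrite /mcons /pushforward -comp_preimage.
rewrite (_ : u \o tuple_cons (n:=n) = id) ?preimage_id; last exact/funext.
by rewrite product_measure1E// lte_mul_pinfty// ge0_fin_numE.
Qed.

HB.instance Definition _ := Measure_isSigmaFinite.Build _ _ _ mcons
  mcons_sigma_finite.

Local Open Scope ereal_scope.

Lemma integral_mcons (g : n.+1.-tuple R -> \bar R) :
  measurable_fun setT g -> (forall x, 0 <= g x) ->
  \int[mcons]_z g z = \int[m0]_x \int[m]_t g (tuple_cons (x, t)).
Proof.
move=> mg g0.
rewrite ge0_integral_pushforward//; last exact: measurable_tuple_cons.
apply: (fubini_tonelli1 (fun p : R * n.-tuple R => g (tuple_cons p))) => //.
by apply: measurableT_comp => //; exact: measurable_tuple_cons.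
Qed.

End mcons.

Section sections.
Context {R : realType} {n : nat}.
Local Open Scope ereal_scope.
Implicit Type g : n.+1.-tuple R -> \bar R.

Lemma measurable_cons_section g x : measurable_fun setT g ->
  measurable_fun setT (fun t : n.-tuple R => g (tuple_cons (x, t))).
Proof.
move=> mg; apply: (measurableT_comp mg).
apply: (measurableT_comp (@measurable_tuple_cons R n)).
exact: measurable_pair1.
Qed.

Lemma measurable_cons_integral (m : {sigma_finite_measure set (n.-tuple R) -> \bar R}) g :
  measurable_fun setT g -> (forall x, 0 <= g x) ->
  measurable_fun setT (fun x : R => \int[m]_t g (tuple_cons (x, t))).
Proof.
move=> mg g0.
apply: (@measurable_fun_fubini_tonelli_F _ _ _ _ _ m
  (fun p : R * n.-tuple R => g (tuple_cons p))) => //.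
by apply: measurableT_comp => //; exact: measurable_tuple_cons.
Qed.

Lemma integral_cons_swap (m0 : {sigma_finite_measure set R -> \bar R})
    (m : {sigma_finite_measure set (n.-tuple R) -> \bar R}) g :
  measurable_fun setT g -> (forall x, 0 <= g x) ->
  \int[m0]_x \int[m]_t g (tuple_cons (x, t)) =
  \int[m]_t \int[m0]_x g (tuple_cons (x, t)).
Proof.
move=> mg g0.
apply: (@fubini_tonelli _ _ _ _ _ m0 m (fun p : R * n.-tuple R => g (tuple_cons p))) => //.
by apply: measurableT_comp => //; exact: measurable_tuple_cons.
Qed.

End sections.

(* The library's Lebesgue measure lives on [measurableTypeR R]. *)
Definition leb {R : realType} : set R -> \bar R := @lebesgue_measure R.

Section leb.
Context {R : realType}.

HB.instance Definition _ := isMeasure.Build _ R R (@leb R)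
  (@measure0 _ _ _ (@lebesgue_measure R))
  (@measure_ge0 _ _ _ (@lebesgue_measure R))
  (@measure_semi_sigma_additive _ _ _ (@lebesgue_measure R)).

HB.instance Definition _ := Measure_isSigmaFinite.Build _ R R (@leb R)
  (@sigma_finiteT _ _ _ (@lebesgue_measure R)).

Lemma integral_leb (g : R -> \bar R) : measurable_fun setT g ->
  (forall x, 0 <= g x)%E ->
  (\int[leb]_x g x = \int[lebesgue_measure]_x g x)%E.
Proof.
move=> mg g0; pose phi (x : measurableTypeR R) : R := x.
have mphi : measurable_fun setT phi by exact: (@measurable_id _ R setT).
pose phiM : {mfun _ >-> _} :=
  HB.pack phi (isMeasurableFun.Build _ _ _ _ _ mphi).
transitivity (\int[pushforward (@lebesgue_measure R) phiM]_x g x)%E.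
  by apply: eq_measure_integral.
by rewrite ge0_integral_pushforward.
Qed.

End leb.

Fixpoint mprod {R : realType} (n : nat) :
    ('I_n -> {sigma_finite_measure set R -> \bar R}) ->
    {sigma_finite_measure set (n.-tuple R) -> \bar R} :=
  match n with
  | 0%N => fun _ => \d_[tuple]
  | k.+1 => fun m => mcons (m ord0) (@mprod R k (fun i => m (lift ord0 i)))
  end.

Section mprod.
Context {R : realType}.
Local Open Scope ereal_scope.
Local Notation SFM := {sigma_finite_measure set R -> \bar R}.

Lemma integral_mprod0 (m : 'I_0 -> SFM) (g : 0.-tuple R -> \bar R) :
  measurable_fun setT g -> \int[mprod m]_x g x = g [tuple].
Proof. by move=> mg; rewrite /= integral_dirac// diracE mem_set// mul1e. Qed.

Lemma integral_mprodS n (m : 'I_n.+1 -> SFM) (g : n.+1.-tuple R -> \bar R) :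
  measurable_fun setT g -> (forall x, 0 <= g x) ->
  \int[mprod m]_z g z =
  \int[m ord0]_x \int[mprod (fun i => m (lift ord0 i))]_t g (tuple_cons (x, t)).
Proof. exact: integral_mcons. Qed.

Lemma integral_lebesgue_tuple n (g : n.-tuple R -> \bar R) :
  measurable_fun setT g -> (forall x, 0 <= g x) ->
  \int[lebesgue_measure_tuple R n]_z g z =
  \int[mprod (fun _ : 'I_n => leb)]_z g z.
Proof.
elim: n g => [|n ih] g mg g0; first by [].
rewrite integral_mprodS//.
transitivity (\int[@lebesgue_measure R]_x
    \int[lebesgue_measure_tuple R n]_t g (tuple_cons (x, t))).
  have mgc : measurable_fun setT
      (fun p : measurableTypeR R * n.-tuple R => g (tuple_cons p)).
    exact: (measurableT_comp mg (@measurable_tuple_cons R n)).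
  rewrite /= /cons_measure.
  rewrite ge0_integral_pushforward//; last exact: measurable_tuple_cons.
  exact: (fubini_tonelli1 _ mgc).
rewrite -integral_leb; last 2 first.
  - exact: measurable_cons_integral.
  - by move=> x; exact: integral_ge0.
apply: eq_integral => x _; apply: ih => //; exact: measurable_cons_section.
Qed.

Lemma integral_mprod_le n (m m' : 'I_n -> SFM) (c : R) : (0 <= c)%R ->
  (forall i g, measurable_fun setT g -> (forall x, 0 <= g x) ->
    \int[m i]_x g x <= c%:E * \int[m' i]_x g x) ->
  forall g : n.-tuple R -> \bar R, measurable_fun setT g -> (forall x, 0 <= g x) ->
  \int[mprod m]_x g x <= (c ^+ n)%:E * \int[mprod m']_x g x.
Proof.
move=> c0; elim: n m m' => [|n ih] m m' mm g mg g0.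
  by rewrite !integral_mprod0// expr0 mul1e.
rewrite !integral_mprodS//.
set m1 := fun i => m (lift _ i); set m1' := fun i => m' (lift _ i).
apply: (@le_trans _ _ (\int[m ord0]_x
    ((c ^+ n)%:E * \int[mprod m1']_t g (tuple_cons (x, t))))).
  apply: le_integral_ge0 => x; first exact: integral_ge0.
  apply: ih => //; first by move=> i; exact: mm.
  exact: measurable_cons_section.
have mI := measurable_cons_integral (mprod m1') mg g0.
rewrite ge0_integralZl//; last 2 first.
  - by move=> x _; exact: integral_ge0.
  - by rewrite lee_fin exprn_ge0.
rewrite exprSr EFinM -muleA; apply: lee_wpmul2l.
  by rewrite lee_fin exprn_ge0.
by apply: mm => // x; exact: integral_ge0.
Qed.

Lemma measurable_tuple_prod n (h : 'I_n -> R -> R) :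
  (forall i, measurable_fun setT (h i)) ->
  measurable_fun setT (fun x : n.-tuple R => (\prod_(i < n) h i (tnth x i))%:E).
Proof.
move=> mh; apply/measurable_EFinP; apply: measurable_prod => i _.
by apply: (measurableT_comp (mh i)); exact: measurable_tnth.
Qed.

Lemma integral_mprod_density n (m m' : 'I_n -> SFM) (k : 'I_n -> R -> R) :
  (forall i x, (0 <= k i x)%R) -> (forall i, measurable_fun setT (k i)) ->
  (forall i g, measurable_fun setT g -> (forall x, 0 <= g x) ->
    \int[m i]_x g x = \int[m' i]_x (g x * (k i x)%:E)) ->
  forall g : n.-tuple R -> \bar R, measurable_fun setT g -> (forall x, 0 <= g x) ->
  \int[mprod m]_x g x =
  \int[mprod m']_x (g x * (\prod_(i < n) k i (tnth x i))%:E).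
Proof.
elim: n m m' k => [|n ih] m m' k k0 mk mm g mg g0.
  rewrite !integral_mprod0//.
    by rewrite big_ord0 mule1.
  by apply: emeasurable_funM => //; exact: measurable_tuple_prod.
have mgk := emeasurable_funM mg (measurable_tuple_prod mk).
rewrite !integral_mprodS//; last first.
  by move=> x; rewrite mule_ge0// lee_fin prodr_ge0.
rewrite mm; last 2 first.
  - exact: measurable_cons_integral.
  - by move=> x; exact: integral_ge0.
apply: eq_integral => x _.
rewrite -ge0_integralZr//; last first.
  by rewrite lee_fin.
- exact: measurable_cons_section.
rewrite (ih _ (fun i => m' (lift ord0 i)) (fun i => k (lift ord0 i)))//.
- apply: eq_integral => t _; rewrite -muleA -EFinM big_ord_recl.
  congr (_ * _%:E); congr (_ * _)%R; apply: eq_bigr => i _.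
  by rewrite tnthS.
- by move=> i h mh h0; exact: mm.
- by apply: emeasurable_funM => //; exact: measurable_cons_section.
- by move=> t; rewrite mule_ge0// lee_fin.
Qed.

End mprod.

Section upd.
Context {R : realType}.

Definition upd {n} (x : n.-tuple R) (i : 'I_n) (y : R) : n.-tuple R :=
  [tuple if j == i then y else tnth x j | j < n].

Lemma tnth_upd n (x : n.-tuple R) i y j :
  tnth (upd x i y) j = if j == i then y else tnth x j.
Proof. by rewrite tnth_mktuple. Qed.

Lemma upd_cons0 n (t : n.-tuple R) x y :
  upd (tuple_cons (x, t)) ord0 y = tuple_cons (y, t).
Proof.
apply: eq_from_tnth => j; rewrite tnth_upd.
by case: (unliftP ord0 j) => [k|] ->; rewrite ?eqxx// -(inj_eq val_inj)/= !tnthS.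
Qed.

Lemma upd_consS n (t : n.-tuple R) x i y :
  upd (tuple_cons (x, t)) (lift ord0 i) y = tuple_cons (x, upd t i y).
Proof.
apply: eq_from_tnth => j; rewrite tnth_upd.
case: (unliftP ord0 j) => [k|] -> //.
by rewrite (inj_eq lift_inj) !tnthS tnth_upd.
Qed.

Lemma measurable_upd n (i : 'I_n) :
  measurable_fun setT (fun p : n.-tuple R * R => upd p.1 i p.2).
Proof.
apply/measurable_fun_tnthP => j.
apply: (eq_measurable_fun
  (fun p : n.-tuple R * R => if j == i then p.2 else tnth p.1 j)).
  by move=> p _; rewrite /= tnth_upd.
case: (j == i); first exact: measurable_snd.
by apply: (measurableT_comp (measurable_tnth j)); exact: measurable_fst.
Qed.

End upd.

Section mprod_prob.
Context {R : realType}.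
Local Open Scope ereal_scope.
Local Notation SFM := {sigma_finite_measure set R -> \bar R}.

Lemma integral_prob_cst (m : SFM) (c : \bar R) : m setT = 1 ->
  \int[m]_x cst c x = c.
Proof. by move=> m1; rewrite integral_cst// -[RHS]mule1; congr (_ * _). Qed.

Lemma mprodT n (m : 'I_n -> SFM) : (forall i, m i setT = 1) -> mprod m setT = 1.
Proof.
elim: n m => [|n ih] m m1; first by rewrite /= diracE in_setT.
rewrite -[LHS]mul1e -integral_cst// integral_mprodS//.
rewrite (eq_integral (cst 1)) => [|x _]; first exact: integral_prob_cst.
rewrite -[LHS]/(\int[mprod (fun i => m (lift ord0 i))]_t cst 1 t).
by rewrite integral_cst// -[RHS]mule1; congr (_ * _); exact: ih.
Qed.

Lemma integral_mprod_cst n (m : 'I_n -> SFM) (c : \bar R) :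
  (forall i, m i setT = 1) -> \int[mprod m]_x cst c x = c.
Proof. by move=> m1; rewrite integral_cst// -[RHS]mule1; congr (_ * _); exact: mprodT. Qed.

Lemma measurable_upd_section n (g : n.-tuple R -> \bar R) x i :
  measurable_fun setT g -> measurable_fun setT (fun y => g (upd x i y)).
Proof.
move=> mg; apply: (measurableT_comp mg).
exact: (measurableT_comp (measurable_upd i) (measurable_pair1 x)).
Qed.

Lemma measurable_upd_integral n (m : SFM) (g : n.-tuple R -> \bar R) i :
  measurable_fun setT g -> (forall x, 0 <= g x) ->
  measurable_fun setT (fun x => \int[m]_y g (upd x i y)).
Proof.
move=> mg g0.
apply: (@measurable_fun_fubini_tonelli_F _ _ _ _ _ m
  (fun p : n.-tuple R * R => g (upd p.1 i p.2))) => //.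
by apply: measurableT_comp => //; exact: measurable_upd.
Qed.

(** Drawing coordinate [i] afresh does not change a product of probabilities. This isolates any
    coordinate without permuting the tuple. *)
Lemma integral_resample n (m : 'I_n -> SFM) (g : n.-tuple R -> \bar R) i :
  (forall i, m i setT = 1) -> measurable_fun setT g -> (forall x, 0 <= g x) ->
  \int[mprod m]_x g x = \int[mprod m]_x \int[m i]_y g (upd x i y).
Proof.
elim: n m g i => [|n ih] m g i m1 mg g0; first by case: i.
rewrite !integral_mprodS//; last 2 first.
  - exact: measurable_upd_integral.
  - by move=> x; exact: integral_ge0.
case: (unliftP ord0 i) => [j|] ->.
  apply: eq_integral => x _.
  rewrite (ih _ _ j)//; last exact: measurable_cons_section.
  apply: eq_integral => t _; apply: eq_integral => y _.
  by rewrite upd_consS.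
rewrite integral_cons_swap// -[LHS](integral_prob_cst _ (m1 ord0)).
apply: eq_integral => x _; apply: eq_integral => t _.
by apply: eq_integral => y _; rewrite upd_cons0.
Qed.

Lemma integral_mprod_coord n (m : 'I_n -> SFM) (g : R -> \bar R) i :
  (forall i, m i setT = 1) -> measurable_fun setT g -> (forall x, 0 <= g x) ->
  \int[mprod m]_x g (tnth x i) = \int[m i]_y g y.
Proof.
move=> m1 mg g0; rewrite (integral_resample i)//; last first.
  by apply: (measurableT_comp mg); exact: measurable_tnth.
rewrite -[RHS](integral_mprod_cst _ m1); apply: eq_integral => x _.
by apply: eq_integral => y _; rewrite tnth_upd eqxx.
Qed.

Lemma integral_mprod_indep n (m : 'I_n -> SFM) (g : R -> \bar R)
    (k : n.-tuple R -> \bar R) i :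
  (forall i, m i setT = 1) -> measurable_fun setT g -> (forall x, 0 <= g x) ->
  measurable_fun setT k -> (forall x, 0 <= k x) ->
  (forall x y, k (upd x i y) = k x) ->
  \int[mprod m]_x (g (tnth x i) * k x) =
  \int[m i]_y g y * \int[mprod m]_x k x.
Proof.
move=> m1 mg g0 mk k0 ku; rewrite (integral_resample i)//; last 2 first.
  - apply: emeasurable_funM => //.
    by apply: (measurableT_comp mg); exact: measurable_tnth.
  - by move=> x; rewrite mule_ge0.
rewrite -ge0_integralZl//; last exact: integral_ge0.
apply: eq_integral => x _; rewrite -ge0_integralZr//.
by apply: eq_integral => y _; rewrite tnth_upd eqxx ku.
Qed.

End mprod_prob.

(** * Efron's monotonicity in R^n *)

Section sublevel.
Context {R : realType}.
Local Open Scope ereal_scope.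

Definition gauge_sum n (F : 'I_n -> R -> R) (x : n.-tuple R) : R :=
  (\sum_(i < n) F i (tnth x i))%R.

Definition sublevel n (F : 'I_n -> R -> R) (s : R) (x : n.-tuple R) : bool :=
  [forall i, (0 <= tnth x i)%R] && (gauge_sum F x <= s)%R.

Definition integral_sublevel n (F : 'I_n -> R -> R) (s : R)
    (g : n.-tuple R -> \bar R) : \bar R :=
  \int[mprod (fun _ => leb)]_x (g x * (sublevel F s x)%:R%:E).

Definition sublevel_vol n (F : 'I_n -> R -> R) s := integral_sublevel F s (cst 1).

Definition increasing_on_ge0 n (g : n.-tuple R -> \bar R) :=
  forall x y, (forall i, (0 <= tnth x i <= tnth y i)%R) -> g x <= g y.

Definition tail_fam n (F : 'I_n.+1 -> R -> R) (i : 'I_n) := F (lift ord0 i).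

Lemma gauge_sum_cons n (F : 'I_n.+1 -> R -> R) x t :
  gauge_sum F (tuple_cons (x, t)) = (F ord0 x + gauge_sum (tail_fam F) t)%R.
Proof.
rewrite /gauge_sum big_ord_recl; congr (_ + _)%R.
by apply: eq_bigr => i _; rewrite tnthS.
Qed.

Lemma sublevel_cons n (F : 'I_n.+1 -> R -> R) s x t :
  sublevel F s (tuple_cons (x, t)) =
  (0 <= x)%R && sublevel (tail_fam F) (s - F ord0 x)%R t.
Proof.
rewrite /sublevel gauge_sum_cons andbA lerBrDl; congr (_ && _).
apply/forallP/andP => [h|[x0 /forallP h] i].
  split; first exact: (h ord0).
  by apply/forallP => i; have := h (lift ord0 i); rewrite tnthS.
by case: (unliftP ord0 i) => [j|] ->; rewrite ?tnthS.
Qed.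

Lemma measurable_gauge_sum n (F : 'I_n -> R -> R) : (forall i, gauge (F i)) ->
  measurable_fun setT (gauge_sum F).
Proof.
move=> gF; apply: measurable_sum => i.
by apply: (measurableT_comp (measurable_gauge (gF i))); exact: measurable_tnth.
Qed.

Lemma measurable_indb {d} {T : measurableType d} (b : T -> bool) :
  measurable_fun setT b -> measurable_fun setT (fun x => (b x)%:R : R).
Proof.
move=> mb; rewrite (_ : (fun x => _) = (fun x => if b x then 1%R else 0%R)).
  exact: measurable_fun_ifT.
by apply/funext => x; case: (b x).
Qed.

Lemma measurable_nonneg n :
  measurable_fun setT (fun x : n.-tuple R => [forall i, (0 <= tnth x i)%R]%:R : R).
Proof.
rewrite (_ : (fun x => _) =
    (fun x : n.-tuple R => \prod_(i < n) (0 <= tnth x i)%R%:R)%R).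
  apply: measurable_prod => i _; apply: measurable_indb.
  by apply: measurable_fun_ler => //; exact: measurable_tnth.
apply/funext => x; case: forallP => /= [h|/forallP].
  by rewrite big1// => i _; rewrite h.
rewrite negb_forall => /existsP[i /negbTE ni].
by rewrite (bigD1 i)//= ni mul0r.
Qed.

Lemma measurable_sublevel n (F : 'I_n -> R -> R) s : (forall i, gauge (F i)) ->
  measurable_fun setT (fun x => (sublevel F s x)%:R%:E : \bar R).
Proof.
move=> gF; apply/measurable_EFinP.
rewrite (_ : (fun x => _) = (fun x : n.-tuple R =>
    [forall i, (0 <= tnth x i)%R]%:R * (gauge_sum F x <= s)%R%:R)%R).
  apply: measurable_funM; first exact: measurable_nonneg.
  apply: measurable_indb; apply: measurable_fun_ler => //.
  exact: measurable_gauge_sum.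
by apply/funext => x; rewrite /sublevel -natrM mulnb.
Qed.

Lemma gauge_sum_ge0 n (F : 'I_n -> R -> R) x : (forall i, gauge (F i)) ->
  (0 <= gauge_sum F x)%R.
Proof. by move=> gF; apply: sumr_ge0 => i _; exact: gauge_ge0. Qed.

Lemma measurable_fun_sublevel n (F : 'I_n -> R -> R) s (g : n.-tuple R -> \bar R) :
  (forall i, gauge (F i)) ->
  measurable_fun setT g ->
  measurable_fun setT (fun x => g x * (sublevel F s x)%:R%:E).
Proof.
by move=> gF mg; apply: emeasurable_funM => //; exact: measurable_sublevel.
Qed.

Lemma integral_sublevel_section n (F : 'I_n.+1 -> R -> R) s
    (g : n.+1.-tuple R -> \bar R) x : (forall i, gauge (F i)) ->
  measurable_fun setT g -> (forall x, 0 <= g x) ->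
  \int[mprod (fun _ : 'I_n => leb)]_t
    (g (tuple_cons (x, t)) * (sublevel F s (tuple_cons (x, t)))%:R%:E) =
  (0 <= x)%R%:R%:E *
    integral_sublevel (tail_fam F) (s - F ord0 x) (fun t => g (tuple_cons (x, t))).
Proof.
move=> gF mg g0; rewrite -ge0_integralZl//.
- apply: eq_integral => t _; rewrite sublevel_cons.
  by case: (0 <= x)%R => //=; rewrite ?mul1e// mul0e mule0.
- apply: measurable_fun_sublevel; first by move=> i; exact: gF.
  exact: measurable_cons_section.
- by move=> t _; rewrite mule_ge0// lee_fin.
Qed.

Lemma integral_sublevelS n (F : 'I_n.+1 -> R -> R) s
    (g : n.+1.-tuple R -> \bar R) : (forall i, gauge (F i)) ->
  measurable_fun setT g -> (forall x, 0 <= g x) ->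
  integral_sublevel F s g = \int[leb]_x ((0 <= x)%R%:R%:E *
    integral_sublevel (tail_fam F) (s - F ord0 x) (fun t => g (tuple_cons (x, t)))).
Proof.
move=> gF mg g0; rewrite /integral_sublevel integral_mprodS//; last 2 first.
- exact: measurable_fun_sublevel.
- by move=> x; rewrite mule_ge0// lee_fin.
by apply: eq_integral => x _; rewrite integral_sublevel_section.
Qed.

Lemma integral_sublevel_ge0 n (F : 'I_n -> R -> R) s (g : n.-tuple R -> \bar R) :
  (forall x, 0 <= g x) ->
  0 <= integral_sublevel F s g.
Proof. by move=> g0; apply: integral_ge0 => x _; rewrite mule_ge0// lee_fin. Qed.

(** Induction on the dimension: integrating out the first coordinate applies [vol] to the volume
    function of the others, and [vol] preserves [volume_like]. *)
Lemma sublevel_volP n (F : 'I_n -> R -> R) : (forall i, gauge (F i)) ->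
  exists2 W : R -> R, volume_like W & forall s, sublevel_vol F s = (W s)%:E.
Proof.
elim: n F => [|n ih] F gF.
  exists (fun s => (0 <= s)%R%:R).
    split => [r r0|r r0|x y xy|u v d vu d0].
    - by rewrite leNgt r0.
    - by rewrite ltW.
    - by rewrite ler_nat; case: (leP 0%R x) => // x0; rewrite (le_trans x0 xy).
    - case: (leP 0%R v) => v0; last by rewrite mulr0 mulr_ge0.
      have u0 := le_trans v0 vu.
      by rewrite u0 (addr_ge0 u0 d0) (addr_ge0 v0 d0).
  move=> s; rewrite /sublevel_vol /integral_sublevel integral_mprod0.
    rewrite mul1e /sublevel /gauge_sum big_ord0; congr (_%:R%:E).
    by rewrite (_ : [forall i, _] = true)//; apply/forallP => -[].
  by apply: measurable_fun_sublevel => //; case.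
have [W vW WE] := ih (tail_fam F) (fun i => gF _).
exists (vol (F ord0) W) => [|s]; first exact: vol_volume_like.
rewrite /sublevel_vol integral_sublevelS// volE// /evol.
rewrite -integral_leb; last 2 first.
- by apply/measurable_EFinP; exact: measurable_fiber.
- by move=> x; rewrite lee_fin fiber_ge0.
apply: eq_integral => x _; rewrite -/(sublevel_vol _ _) WE /fiber.
by case: (0 <= x)%R; rewrite ?mul1e ?mul0e.
Qed.

(** Induction on the dimension. Given the first coordinate, the others are uniform on a sublevel set
    of the remaining height. Along the one-dimensional coupling both the first coordinate and the
    remaining height grow, so the conditional mean of [g] grows by the induction hypothesis. *)
Lemma efron n (F : 'I_n -> R -> R) (g : n.-tuple R -> \bar R) s s' :
  (forall i, gauge (F i)) -> measurable_fun setT g -> (forall x, 0 <= g x) ->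
  increasing_on_ge0 g -> (s <= s')%R ->
  integral_sublevel F s g * sublevel_vol F s' <=
  integral_sublevel F s' g * sublevel_vol F s.
Proof.
elim: n F g s s' => [|n ih] F g s s' gF mg g0 ig ss'.
  have E0 (h : 0.-tuple R -> \bar R) r : measurable_fun setT h ->
      integral_sublevel F r h = h [tuple] * ((0 <= r)%R%:R)%:E.
    move=> mh; rewrite /integral_sublevel integral_mprod0; last first.
      by apply: measurable_fun_sublevel => //; case.
    rewrite /sublevel /gauge_sum big_ord0; congr (_ * _%:R%:E).
    by rewrite (_ : [forall i, _] = true)//; apply/forallP => -[].
  rewrite /sublevel_vol !E0//; case: (leP 0%R s) => s0; last first.
    by rewrite mule0 mul0e mule_ge0 ?mule_ge0.
  by rewrite (le_trans s0).
have gF' i : gauge (tail_fam F i) by exact: gF.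
have [W vW WE] := sublevel_volP gF'.
pose G r x := (0 <= x)%R%:R%:E *
  integral_sublevel (tail_fam F) (r - F ord0 x) (fun t => g (tuple_cons (x, t))).
have GE r : integral_sublevel F r g = \int[leb]_x G r x by rewrite integral_sublevelS.
have VE r : sublevel_vol F r = (vol (F ord0) W r)%:E.
  rewrite /sublevel_vol integral_sublevelS// volE// /evol.
  rewrite -integral_leb; last 2 first.
  - by apply/measurable_EFinP; exact: measurable_fiber.
  - by move=> x; rewrite lee_fin fiber_ge0.
  apply: eq_integral => x _; rewrite -/(sublevel_vol _ _) WE /fiber.
  by case: (0 <= x)%R; rewrite ?mul1e ?mul0e.
have ig' x : (0 <= x)%R -> increasing_on_ge0 (fun t => g (tuple_cons (x, t))).
  move=> x0 t t' tt'; apply: ig => i.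
  by case: (unliftP ord0 i) => [j|] ->; rewrite ?tnthS//= !(tnth_nth 0%R)/= x0 lexx.
have g0' x t : 0 <= g (tuple_cons (x, t)) by [].
have mg' x := measurable_cons_section x mg.
pose Phi x r := integral_sublevel (tail_fam F) r (fun t => g (tuple_cons (x, t))).
have Phi_ge0 x r : 0 <= Phi x r by exact: integral_sublevel_ge0.
(* The induction hypothesis against a height of positive volume makes the integral over a section of
   volume 0 vanish, even if [g] takes the value [+oo]. *)
have Phi0 x r : (0 <= x)%R -> W r = 0%R -> Phi x r = 0.
  move=> x0 Wr; pose r' := (`|r| + 1)%R.
  have r'0 : (0 < r')%R by rewrite /r'; have := normr_ge0 r; lra.
  have rr' : (r <= r')%R by rewrite /r'; have := ler_norm r; lra.
  have := ih _ _ r r' gF' (mg' x) (g0' x) (ig' _ x0) rr'.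
  rewrite !WE Wr mule0 pmule_lle0; last first.
    by rewrite lte_fin; case: vW => _ + _ _; exact.
  by move=> H; apply/eqP; rewrite eq_le H Phi_ge0.
have G_ge0 r x : 0 <= G r x by rewrite mule_ge0 ?lee_fin// Phi_ge0.
have mG r : measurable_fun setT (G r).
  rewrite (_ : G r = fun x => \int[mprod (fun _ : 'I_n => leb)]_t
    (g (tuple_cons (x, t)) * (sublevel F r (tuple_cons (x, t)))%:R%:E)).
    apply: (measurable_cons_integral (mprod (fun _ : 'I_n => leb))
      (g := fun x => g x * (sublevel F r x)%:R%:E)).
      exact: measurable_fun_sublevel.
    by move=> x; rewrite mule_ge0// lee_fin.
  by apply/funext => x; rewrite integral_sublevel_section.
have [s0|s0] := leP s 0%R.
  suff -> : integral_sublevel F s g = 0.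
    by rewrite mul0e mule_ge0// integral_sublevel_ge0.
  rewrite GE integral_leb//.
  transitivity (\int[lebesgue_measure]_(x in [set 0%R]) G s x); last first.
    exact: integral_set1.
  rewrite [RHS]integral_mkcond; apply: eq_integral => x _; rewrite patchE.
  case: ifPn => //; rewrite notin_setE/= => x0; rewrite /G.
  case: (leP 0%R x) => x0'; last by rewrite mul0e.
  rewrite -/(Phi _ _) Phi0 ?mule0//; case: vW => W0 _ _ _; apply: W0.
  have xp : (0 < x)%R by rewrite lt_neqAle x0' andbT eq_sym; apply/eqP.
  by have := gauge_inc (gF ord0) (lexx _) xp; rewrite (gauge0 (gF ord0)); lra.
(* The conditional mean of [g] given the first coordinate; it is 0 where the section has volume 0,
   the inverse of 0 being 0. *)
pose g1 r x := G r x * ((W (r - F ord0 x))^-1)%:E.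
have g1E r x : G r x = g1 r x * (fiber (F ord0) W r x)%:E.
  rewrite /g1 /fiber; case: (leP 0%R x) => x0; last first.
    by rewrite mule0 /G leNgt x0 mul0e.
  have [W0|W0] := eqVneq (W (r - F ord0 x)%R) 0%R.
    by rewrite W0 mule0 /G -/(Phi _ _) Phi0// mule0.
  by rewrite -muleA -EFinM mulVf// mule1.
have mg1 r : measurable_fun setT (g1 r).
  apply: emeasurable_funM => //; apply/measurable_EFinP.
  under eq_fun do rewrite -powR_inv1 ?volume_like_ge0//.
  apply: (measurableT_comp (measurable_powR (-1)%R)).
  apply: (measurableT_comp (measurable_volume_like vW)).
  by apply: measurable_funB => //; exact: measurable_gauge.
have g1_ge0 r x : 0 <= g1 r x.
  by rewrite mule_ge0// lee_fin invr_ge0 volume_like_ge0.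
rewrite !GE !VE !integral_leb//.
under eq_integral do rewrite g1E.
under [X in _ <= X * _]eq_integral do rewrite g1E.
apply: efron_le => // x y x0 xy Fxy.
rewrite /g1 /G x0 (le_trans x0 xy) !mul1e -!/(Phi _ _).
set r := (s - F ord0 x)%R; set r' := (s' - F ord0 y)%R.
(* Along the coupling [F ord0] gains at most [s' - s], so the height left to the other coordinates
   does not decrease. *)
have rr' : (r <= r')%R by rewrite /r /r'; lra.
have [W0|W0] := eqVneq (W r) 0%R.
  by rewrite W0 invr0 mule0 mule_ge0// lee_fin invr_ge0 volume_like_ge0.
have Wr : (0 < W r)%R by rewrite lt_neqAle eq_sym W0 volume_like_ge0.
have Wr' : (0 < W r')%R by case: vW => _ _ nd _; exact: lt_le_trans Wr (nd _ _ rr').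
rewrite lee_pdivrMr// muleAC lee_pdivlMr//.
have := ih _ _ r r' gF' (mg' x) (g0' x) (ig' _ x0) rr'.
rewrite !WE => /le_trans; apply; apply: lee_wpmul2r; first by rewrite lee_fin ltW.
apply: le_integral_ge0 => t; first by rewrite mule_ge0// lee_fin.
rewrite /sublevel; case: forallP => [t0|_]; last by rewrite !mule0.
apply: lee_wpmul2r; first by rewrite lee_fin.
apply: ig => i; case: (unliftP ord0 i) => [j|] ->; first by rewrite !tnthS t0 lexx.
by rewrite !(tnth_nth 0%R)/= x0.
Qed.

End sublevel.

(** * Gibbs measures *)

Section integral_scale.
Context {R : realType}.
Local Open Scope ereal_scope.

Lemma integral_leb_shift (b : R) (g : R -> \bar R) : measurable_fun setT g ->
  (forall x, 0 <= g x) -> \int[leb]_x g (x + b)%R = \int[leb]_x g x.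
Proof.
move=> mg g0; rewrite !integral_leb//; first exact: integral_shift.
by apply: (measurableT_comp mg); exact: measurable_funD.
Qed.

Lemma integral_leb_scale (c : R) (g : R -> \bar R) : (0 < c)%R ->
  measurable_fun setT g -> (forall x, 0 <= g x) ->
  c%:E * \int[leb]_x g (c * x)%R = \int[leb]_x g x.
Proof.
move=> c0 mg g0; pose phi (x : R) : measurableTypeR R := (c * x)%R.
have mphi : measurable_fun setT phi by exact: measurable_funM.
pose phiM : {mfun _ >-> _} :=
  HB.pack phi (isMeasurableFun.Build _ _ _ _ _ mphi).
have mgc : measurable_fun setT (fun x => g (c * x)%R).
  by apply: (measurableT_comp mg); exact: measurable_funM.
rewrite !integral_leb//.
transitivity (c%:E * \int[pushforward lebesgue_measure phiM]_x g x).
  by rewrite ge0_integral_pushforward.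
pose cN := NngNum (ltW c0).
rewrite -(@ge0_integral_mscale _ _ _ _ setT measurableT cN _ _)//.
apply: eq_measure_integral => //= A mA _.
apply/esym/lebesgue_measure_unique => //= _ [[u v]] _ <-.
rewrite /mscale/= /pushforward (_ : _ @^-1` _ = `](u / c)%R, (v / c)%R]%classic).
  rewrite !lebesgue_measure_itv/= !lte_fin ltr_pM2r ?invr_gt0//.
  case: ifP => // _; rewrite ?mule0// -!EFinB -EFinM; congr EFin.
  by field; rewrite gt_eqF.
by apply/seteqP; split => x; rewrite /= !in_itv/= /phi ltr_pdivrMr// ler_pdivlMr// ![(x * c)%R]mulrC.
Qed.

End integral_scale.

Section gibbs.
Context {R : realType}.
Local Open Scope ereal_scope.
Implicit Type F : R -> R.

Definition gibbs_weight F (x : R) : R := if (0 <= x)%R then expR (- F x) else 0%R.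

Definition gibbs_partition F : R := fine (\int[leb]_x (gibbs_weight F x)%:E).

Definition gibbs_pdf F (x : R) : R := (gibbs_weight F x / gibbs_partition F)%R.

Lemma gibbs_weight_ge0 F x : (0 <= gibbs_weight F x)%R.
Proof. by rewrite /gibbs_weight; case: ifP => // _; exact: expR_ge0. Qed.

Lemma measurable_gibbs_weight F : gauge F -> measurable_fun setT (gibbs_weight F).
Proof.
move=> gF; apply: measurable_fun_ifT => //; first exact: measurable_fun_ler.
apply: measurableT_comp => //; apply: measurableT_comp => //.
exact: measurable_gauge.
Qed.

Lemma integral_exp_ge0 (c : R) : (0 < c)%R ->
  \int[@leb R]_x (if (0 <= x)%R then expR (- (c * x)) else 0%R)%:E = c^-1%:E.
Proof.
move=> c0.
have -> : \int[@leb R]_x (if (0 <= x)%R then expR (- (c * x)) else 0%R)%:E =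
    \int[@leb R]_x (c^-1%:E * (exponential_pdf c x)%:E).
  apply: eq_integral => x _; case: (leP 0%R x) => x0.
    rewrite exponential_pdfE// -EFinM mulrA mulVf ?gt_eqF// mul1r mulNr//.
  by rewrite lt0_exponential_pdf// mule0.
have me : measurable_fun setT (fun x : R => (exponential_pdf c x)%:E).
  by apply/measurable_EFinP; exact: measurable_exponential_pdf.
have e0 x : 0 <= (exponential_pdf c x)%:E.
  by rewrite lee_fin; apply: exponential_pdf_ge0; exact: ltW.
rewrite ge0_integralZl//; last by rewrite lee_fin invr_ge0 ltW.
by rewrite integral_leb// integral_exponential_pdf// mule1.
Qed.

Let mw F : gauge F -> measurable_fun setT (fun x => (gibbs_weight F x)%:E).
Proof. by move=> gF; apply/measurable_EFinP; exact: measurable_gibbs_weight. Qed.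

Let w0 F x : 0 <= (gibbs_weight F x)%:E.
Proof. by rewrite lee_fin gibbs_weight_ge0. Qed.

Lemma integral_gibbs_weight_fin F : gauge F ->
  \int[leb]_x (gibbs_weight F x)%:E < +oo.
Proof.
move=> gF; have F1 : (0 < F 1)%R by case: gF => _ + _; apply.
(* Convexity gives [F x >= F 1 * x] for [x >= 1]; the factor [expR (F 1)] covers [[0, 1]]. *)
apply: (@le_lt_trans _ _ (\int[@leb R]_x ((expR (F 1))%:E *
    (if (0 <= x)%R then expR (- (F 1 * x)) else 0%R)%:E))); last first.
  have me : measurable_fun setT (fun x : R =>
      (if (0 <= x)%R then expR (- (F 1 * x)) else 0%R)%:E).
    apply/measurable_EFinP; apply: measurable_fun_ifT => //.
      exact: measurable_fun_ler.
    by apply: measurableT_comp => //; apply: measurableT_comp => //; exact: measurable_funM.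
  have e0 (x : R) : 0 <= (if (0 <= x)%R then expR (- (F 1 * x)) else 0%R)%:E.
    by rewrite lee_fin; case: ifP => // _; exact: expR_ge0.
  rewrite ge0_integralZl//.
  by rewrite integral_exp_ge0// -EFinM ltry.
apply: le_integral_ge0 => // x; rewrite -EFinM lee_fin /gibbs_weight.
case: (leP 0%R x) => x0; last by rewrite mulr0.
rewrite -expRD ler_expR; case: (leP x 1%R) => x1.
  by have := gauge_ge0 x gF; nra.
have := gauge_scale gF (@ler01 R) (ltW x1); rewrite mulr1 mulrC; lra.
Qed.

Lemma gibbs_partitionE F : gauge F ->
  (gibbs_partition F)%:E = \int[leb]_x (gibbs_weight F x)%:E.
Proof.
move=> gF; rewrite fineK// ge0_fin_numE ?integral_gibbs_weight_fin//.
exact: integral_ge0.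
Qed.

Lemma lebitv (a b : R) : (a <= b)%R -> leb `[a, b]%classic = (b - a)%:E.
Proof.
move=> ab; rewrite /leb lebesgue_measure_itv/= lte_fin; case: ifPn => //.
by rewrite -leNgt => ba; congr EFin; lra.
Qed.

Lemma integral_leb_itv (a b c : R) : (a <= b)%R ->
  \int[@leb R]_x (c%:E * ((a <= x <= b)%R%:R)%:E) = (c * (b - a))%:E.
Proof.
move=> ab; rewrite EFinM -(lebitv ab) -integral_cst//.
rewrite [RHS]integral_mkcond; apply: eq_integral => x _; rewrite patchE.
by rewrite mem_setE in_itv/=; case: (_ <= _ <= _)%R; rewrite ?mule1 ?mule0.
Qed.

Lemma gibbs_partition_ge F b : gauge F -> (0 <= b)%R ->
  (expR (- F b) * b <= gibbs_partition F)%R.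
Proof.
move=> gF b0; rewrite -lee_fin gibbs_partitionE//.
rewrite -[X in (_ * X)%:E]subr0 -integral_leb_itv//.
apply: le_integral_ge0 => x; first by rewrite mule_ge0// lee_fin// expR_ge0.
case: (boolP (0 <= x <= b)%R) => [/andP[x0 xb]|_]; last by rewrite mule0.
rewrite mule1 lee_fin /gibbs_weight x0 ler_expR lerN2.
exact: gauge_nd.
Qed.

Lemma gibbs_partition_gt0 F : gauge F -> (0 < gibbs_partition F)%R.
Proof.
move=> gF; apply: lt_le_trans (gibbs_partition_ge gF (@ler01 R)).
by rewrite mulr1 expR_gt0.
Qed.

Lemma gibbs_pdf_ge0 F : gauge F -> forall x, (0 <= gibbs_pdf F x)%R.
Proof.
move=> gF x; rewrite divr_ge0 ?gibbs_weight_ge0//.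
exact/ltW/gibbs_partition_gt0.
Qed.

Lemma measurable_gibbs_pdf F : gauge F -> measurable_fun setT (gibbs_pdf F).
Proof. by move=> gF; apply: measurable_funM => //; exact: measurable_gibbs_weight. Qed.

Lemma integral_gibbs_pdf F : gauge F ->
  \int[lebesgue_measure]_x (gibbs_pdf F x)%:E = 1.
Proof.
move=> gF; have Z0 := gibbs_partition_gt0 gF.
rewrite -integral_leb; last 2 first.
- by apply/measurable_EFinP; exact: measurable_gibbs_pdf.
- by move=> x; rewrite lee_fin gibbs_pdf_ge0.
under eq_integral do rewrite /gibbs_pdf EFinM.
rewrite ge0_integralZr//; [|exact: mw|by rewrite lee_fin invr_ge0 ltW].
by rewrite -gibbs_partitionE// -EFinM divff// gt_eqF.
Qed.

Definition gibbs F (gF : gauge F) : probability R R :=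
  pdf_prob (gibbs_pdf_ge0 gF) (measurable_gibbs_pdf gF) (integral_gibbs_pdf gF).

Lemma integral_gibbs F (gF : gauge F) (g : R -> \bar R) : measurable_fun setT g ->
  (forall x, 0 <= g x) ->
  \int[gibbs gF]_x g x = \int[leb]_x (g x * (gibbs_pdf F x)%:E).
Proof.
move=> mg g0; rewrite integral_pdf_prob// integral_leb//.
- apply: emeasurable_funM => //.
  by apply/measurable_EFinP; exact: measurable_gibbs_pdf.
- by move=> x; rewrite mule_ge0// lee_fin gibbs_pdf_ge0.
Qed.

Lemma integral_gibbsZ F (gF : gauge F) (g : R -> \bar R) : measurable_fun setT g ->
  (forall x, 0 <= g x) ->
  (gibbs_partition F)%:E * \int[gibbs gF]_x g x =
  \int[leb]_x (g x * (gibbs_weight F x)%:E).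
Proof.
move=> mg g0; have Z0 := gibbs_partition_gt0 gF.
rewrite integral_gibbs// -ge0_integralZl//.
- apply: eq_integral => x _; rewrite muleCA -EFinM; congr (_ * _%:E).
  by rewrite /gibbs_pdf mulrCA divff ?mulr1// gt_eqF.
- apply: emeasurable_funM => //.
  by apply/measurable_EFinP; exact: measurable_gibbs_pdf.
- by move=> x _; rewrite mule_ge0// lee_fin gibbs_pdf_ge0.
- by rewrite lee_fin ltW.
Qed.

Lemma gibbs_cancel F (a b : \bar R) : gauge F ->
  (gibbs_partition F)%:E * a <= (gibbs_partition F)%:E * b -> a <= b.
Proof.
by move=> gF; rewrite lee_pmul2l// lte_fin gibbs_partition_gt0.
Qed.

End gibbs.

Section gibbs_facts.
Context {R : realType}.
Local Open Scope ereal_scope.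
Variables (F : R -> R) (gF : gauge F).
Local Notation Z := (gibbs_partition F).
Local Notation wt := (gibbs_weight F).

Let mF := measurable_gauge gF.

Let mw : measurable_fun setT (fun x => (wt x)%:E).
Proof. by apply/measurable_EFinP; exact: measurable_gibbs_weight. Qed.

Let w0 x : 0 <= (wt x)%:E.
Proof. by rewrite lee_fin gibbs_weight_ge0. Qed.

Let mind (P : R -> bool) : measurable_fun setT P ->
  measurable_fun setT (fun x => (P x)%:R%:E : \bar R).
Proof. by move=> mP; apply/measurable_EFinP; exact: measurable_indb. Qed.

(* The density of the translate by -b of the Gibbs law restricted to [b, +oo[. *)
Definition shift_ratio (b x : R) : R :=
  if (0 <= x)%R then expR (F x - F (x + b)) else 0%R.

Lemma shift_ratio_ge0 b x : (0 <= shift_ratio b x)%R.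
Proof. by rewrite /shift_ratio; case: ifP => // _; exact: expR_ge0. Qed.

Lemma measurable_shift_ratio b : measurable_fun setT (shift_ratio b).
Proof.
apply: measurable_fun_ifT => //; first exact: measurable_fun_ler.
apply: measurableT_comp => //; apply: measurable_funB => //.
by apply: (measurableT_comp mF); exact: measurable_funD.
Qed.

Lemma shift_ratio_le b x : (0 <= b)%R -> (shift_ratio b x <= expR (- F b))%R.
Proof.
move=> b0; rewrite /shift_ratio; case: ifP => [x0|_]; last exact: expR_ge0.
by rewrite ler_expR; have := gauge_superadd gF x0 b0; lra.
Qed.

Lemma shift_ratio_le1 b x : (0 <= b)%R -> (shift_ratio b x <= 1)%R.
Proof.
move=> b0; apply: (le_trans (shift_ratio_le x b0)).
by rewrite -expR0 ler_expR oppr_le0 gauge_ge0.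
Qed.

Lemma integral_gibbs_shift b (b0 : (0 <= b)%R) (g : R -> \bar R) : measurable_fun setT g ->
  (forall x, 0 <= g x) ->
  \int[gibbs gF]_x ((b <= x)%R%:R%:E * g (x - b)%R) =
  \int[gibbs gF]_x (g x * (shift_ratio b x)%:E).
Proof.
move=> mg g0.
have mgb : measurable_fun setT (fun x : R => g (x - b)%R).
  by apply: (measurableT_comp mg); exact: measurable_funB.
have mb : measurable_fun setT (fun x : R => (b <= x)%R%:R%:E : \bar R).
  by apply: mind; exact: measurable_fun_ler.
have ms : measurable_fun setT (fun x => (shift_ratio b x)%:E).
  by apply/measurable_EFinP; exact: measurable_shift_ratio.
suff H : Z%:E * \int[gibbs gF]_x ((b <= x)%R%:R%:E * g (x - b)%R) =
    Z%:E * \int[gibbs gF]_x (g x * (shift_ratio b x)%:E).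
  by apply/eqP; rewrite eq_le; apply/andP; split; apply: (gibbs_cancel gF); rewrite H.
rewrite !integral_gibbsZ//; last 4 first.
- exact: emeasurable_funM.
- by move=> x; rewrite mule_ge0// lee_fin shift_ratio_ge0.
- exact: emeasurable_funM.
- by move=> x; rewrite mule_ge0// lee_fin.
rewrite -(integral_leb_shift b); last 2 first.
- by apply: emeasurable_funM => //; exact: emeasurable_funM.
- by move=> x; rewrite !mule_ge0// lee_fin.
apply: eq_integral => x _; rewrite addrK lerDr /shift_ratio /gibbs_weight.
case: (leP 0%R x) => x0; last by rewrite !mul0e !mule0.
rewrite mul1e -muleA -EFinM -expRD.
rewrite addr_ge0//; congr (_ * (expR _)%:E); ring.
Qed.

Lemma gibbs_tail_eq b : (0 <= b)%R ->
  \int[gibbs gF]_x (b <= x)%R%:R%:E = \int[gibbs gF]_x (shift_ratio b x)%:E.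
Proof.
move=> b0; have := @integral_gibbs_shift b b0 (cst 1) _ _.
under eq_integral do rewrite mule1.
under [in X in (_ -> _ -> _ = X) -> _]eq_integral do rewrite mul1e.
by apply.
Qed.

Lemma gibbs_tail_le b : (0 <= b)%R ->
  \int[gibbs gF]_x (b <= x)%R%:R%:E <= (expR (- F b))%:E.
Proof.
move=> b0; rewrite gibbs_tail_eq// -[leRHS]mule1 -(probability_setT (gibbs gF)).
rewrite -integral_cst//; apply: le_integral_ge0 => x; rewrite lee_fin.
  exact: shift_ratio_ge0.
exact: shift_ratio_le.
Qed.

(** Beyond [b] the slope of [F] is at least [F b / b], so the weight there has mass at most
    [expR (- F b) * b / F b]; on [[b / 2, b]] the weight is at least [expR (- F b)]. *)
Lemma gibbs_tail_half b : (0 < b)%R ->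
  \int[gibbs gF]_x (b < x)%R%:R%:E <=
  (2 / F b)%:E * \int[gibbs gF]_x (b / 2 <= x <= b)%R%:R%:E.
Proof.
move=> b0; have Fb : (0 < F b)%R by case: (gF) => _ + _; apply.
have m1 : measurable_fun setT (fun x : R => (b < x)%R%:R%:E : \bar R).
  by apply: mind; exact: measurable_fun_ltr.
have m2 : measurable_fun setT (fun x : R => (b / 2 <= x <= b)%R%:R%:E : \bar R).
  by apply: mind; apply: measurable_and; exact: measurable_fun_ler.
apply: (gibbs_cancel gF); rewrite muleCA !integral_gibbsZ//.
pose q := (F b / b)%R; have q0 : (0 < q)%R by rewrite divr_gt0.
apply: (@le_trans _ _ (expR (- F b) * (b / F b))%:E).
  rewrite -(integral_leb_shift b); last 2 first.
  - exact: emeasurable_funM.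
  - by move=> x; rewrite mule_ge0// lee_fin.
  have -> : (b / F b = q^-1)%R by rewrite /q invf_div.
  have me : measurable_fun setT (fun x : R =>
      (if (0 <= x)%R then expR (- (q * x)) else 0%R)%:E).
    apply/measurable_EFinP; apply: measurable_fun_ifT => //.
      exact: measurable_fun_ler.
    by apply: measurableT_comp => //; apply: measurableT_comp => //; exact: measurable_funM.
  have e0 (x : R) : 0 <= (if (0 <= x)%R then expR (- (q * x)) else 0%R)%:E.
    by rewrite lee_fin; case: ifP => // _; exact: expR_ge0.
  rewrite EFinM -integral_exp_ge0// -ge0_integralZl//.
  apply: le_integral_ge0 => x; first by rewrite mule_ge0// lee_fin.
  rewrite ltrDr; case: (ltP 0%R x) => x0; last first.
    by rewrite mul0e mule_ge0// lee_fin expR_ge0.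
  rewrite mul1e (ltW x0) /gibbs_weight addr_ge0 ?(ltW b0) ?(ltW x0)//.
  rewrite -EFinM lee_fin -expRD ler_expR.
  have bxb : (b < x + b)%R by lra.
  have := gauge_slope gF b0 bxb; rewrite (gauge0 gF) !subr0 addrK.
  rewrite /q -ler_pdivrMr// mulrAC; lra.
apply: (@le_trans _ _ ((2 / F b)%:E * (expR (- F b) * (b - b / 2))%:E)).
  by rewrite -EFinM lee_fin le_eqVlt; apply/orP; left; apply/eqP; field; rewrite gt_eqF.
apply: lee_wpmul2l; first by rewrite lee_fin divr_ge0// ltW.
have b2 : (b / 2 <= b)%R by lra.
rewrite -integral_leb_itv//; apply: le_integral_ge0 => x.
  by rewrite mule_ge0// lee_fin// expR_ge0.
case: (boolP (b / 2 <= x <= b)%R) => [/andP[x0 xb]|_]; last by rewrite mule0 mul0e.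
rewrite mule1 mul1e lee_fin /gibbs_weight (_ : 0 <= x)%R; last by lra.
by rewrite ler_expR lerN2 gauge_nd.
Qed.

(** The weight on [[b, c * b]] has mass at most [expR (- F b) * (c - 1) * b], and the partition
    function is at least [expR (- F b) * b]. *)
Lemma gibbs_tail_step b b' c : (0 < b)%R -> (1 <= c)%R -> (b <= b' <= c * b)%R ->
  \int[gibbs gF]_x (b <= x)%R%:R%:E <=
  \int[gibbs gF]_x (b' <= x)%R%:R%:E + (c - 1)%:E.
Proof.
move=> b0 c1 /andP[bb' b'c].
have mb (a : R) : measurable_fun setT (fun x : R => (a <= x)%R%:R%:E : \bar R).
  by apply: mind; exact: measurable_fun_ler.
apply: (gibbs_cancel gF).
have I0 : 0 <= \int[gibbs gF]_x (b' <= x)%R%:R%:E.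
  by apply: integral_ge0 => x _; rewrite lee_fin.
have c0 : 0 <= (c - 1)%:E by rewrite lee_fin; lra.
rewrite [leRHS](ge0_muleDr _ I0 c0).
rewrite !integral_gibbsZ//.
have bc : (b <= c * b)%R := le_trans bb' b'c.
apply: (@le_trans _ _ (\int[leb]_x ((b' <= x)%R%:R%:E * (wt x)%:E) +
    (expR (- F b) * (c * b - b))%:E)); last first.
  apply: leeD => //; rewrite -EFinM lee_fin.
  have := gibbs_partition_ge gF (ltW b0); have := expR_ge0 (- F b); nra.
have A1 (x : R) : 0 <= (b' <= x)%R%:R%:E * (wt x)%:E.
  by rewrite mule_ge0// lee_fin.
have A2 : measurable_fun setT (fun x : R => (b' <= x)%R%:R%:E * (wt x)%:E).
  exact: emeasurable_funM.
have B1 (x : R) : 0 <= (expR (- F b))%:E * (b <= x <= c * b)%R%:R%:E.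
  by rewrite mule_ge0// lee_fin// expR_ge0.
have B2 : measurable_fun setT (fun x : R => (expR (- F b))%:E * (b <= x <= c * b)%R%:R%:E).
  apply: emeasurable_funM => //; apply: mind.
  by apply: measurable_and; exact: measurable_fun_ler.
rewrite -integral_leb_itv// -ge0_integralD//.
apply: le_integral_ge0 => x; first by rewrite mule_ge0// lee_fin.
case: (leP b x) => bx; last by rewrite mul0e adde_ge0 ?mule_ge0// lee_fin// expR_ge0.
rewrite mul1e; case: (leP b' x) => b'x.
  by rewrite mul1e leeDl// mule_ge0// lee_fin// expR_ge0.
rewrite mul0e add0e (le_trans (ltW b'x) b'c)/= mule1 lee_fin /gibbs_weight.
by rewrite (le_trans (ltW b0) bx) ler_expR lerN2 gauge_nd.
Qed.



End gibbs_facts.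

Section gibbs_scale.
Context {R : realType}.
Local Open Scope ereal_scope.

(** The density of one law with respect to the other is at most [c]: the weight decreases, and the
    partition function is divided by at most [c], by the substitution of [c * x] and
    [c * F x <= F (c * x)]. *)
Lemma gibbs_scale (F : R -> R) c (gF : gauge F) (gcF : gauge (fun x => c * F x)%R)
    (g : R -> \bar R) : (1 <= c)%R -> measurable_fun setT g -> (forall x, 0 <= g x) ->
  \int[gibbs gcF]_x g x <= c%:E * \int[gibbs gF]_x g x.
Proof.
move=> c1 mg g0; have c0 : (0 < c)%R by lra.
have mw := measurable_gibbs_weight gF.
have Zc : (gibbs_partition F <= c * gibbs_partition (fun x => c * F x))%R.
  rewrite -lee_fin EFinM !gibbs_partitionE//.
  rewrite -(integral_leb_scale c0); last 2 first.
  - exact/measurable_EFinP.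
  - by move=> x; rewrite lee_fin gibbs_weight_ge0.
  apply: lee_wpmul2l; first by rewrite lee_fin ltW.
  apply: le_integral_ge0 => x; rewrite lee_fin ?gibbs_weight_ge0//.
  rewrite /gibbs_weight pmulr_rge0//; case: ifP => // x0.
  by rewrite ler_expR lerN2 gauge_scale.
have Z0 := gibbs_partition_gt0 gF; have Z1 := gibbs_partition_gt0 gcF.
have mp : measurable_fun setT (fun x => g x * (gibbs_pdf F x)%:E).
  apply: emeasurable_funM => //.
  by apply/measurable_EFinP; exact: measurable_gibbs_pdf.
have p0 x : 0 <= g x * (gibbs_pdf F x)%:E by rewrite mule_ge0// lee_fin gibbs_pdf_ge0.
have cE : 0 <= c%:E by rewrite lee_fin ltW.
have -> : c%:E * \int[gibbs gF]_x g x =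
    \int[leb]_x (c%:E * (g x * (gibbs_pdf F x)%:E)).
  by rewrite (integral_gibbs gF mg g0) ge0_integralZl.
rewrite (integral_gibbs gcF mg g0).
apply: le_integral_ge0 => x; first by rewrite mule_ge0// lee_fin gibbs_pdf_ge0.
rewrite muleCA; apply: lee_wpmul2l => //; rewrite -EFinM lee_fin /gibbs_pdf.
have ww : (gibbs_weight (fun x => c * F x)%R x <= gibbs_weight F x)%R.
  rewrite /gibbs_weight; case: ifP => // x0; rewrite ler_expR lerN2.
  by have := gauge_ge0 x gF; nra.
rewrite ler_pdivrMr// mulrA mulrAC ler_pdivlMr//.
have := gibbs_weight_ge0 F x; have := gibbs_weight_ge0 (fun x => c * F x)%R x.
move=> h1 h2; apply: (@le_trans _ _ (gibbs_weight F x * (c * gibbs_partition (fun x => c * F x)))%R).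
  by apply: ler_pM => //; exact: ltW.
by rewrite mulrCA mulrA.
Qed.

End gibbs_scale.

Section soft.
Context {R : realType}.
Local Open Scope ereal_scope.
Implicit Types l r s : R.

(* [soft l r] is the probability that r + E <= l, E being exponential. *)
Definition soft l r : R := (1 - expR (- Num.max 0 (l - r)))%R.

Lemma soft_ge0 l r : (0 <= soft l r)%R.
Proof. by rewrite subr_ge0 -expR0 ler_expR oppr_le0 le_max lexx. Qed.

Lemma soft_le1 l r : (soft l r <= 1)%R.
Proof. by rewrite gerBl expR_ge0. Qed.

Lemma soft_nd l l' r r' : (l - r <= l' - r' -> soft l r <= soft l' r')%R.
Proof.
move=> h; rewrite lerD2l lerN2 ler_expR lerN2.
by rewrite ge_max !le_max lexx h orbT.
Qed.

Lemma softB_le l r k : (0 <= k -> soft l r <= soft (l - k) r + k)%R.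
Proof.
move=> k0; rewrite /soft.
set a := (Num.max 0 (l - r))%R; set b := (Num.max 0 (l - k - r))%R.
have b0 : (0 <= b)%R by rewrite le_max lexx.
have bl : (l - k - r <= b)%R by rewrite le_max lexx orbT.
have ab : (a <= b + k)%R by rewrite ge_max; apply/andP; split; lra.
have : (expR (- b) * (1 - k) <= expR (- a))%R.
  apply: (@le_trans _ _ (expR (- b) * expR (- k))%R).
    by apply: ler_wpM2l; [exact: expR_ge0|have := expR_ge1Dx (- k)%R; lra].
  by rewrite -expRD ler_expR; lra.
have : (expR (- b) <= 1)%R by rewrite -expR0 ler_expR oppr_le0.
by nra.
Qed.

Lemma measurable_soft l : measurable_fun setT (soft l).
Proof.
apply: measurable_funB => //; apply: measurableT_comp => //.
apply: measurableT_comp => //; apply: measurable_maxr => //.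
exact: measurable_funB.
Qed.

Definition exp_below l s : R := if (0 <= s < l)%R then expR (- s) else 0%R.
Definition exp_above l s : R := if (l <= s)%R then expR (- s) else 0%R.

Lemma exp_below_ge0 l s : (0 <= exp_below l s)%R.
Proof. by rewrite /exp_below; case: ifP => // _; exact: expR_ge0. Qed.

Lemma exp_above_ge0 l s : (0 <= exp_above l s)%R.
Proof. by rewrite /exp_above; case: ifP => // _; exact: expR_ge0. Qed.

Lemma measurable_exp_below l : measurable_fun setT (exp_below l).
Proof.
apply: measurable_fun_ifT => //.
  by apply: measurable_and; [exact: measurable_fun_ler|exact: measurable_fun_ltr].
by apply: measurableT_comp => //; exact: measurableT_comp.
Qed.

Lemma measurable_exp_above l : measurable_fun setT (exp_above l).
Proof.
apply: measurable_fun_ifT => //; first exact: measurable_fun_ler.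
by apply: measurableT_comp => //; exact: measurableT_comp.
Qed.

Lemma integral_exp_above l : \int[leb]_s (exp_above l s)%:E = (expR (- l))%:E.
Proof.
rewrite -(integral_leb_shift l); last 2 first.
- by apply/measurable_EFinP; exact: measurable_exp_above.
- by move=> s; rewrite lee_fin exp_above_ge0.
transitivity ((expR (- l))%:E * \int[@leb R]_s
    (if (0 <= s)%R then expR (- (1 * s)) else 0%R)%:E); last first.
  by rewrite integral_exp_ge0// invr1 mule1.
have me : measurable_fun setT (fun s : R =>
    (if (0 <= s)%R then expR (- (1 * s)) else 0%R)%:E).
  apply/measurable_EFinP; apply: measurable_fun_ifT => //.
    exact: measurable_fun_ler.
  by apply: measurableT_comp => //; apply: measurableT_comp => //; exact: measurable_funM.
have e0 (s : R) : 0 <= (if (0 <= s)%R then expR (- (1 * s)) else 0%R)%:E.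
  by rewrite lee_fin; case: ifP => // _; exact: expR_ge0.
rewrite -ge0_integralZl//.
apply: eq_integral => s _; rewrite /exp_above lerDr; case: ifP => _; last by rewrite mule0.
by rewrite -EFinM -expRD mul1r opprD addrC.
Qed.

Lemma integral_exp_above_ge l r :
  \int[leb]_s ((exp_above l s)%:E * ((r <= s)%R%:R)%:E) = (expR (- Num.max l r))%:E.
Proof.
rewrite -integral_exp_above; apply: eq_integral => s _; rewrite /exp_above ge_max.
by case: (l <= s)%R => /=; case: (r <= s)%R; rewrite ?mule1 ?mule0 ?mul0e.
Qed.

Lemma soft_expR l r : (expR (- r) * (1 - soft l r) = expR (- Num.max l r))%R.
Proof.
rewrite /soft opprB addrC subrK -expRD; congr expR; case: (leP r l) => lr.
  by rewrite (max_idPr _) ?subr_ge0//; ring.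
by rewrite (max_idPl _) ?subr_le0 1?ltW//; ring.
Qed.

Lemma integral_exp_below_ge l r : (0 <= r)%R ->
  \int[leb]_s ((exp_below l s)%:E * ((r <= s)%R%:R)%:E) = (expR (- r) * soft l r)%:E.
Proof.
move=> r0.
have A1 s : 0 <= (exp_below l s)%:E * ((r <= s)%R%:R)%:E.
  by rewrite mule_ge0// lee_fin exp_below_ge0.
have A2 : measurable_fun setT (fun s => (exp_below l s)%:E * ((r <= s)%R%:R)%:E).
  apply: emeasurable_funM; apply/measurable_EFinP; first exact: measurable_exp_below.
  by apply: measurable_indb; exact: measurable_fun_ler.
have B1 s : 0 <= (exp_above l s)%:E * ((r <= s)%R%:R)%:E.
  by rewrite mule_ge0// lee_fin exp_above_ge0.
have B2 : measurable_fun setT (fun s => (exp_above l s)%:E * ((r <= s)%R%:R)%:E).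
  apply: emeasurable_funM; apply/measurable_EFinP; first exact: measurable_exp_above.
  by apply: measurable_indb; exact: measurable_fun_ler.
have : \int[leb]_s ((exp_below l s)%:E * ((r <= s)%R%:R)%:E) +
    (expR (- Num.max l r))%:E = (expR (- r))%:E.
  rewrite -integral_exp_above_ge -ge0_integralD// -[RHS]integral_exp_above.
  apply: eq_integral => s _; rewrite /exp_above /exp_below.
  case: (leP r s) => rs; last by rewrite !mule0 adde0.
  rewrite (le_trans r0 rs)/= !mule1 -EFinD.
  by case: (leP l s); rewrite ?add0r ?addr0.
rewrite -soft_expR; case: (\int[leb]_s _) => [a| |]//=.
by rewrite -EFinD => -[] h; congr EFin; lra.
Qed.

End soft.

(** * Gibbs product measures and uniform measures on sublevel sets *)

Section gibbs_prod.
Context {R : realType}.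
Local Open Scope ereal_scope.
Variables (n : nat) (F : 'I_n -> R -> R) (gF : forall i, gauge (F i)).
Local Notation S := (gauge_sum F).
Local Notation lebn := (mprod (fun _ : 'I_n => leb)).

Definition gibbs_prod (h : forall i, gauge (F i)) :
    {sigma_finite_measure set (n.-tuple R) -> \bar R} :=
  mprod (fun i => gibbs (h i)).

Local Notation Q := (gibbs_prod gF).

Lemma gibbsT i : gibbs (gF i) setT = 1. Proof. exact: probability_setT. Qed.

Definition gibbs_norm : R := (\prod_(i < n) (gibbs_partition (F i))^-1)%R.

Lemma gibbs_norm_ge0 : (0 <= gibbs_norm)%R.
Proof.
apply: prodr_ge0 => i _; rewrite invr_ge0.
exact/ltW/gibbs_partition_gt0.
Qed.

Lemma prod_gibbs_pdf x : (\prod_(i < n) gibbs_pdf (F i) (tnth x i) =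
  gibbs_norm * ([forall i, (0 <= tnth x i)%R]%:R * expR (- S x)))%R.
Proof.
rewrite big_split/= mulrC; congr (_ * _)%R.
case: forallP => [x0|/forallP].
  rewrite mul1r /gauge_sum -sumrN expR_sum.
  by apply: eq_bigr => i _; rewrite /gibbs_weight x0.
rewrite negb_forall => /existsP[i /negbTE ni].
by rewrite mul0r (bigD1 i)//= /gibbs_weight ni mul0r.
Qed.

(** Layer cake formula: the hypothesis linking [k] and [K] writes [expR (- r) * K r] as a
    superposition over heights [s] of the indicators of [r <= s], and Tonelli exchanges heights and
    points. It is applied to [exp_below] with [soft], and to [exp_above] with [1 - soft]. *)
Lemma gibbs_slice (k K : R -> R) (g : n.-tuple R -> \bar R) :
  measurable_fun setT k -> (forall s, (0 <= k s)%R) ->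
  measurable_fun setT K -> (forall s, (0 <= K s)%R) ->
  (forall r, (0 <= r)%R ->
    \int[leb]_s ((k s)%:E * ((r <= s)%R%:R)%:E) = (expR (- r) * K r)%:E) ->
  measurable_fun setT g -> (forall x, 0 <= g x) ->
  \int[Q]_x (g x * (K (S x))%:E) =
  gibbs_norm%:E * \int[leb]_s ((k s)%:E * integral_sublevel F s g).
Proof.
move=> mk k0 mK K0 kK mg g0.
have mKS : measurable_fun setT (fun x => (K (S x))%:E).
  by apply/measurable_EFinP; apply: (measurableT_comp mK); exact: measurable_gauge_sum.
have mgK : measurable_fun setT (fun x => g x * (K (S x))%:E) by exact: emeasurable_funM.
have gK0 x : 0 <= g x * (K (S x))%:E by rewrite mule_ge0// lee_fin.
rewrite (integral_mprod_density (m' := fun _ => leb) (k := fun i => gibbs_pdf (F i)))//; last 3 first.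
- by move=> i x; exact: gibbs_pdf_ge0.
- by move=> i; exact: measurable_gibbs_pdf.
- by move=> i h mh h0; exact: integral_gibbs.
pose nn (x : n.-tuple R) : R := [forall i, (0 <= tnth x i)%R]%:R.
pose H (p : n.-tuple R * R) : \bar R :=
  (g p.1 * (nn p.1)%:E) * ((k p.2)%:E * ((S p.1 <= p.2)%R%:R)%:E).
have mnn : measurable_fun setT (fun x => (nn x)%:E).
  by apply/measurable_EFinP; exact: measurable_nonneg.
have nn0 x : 0 <= (nn x)%:E by rewrite lee_fin /nn.
have H0 p : 0 <= H p by rewrite !mule_ge0// lee_fin.
have mH : measurable_fun setT H.
  apply: emeasurable_funM.
    exact: (measurableT_comp (emeasurable_funM mg mnn) measurable_fst).
  apply: emeasurable_funM; apply/measurable_EFinP.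
    exact: (measurableT_comp mk measurable_snd).
  apply: measurable_indb; apply: measurable_fun_ler; last exact: measurable_snd.
  exact: (measurableT_comp (measurable_gauge_sum gF) measurable_fst).
have swap : \int[leb]_s ((k s)%:E * integral_sublevel F s g) =
    \int[lebn]_x \int[leb]_s H (x, s).
  rewrite (@fubini_tonelli _ _ _ _ _ lebn leb H mH H0).
  apply: eq_integral => s _; rewrite -ge0_integralZl//.
  - apply: eq_integral => x _; rewrite /H/= /sublevel -mulnb natrM EFinM -/(nn x).
    by rewrite [RHS]muleCA -!muleA.
  - exact: (measurable_fun_sublevel s gF mg).
  - by move=> x _; rewrite mule_ge0// lee_fin.
  - by rewrite lee_fin.
have HE x : \int[leb]_s H (x, s) = g x * (nn x)%:E * (expR (- S x) * K (S x))%:E.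
  rewrite /H/= ge0_integralZl//.
  - by rewrite kK// gauge_sum_ge0.
  - apply: emeasurable_funM; apply/measurable_EFinP => //.
    by apply: measurable_indb; exact: measurable_fun_ler.
  - by move=> s _; rewrite mule_ge0// lee_fin.
  - by rewrite mule_ge0.
rewrite swap; under [in RHS]eq_integral do rewrite HE.
rewrite -ge0_integralZl//.
- apply: eq_integral => x _; rewrite prod_gibbs_pdf -/(nn x).
  rewrite -!muleA -!EFinM muleCA -EFinM; congr (_ * _%:E); ring.
- apply: emeasurable_funM; first exact: emeasurable_funM.
  apply/measurable_EFinP; apply: measurable_funM.
    apply: measurableT_comp => //; apply: measurableT_comp => //.
    exact: measurable_gauge_sum.
  exact/measurable_EFinP.
- by move=> x _; rewrite !mule_ge0// lee_fin mulr_ge0// expR_ge0.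
- by rewrite lee_fin gibbs_norm_ge0.
Qed.

Local Notation V := (sublevel_vol F).

Let mIS (g : n.-tuple R -> \bar R) : measurable_fun setT g -> (forall x, 0 <= g x) ->
  measurable_fun setT (fun s => integral_sublevel F s g).
Proof.
move=> mg g0.
pose H (p : R * n.-tuple R) : \bar R := g p.2 *
  ([forall i, (0 <= tnth p.2 i)%R]%:R * (S p.2 <= p.1)%R%:R)%:E.
rewrite (_ : (fun s => _) = (fun s => \int[lebn]_x H (s, x))); last first.
  apply/funext => s; apply: eq_integral => x _; rewrite /H/=.
  by rewrite /sublevel -mulnb natrM.
apply: (@measurable_fun_fubini_tonelli_F _ _ _ _ _ lebn H); last first.
  by move=> p; rewrite mule_ge0// lee_fin mulr_ge0.
apply: emeasurable_funM; first exact: (measurableT_comp mg measurable_snd).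
apply/measurable_EFinP; apply: measurable_funM.
  exact: (measurableT_comp (@measurable_nonneg R n) measurable_snd).
apply: measurable_indb; apply: measurable_fun_ler; last exact: measurable_fst.
exact: (measurableT_comp (measurable_gauge_sum gF) measurable_snd).
Qed.

Variables (l : R) (g : n.-tuple R -> \bar R).
Variables (mg : measurable_fun setT g) (g0 : forall x, 0 <= g x).
Hypothesis ig : increasing_on_ge0 g.

Lemma gibbs_le_uniform :
  \int[Q]_x (g x * (soft l (S x))%:E) * V l <=
  \int[Q]_x (soft l (S x))%:E * integral_sublevel F l g.
Proof.
have sE (h : n.-tuple R -> \bar R) := @gibbs_slice (exp_below l) (soft l) h
  (measurable_exp_below l) (exp_below_ge0 l) (measurable_soft l) (soft_ge0 l)
  (@integral_exp_below_ge R l).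
have -> : \int[Q]_x (soft l (S x))%:E = \int[Q]_x (cst 1 x * (soft l (S x))%:E).
  by apply: eq_integral => x _; rewrite mul1e.
rewrite (sE g mg g0) (sE (cst 1) _ _)// -!muleA.
apply: lee_wpmul2l; first by rewrite lee_fin gibbs_norm_ge0.
have mk : measurable_fun setT (fun s => (exp_below l s)%:E).
  by apply/measurable_EFinP; exact: measurable_exp_below.
have k0 s : 0 <= (exp_below l s)%:E by rewrite lee_fin exp_below_ge0.
rewrite -!ge0_integralZr//; last 6 first.
- by apply: emeasurable_funM => //; exact: mIS.
- by move=> s _; rewrite mule_ge0// integral_sublevel_ge0.
- exact: integral_sublevel_ge0.
- by apply: emeasurable_funM => //; exact: mIS.
- by move=> s _; rewrite mule_ge0// integral_sublevel_ge0.
- exact: integral_sublevel_ge0.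
apply: le_integral_ge0 => s; first by rewrite !mule_ge0// integral_sublevel_ge0.
rewrite -!muleA /exp_below; case: ifPn => [/andP[_ sl]|_]; last by rewrite !mul0e.
apply: lee_wpmul2l; first by rewrite lee_fin expR_ge0.
by rewrite [leRHS]muleC; exact: efron (ltW sl).
Qed.

Lemma uniform_le_gibbs :
  \int[Q]_x (1 - soft l (S x))%:E * integral_sublevel F l g <=
  \int[Q]_x (g x * (1 - soft l (S x))%:E) * V l.
Proof.
have mK : measurable_fun setT (fun r => 1 - soft l r)%R.
  by apply: measurable_funB => //; exact: measurable_soft.
have K0 r : (0 <= 1 - soft l r)%R by rewrite subr_ge0 soft_le1.
have kK r : (0 <= r)%R -> \int[leb]_s ((exp_above l s)%:E * ((r <= s)%R%:R)%:E) =
    (expR (- r) * (1 - soft l r))%:E.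
  by move=> _; rewrite integral_exp_above_ge soft_expR.
have sE (h : n.-tuple R -> \bar R) := @gibbs_slice (exp_above l) _ h
  (measurable_exp_above l) (exp_above_ge0 l) mK K0 kK.
have -> : \int[Q]_x (1 - soft l (S x))%:E = \int[Q]_x (cst 1 x * (1 - soft l (S x))%:E).
  by apply: eq_integral => x _; rewrite mul1e.
rewrite (sE g mg g0) (sE (cst 1) _ _)// -!muleA.
apply: lee_wpmul2l; first by rewrite lee_fin gibbs_norm_ge0.
have mk : measurable_fun setT (fun s => (exp_above l s)%:E).
  by apply/measurable_EFinP; exact: measurable_exp_above.
have k0 s : 0 <= (exp_above l s)%:E by rewrite lee_fin exp_above_ge0.
rewrite -!ge0_integralZr//; last 6 first.
- by apply: emeasurable_funM => //; exact: mIS.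
- by move=> s _; rewrite mule_ge0// integral_sublevel_ge0.
- exact: integral_sublevel_ge0.
- by apply: emeasurable_funM => //; exact: mIS.
- by move=> s _; rewrite mule_ge0// integral_sublevel_ge0.
- exact: integral_sublevel_ge0.
apply: le_integral_ge0 => s; first by rewrite !mule_ge0// integral_sublevel_ge0.
rewrite -!muleA /exp_above; case: ifPn => [ls|_]; last by rewrite !mul0e.
apply: lee_wpmul2l; first by rewrite lee_fin expR_ge0.
by rewrite [leLHS]muleC; exact: efron ls.
Qed.

End gibbs_prod.

(** * Choice of the level [l] *)

Section level_choice.
Context {R : realType}.
Local Open Scope ereal_scope.

(** The function [1 - exp (- u)] is concave and vanishes at 0. *)
Lemma soft_scale (c l r : R) : (1 <= c -> soft (c * l) (c * r) <= c * soft l r)%R.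
Proof.
move=> c1; rewrite /soft -mulrBr.
have -> : (Num.max 0 (c * (l - r)) = c * Num.max 0 (l - r))%R.
  by rewrite maxr_pMr ?mulr0//; lra.
set u := Num.max _ _; have u0 : (0 <= u)%R by rewrite le_max lexx.
have h1 : (expR (- u) * (1 - (c - 1) * u) <= expR (- (c * u)))%R.
  rewrite (_ : - (c * u) = - u + - ((c - 1) * u))%R; last by ring.
  rewrite expRD; apply: ler_wpM2l; first exact: expR_ge0.
  exact: expR_ge1Dx.
have h2 : (expR (- u) * (1 + u) <= 1)%R.
  rewrite expRN mulrC ler_pdivrMr ?expR_gt0// mul1r; exact: expR_ge1Dx.
have h3 : (0 <= c - 1)%R by lra.
have := mulr_ge0 h3 (_ : 0 <= 1 - expR (- u) * (1 + u))%R; rewrite subr_ge0 => /(_ h2).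
by nra.
Qed.

Section fixed.
Variables (n : nat) (F : 'I_n -> R -> R) (gF : forall i, gauge (F i)).
Local Notation S := (gauge_sum F).

Definition gmean l := \int[gibbs_prod gF]_x (soft l (S x))%:E.

Lemma measurable_soft_sum l : measurable_fun setT (fun x => (soft l (S x))%:E).
Proof.
apply/measurable_EFinP; apply: (measurableT_comp (measurable_soft l)).
exact: measurable_gauge_sum.
Qed.

Lemma integral_gibbs_cst (c : \bar R) : \int[gibbs_prod gF]_x cst c x = c.
Proof. by apply: integral_mprod_cst => i; exact: gibbsT. Qed.

Lemma gmean_ge0 l : 0 <= gmean l.
Proof. by apply: integral_ge0 => x _; rewrite lee_fin soft_ge0. Qed.

Lemma gmean_le l : (0 <= l)%R -> gmean l <= l%:E.
Proof.
move=> l0; rewrite -[leRHS]integral_gibbs_cst; apply: le_integral_ge0 => x.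
  by rewrite lee_fin soft_ge0.
rewrite lee_fin /soft; set u := Num.max _ _.
have ul : (u <= l)%R by rewrite ge_max l0/=; have := gauge_sum_ge0 x gF; lra.
by have := expR_ge1Dx (- u)%R; lra.
Qed.

Lemma gmeanC l : gmean l + \int[gibbs_prod gF]_x (1 - soft l (S x))%:E = 1.
Proof.
rewrite -ge0_integralD//; last 4 first.
- by move=> x _; rewrite lee_fin soft_ge0.
- exact: measurable_soft_sum.
- by move=> x _; rewrite lee_fin subr_ge0 soft_le1.
- apply/measurable_EFinP; apply: measurable_funB => //.
  by apply/measurable_EFinP; exact: measurable_soft_sum.
rewrite -[RHS]integral_gibbs_cst; apply: eq_integral => x _.
by rewrite -EFinD addrC subrK.
Qed.

Lemma gibbs_coord (g : R -> \bar R) i : measurable_fun setT g -> (forall x, 0 <= g x) ->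
  \int[gibbs_prod gF]_x g (tnth x i) = \int[gibbs (gF i)]_y g y.
Proof. by move=> mg g0; apply: integral_mprod_coord => // j; exact: gibbsT. Qed.

Lemma gibbs_gauge_tail i v : (0 < v)%R ->
  \int[gibbs (gF i)]_y ((v <= F i y)%R%:R)%:E <= (expR (- v))%:E.
Proof.
move=> v0; have [b b0 Fb] := gauge_surj (gF i) (ltW v0).
rewrite -[in leRHS]Fb; apply: le_trans (gibbs_tail_le (gF i) b0).
apply: le_integral_ge0 => y; first by rewrite lee_fin.
rewrite lee_fin ler_nat; case: (leP b y) => //= yb; first by case: (_ <= _)%R.
rewrite leNgt -Fb; have [y0|y0] := leP 0%R y; first by rewrite (gauge_inc (gF i)).
case: (gF i) => f0 _ _; rewrite (f0 y) ?(ltW y0)// Fb v0//.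
Qed.

(** With [v = l / (2 n)], either some [F i] reaches [v], which has probability at most
    [n * exp (- v)], or [S <= l / 2] and [1 - soft l S <= exp (- l / 2)]. By [exp (- u) < 1 / u] the
    total is below [(2 n^2 + 2) / l < 1/2]. *)
Lemma gmean_large l : (0 < n)%N -> (4 * n%:R ^+ 2 + 4 < l)%R -> 2^-1%:E < gmean l.
Proof.
move=> n0 ln; have nR : (0 < n%:R :> R)%R by rewrite ltr0n.
have l0 : (0 < l)%R by have := sqr_ge0 (n%:R : R); lra.
pose v := (l / (2 * n%:R))%R; have v0 : (0 < v)%R by rewrite divr_gt0// mulr_gt0.
have nv : (n%:R * v = l / 2)%R by rewrite /v; field; rewrite gt_eqF.
have mi i : measurable_fun setT (fun x : n.-tuple R => ((v <= F i (tnth x i))%R%:R)%:E : \bar R).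
  apply/measurable_EFinP; apply: measurable_indb; apply: measurable_fun_ler => //.
  by apply: (measurableT_comp (measurable_gauge (gF i))); exact: measurable_tnth.
have : \int[gibbs_prod gF]_x (1 - soft l (S x))%:E <=
    \sum_(i < n) (expR (- v))%:E + (expR (- (l / 2)))%:E.
  apply: (@le_trans _ _ (\int[gibbs_prod gF]_x
      (\sum_(i < n) ((v <= F i (tnth x i))%R%:R)%:E + (expR (- (l / 2)))%:E))).
    apply: le_integral_ge0 => x; first by rewrite lee_fin subr_ge0 soft_le1.
    rewrite /soft opprB addrC subrK.
    case: (boolP [exists i, v <= F i (tnth x i)]%R) => [/existsP[i vi]|].
      apply: (@le_trans _ _ 1); first by rewrite lee_fin -expR0 ler_expR oppr_le0 le_max lexx.
      rewrite (bigD1 i)//= vi -addeA leeDl// adde_ge0// ?lee_fin ?expR_ge0//.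
      by apply: sume_ge0 => j _; rewrite lee_fin.
    rewrite negb_exists => /forallP h.
    apply: (@le_trans _ _ (expR (- (l / 2)))%:E); last first.
      by rewrite leeDr//; apply: sume_ge0 => j _; rewrite lee_fin.
    rewrite lee_fin ler_expR lerN2 le_max; apply/orP; right.
    suff : (S x <= n%:R * v)%R by rewrite nv; lra.
    rewrite mulr_natl -[in leRHS](card_ord n) -sumr_const; apply: ler_sum => i _.
    by rewrite ltW// ltNge h.
  have s1 (x : n.-tuple R) : 0 <= \sum_(i < n) ((v <= F i (tnth x i))%R%:R)%:E :> \bar R.
    by apply: sume_ge0 => j _; rewrite lee_fin.
  have s2 : measurable_fun setT (fun x : n.-tuple R =>
      \sum_(i < n) ((v <= F i (tnth x i))%R%:R)%:E : \bar R).
    exact: emeasurable_sum.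
  rewrite ge0_integralD//.
  rewrite integral_gibbs_cst leeD2r// ge0_integral_sum//.
  apply: lee_sum => i _.
  rewrite (gibbs_coord (g := fun y => ((v <= F i y)%R%:R)%:E))//.
    exact: gibbs_gauge_tail.
  apply/measurable_EFinP; apply: measurable_indb; apply: measurable_fun_ler => //.
  exact: measurable_gauge.
rewrite sumEFin sumr_const card_ord -EFinD => H.
have e1 (u : R) : (0 < u)%R -> (expR (- u) < u^-1)%R.
  move=> u0; rewrite expRN ltf_pV2 ?posrE ?expR_gt0//.
  by have := expR_ge1Dx u; lra.
have H2 : (expR (- v) *+ n + expR (- (l / 2)) < 2^-1)%R.
  have := e1 _ v0; have l2 : (0 < l / 2)%R by lra.
  have := e1 _ l2; rewrite -mulr_natl => a1 a2.
  have : (n%:R * expR (- v) <= n%:R * v^-1)%R by rewrite ler_pM2l// ltW.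
  have -> : (n%:R * v^-1 = 2 * n%:R ^+ 2 / l)%R by rewrite /v; field; rewrite !gt_eqF.
  rewrite invf_div in a1.
  have : (2 * n%:R ^+ 2 / l + 2 / l < 2^-1)%R.
    by rewrite -mulrDl ltr_pdivrMr//; lra.
  by lra.
have H3 := gmeanC l; move: H3 H (gmean_ge0 l).
case: (gmean l) => [a| |]//; case: (\int[_]_x _) => [b| |]//.
by rewrite -EFinD => -[ab]; rewrite lee_fin lte_fin => ? _; lra.
Qed.

End fixed.

(** One factor [c] comes from [soft], one more from the Gibbs law of each coordinate. *)
Lemma gmean_step n (F F' : 'I_n -> R -> R) (gF : forall i, gauge (F i))
    (gF' : forall i, gauge (F' i)) (c l : R) : (1 <= c)%R ->
  (forall i x, F' i x = c * F i x)%R ->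
  gmean gF' (c * l) <= (c ^+ n.+1)%:E * gmean gF l.
Proof.
move=> c1 FE; have c0 : (0 <= c)%R by lra.
have E : F' = (fun i x => c * F i x)%R by apply/funext => i; apply/funext => x.
subst F'.
have SE x : gauge_sum (fun i x => c * F i x)%R x = (c * gauge_sum F x)%R.
  by rewrite /gauge_sum mulr_sumr.
have ms := measurable_soft_sum gF l.
have s0 x : 0 <= (soft l (gauge_sum F x))%:E by rewrite lee_fin soft_ge0.
apply: (@le_trans _ _ (c%:E * \int[gibbs_prod gF']_x (soft l (gauge_sum F x))%:E)).
  rewrite -ge0_integralZl//; apply: le_integral_ge0 => x.
    by rewrite lee_fin soft_ge0.
  by rewrite -EFinM lee_fin SE soft_scale.
rewrite exprS EFinM -muleA; apply: lee_wpmul2l; first by rewrite lee_fin.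
apply: integral_mprod_le => // i g mg g0.
exact: gibbs_scale.
Qed.

Lemma expr1D_ub (x : R) m : (0 <= x -> (1 + x) ^+ m * (1 - m%:R * x) <= 1)%R.
Proof.
move=> x0; elim: m => [|m ih]; first by rewrite expr0 mul0r subr0 mulr1.
apply: le_trans ih; rewrite exprSr -mulrA.
apply: ler_wpM2l; first by rewrite exprn_ge0//; lra.
rewrite -natr1; have : (0 <= m%:R * (x * x))%R by rewrite mulr_ge0// mulr_ge0.
have : (0 <= x * x)%R by exact: mulr_ge0.
by nra.
Qed.

Lemma expr1D_lb (x : R) m : (0 <= x -> 1 + m%:R * x <= (1 + x) ^+ m)%R.
Proof.
move=> x0; elim: m => [|m ih]; first by rewrite expr0 mul0r addr0.
rewrite exprSr; apply: (@le_trans _ _ ((1 + m%:R * x) * (1 + x))%R); last first.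
  by apply: ler_wpM2r => //; lra.
rewrite -natr1; have : (0 <= m%:R * (x * x))%R by rewrite mulr_ge0// mulr_ge0.
by nra.
Qed.

Lemma expr1D_unbounded (x M : R) : (0 < x)%R -> exists m, (M < (1 + x) ^+ m)%R.
Proof.
move=> x0; exists (Num.truncn (`|M| / x)).+1.
apply: lt_le_trans (expr1D_lb _ (ltW x0)).
have : (`|M| / x < (Num.truncn (`|M| / x)).+1%:R)%R by rewrite truncnS_gt.
rewrite ltr_pdivrMr//; have := ler_norm M; lra.
Qed.

(** A discrete substitute for continuity in [l]: the level runs through a geometric grid starting at
    1/2, where the mean is at most 1/2. The ratio [1 + x] with [x = 1 / (4 (n + 1))] makes one step
    multiply the mean by at most 4/3, so the first grid level with mean above 1/2 has mean at most
    2/3. *)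
Lemma exists_level n (f : 'I_n -> R -> R) : (0 < n)%N -> (forall i, gauge (f i)) ->
  exists2 l : R, (0 < l)%R & exists gF : forall i, gauge (fun x => l * f i x)%R,
    2^-1%:E < gmean gF l /\ gmean gF l <= (2 / 3)%:E.
Proof.
move=> n0 gf; pose x : R := ((4 * n.+1%:R)^-1)%R.
have n1 : (0 < n.+1%:R :> R)%R by rewrite ltr0n.
have x0 : (0 < x)%R by rewrite invr_gt0 mulr_gt0.
pose lk k := (2^-1 * (1 + x) ^+ k)%R.
have lk0 k : (0 < lk k)%R by rewrite mulr_gt0// exprn_gt0//; lra.
have gk k i : gauge (fun x => lk k * f i x)%R by exact: gauge_mulr.
pose P k := 2^-1%:E < gmean (gk k) (lk k).
have exP : exists k, P k.
  have [k hk] := expr1D_unbounded (2 * (4 * n%:R ^+ 2 + 4))%R x0.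
  by exists k; apply: gmean_large => //; rewrite /lk; lra.
case: (ex_minnP exP) => k Pk kmin; exists (lk k) => //; exists (gk k); split => //.
case: k Pk kmin => [|k] Pk kmin.
  apply: (le_trans (gmean_le (gk 0%N) (ltW (lk0 0%N)))).
  by rewrite lee_fin /lk expr0; lra.
have Gk : gmean (gk k) (lk k) <= 2^-1%:E.
  by rewrite leNgt; apply/negP => /kmin; rewrite ltnn.
have lkS : lk k.+1 = ((1 + x) * lk k)%R by rewrite /lk exprS; ring.
have c1 : (1 <= 1 + x)%R by lra.
have FE i y : (lk k.+1 * f i y = (1 + x) * (lk k * f i y))%R by rewrite lkS -mulrA.
have := gmean_step (gk k) (gk k.+1) (lk k) c1 FE.
rewrite -lkS => /le_trans; apply.
apply: (@le_trans _ _ ((4 / 3)%:E * 2^-1%:E)); last by rewrite -EFinM lee_fin; lra.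
apply: lee_pmul => //; [by rewrite lee_fin exprn_ge0//; lra|exact: gmean_ge0|].
have := expr1D_ub n.+1 (ltW x0).
rewrite (_ : n.+1%:R * x = 4^-1)%R; last by rewrite /x; field; rewrite gt_eqF.
by rewrite lee_fin; lra.
Qed.

End level_choice.

(** * Second moments of sums of independent variables in [[0, 1]] *)

Section variance.
Context {R : realType}.
Local Open Scope ereal_scope.
Local Notation SFM := {sigma_finite_measure set R -> \bar R}.

(** The variance is at most the mean because [g ^ 2 <= g]. The shift [c] carries the other terms of
    a sum in the induction of [variance_sum]. *)
Lemma variance1 (m : SFM) (g : R -> R) (a c : R) : m setT = 1 ->
  measurable_fun setT g -> (forall x, (0 <= g x <= 1)%R) ->
  \int[m]_x (g x)%:E = a%:E ->
  \int[m]_x ((c + (g x - a)) ^+ 2)%:E <= (c ^+ 2 + a)%:E.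
Proof.
move=> m1 mg g01 ga; pose e := (c - a)%R.
have g0 x : 0 <= (g x)%:E by rewrite lee_fin; case/andP : (g01 x).
have mgE : measurable_fun setT (fun x => (g x)%:E) by exact/measurable_EFinP.
have gg x : (g x ^+ 2 <= g x)%R by case/andP : (g01 x) => ? ?; nra.
have a0 : (0 <= a)%R by rewrite -lee_fin -ga; exact: integral_ge0.
have q0 x : 0 <= ((c + (g x - a)) ^+ 2)%:E by rewrite lee_fin sqr_ge0.
have mq : measurable_fun setT (fun x => ((c + (g x - a)) ^+ 2)%:E).
  apply/measurable_EFinP; apply: measurable_funX; apply: measurable_funD => //.
  exact: measurable_funB.
(* In [(e + g)^2 <= e^2 + (2 e + 1) g] the coefficient of [g] can be negative; the term is then
   moved to the left, so that all integrands stay nonnegative. *)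
have [e0|e0] := leP 0%R (2 * e + 1)%R.
  apply: (@le_trans _ _ (\int[m]_x ((e ^+ 2)%:E + (2 * e + 1)%:E * (g x)%:E))).
    apply: le_integral_ge0 => // x; rewrite -EFinM -EFinD lee_fin.
    by have := gg x; rewrite /e; nra.
  rewrite ge0_integralD//; last 3 first.
  - by move=> x _; rewrite lee_fin sqr_ge0.
  - by move=> x _; rewrite mule_ge0// lee_fin.
  - by apply: emeasurable_funM.
  rewrite (integral_prob_cst _ m1) ge0_integralZl// ga -EFinM -EFinD lee_fin /e.
  by nra.
have e1 : 0 <= (- (2 * e + 1))%:E by rewrite lee_fin; lra.
have : \int[m]_x (((c + (g x - a)) ^+ 2)%:E + (- (2 * e + 1))%:E * (g x)%:E) <= (e ^+ 2)%:E.
  rewrite -[leRHS](integral_prob_cst _ m1); apply: le_integral_ge0 => x.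
    by rewrite adde_ge0// mule_ge0.
  rewrite -EFinM -EFinD lee_fin; have := gg x; rewrite /e; nra.
rewrite ge0_integralD//; last 2 first.
- by move=> x _; rewrite mule_ge0.
- by apply: emeasurable_funM.
rewrite ge0_integralZl// ga -EFinM => H.
have : \int[m]_x ((c + (g x - a)) ^+ 2)%:E <= (e ^+ 2)%:E - (- (2 * e + 1) * a)%:E.
  by rewrite leeBrDr.
move=> /le_trans; apply; rewrite -EFinB lee_fin /e; nra.
Qed.

Lemma variance_sum n (m : 'I_n -> SFM) (g : 'I_n -> R -> R) (a : 'I_n -> R) (c : R) :
  (forall i, m i setT = 1) -> (forall i, measurable_fun setT (g i)) ->
  (forall i x, (0 <= g i x <= 1)%R) ->
  (forall i, \int[m i]_x (g i x)%:E = (a i)%:E) ->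
  \int[mprod m]_x ((c + (\sum_(i < n) g i (tnth x i) - \sum_(i < n) a i)) ^+ 2)%:E <=
  (c ^+ 2 + \sum_(i < n) a i)%:E.
Proof.
elim: n m g a c => [|n ih] m g a c m1 mg g01 ga.
  rewrite integral_mprod0; first by rewrite !big_ord0 subrr !addr0.
  by apply/measurable_EFinP; under eq_fun do rewrite !big_ord0; exact: measurable_cst.
have mF : measurable_fun setT (fun x : n.+1.-tuple R =>
    ((c + (\sum_(i < n.+1) g i (tnth x i) - \sum_(i < n.+1) a i)) ^+ 2)%:E).
  apply/measurable_EFinP; apply: measurable_funX; apply: measurable_funD => //.
  apply: measurable_funB => //; apply: measurable_sum => i.
  by apply: (measurableT_comp (mg i)); exact: measurable_tnth.
rewrite integral_mprodS//; last by move=> x; rewrite lee_fin sqr_ge0.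
pose s := (\sum_(i < n) a (lift ord0 i))%R.
have s0 : (0 <= s)%R.
  apply: sumr_ge0 => i _; rewrite -lee_fin -ga; apply: integral_ge0 => x _.
  by rewrite lee_fin; case/andP : (g01 (lift ord0 i) x).
apply: (@le_trans _ _ (\int[m ord0]_x (((c + (g ord0 x - a ord0)) ^+ 2)%:E + s%:E))).
  apply: le_integral_ge0 => x; first by apply: integral_ge0 => t _; rewrite lee_fin sqr_ge0.
  rewrite -EFinD; apply: le_trans (ih _ _ _ _ (fun i => m1 _) (fun i => mg _)
    (fun i => g01 _) (fun i => ga (lift ord0 i))).
  rewrite le_eqVlt; apply/orP; left; apply/eqP; apply: eq_integral => t _.
  congr ((_ ^+ 2)%:E); rewrite !big_ord_recl /=.
  under eq_bigr do rewrite tnthS.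
  by rewrite (_ : tnth (tuple_cons (x, t)) ord0 = x)//; ring.
have q0 x : 0 <= ((c + (g ord0 x - a ord0)) ^+ 2)%:E by rewrite lee_fin sqr_ge0.
have mq : measurable_fun setT (fun x => ((c + (g ord0 x - a ord0)) ^+ 2)%:E).
  apply/measurable_EFinP; apply: measurable_funX; apply: measurable_funD => //.
  exact: measurable_funB.
rewrite ge0_integralD// (integral_prob_cst _ (m1 ord0)) big_ord_recl addrA EFinD leeD2r//.
by apply: variance1 => //; exact: g01.
Qed.

End variance.

(** * The truncation threshold *)

(** As [u i <= 1], each denominator is at least the full sum. Leaving [i] out makes the weight of
    [u i] independent of coordinate [i] in both applications. *)
Lemma sum_leave_one_out (R : realType) n (u : 'I_n -> R) : (forall i, 0 <= u i <= 1) ->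
  \sum_(i < n) u i * (1 + \sum_(j < n | j != i) u j)^-1 <= 1.
Proof.
move=> u01; have u0 i : 0 <= u i by case/andP : (u01 i).
pose T := \sum_(i < n) u i.
have [T0|T0] := eqVneq T 0.
  rewrite big1 ?ler01// => i _.
  have /eqP := T0; rewrite /T psumr_eq0//.
  by move/allP => /(_ i); rewrite mem_index_enum => /(_ isT) /eqP ->; rewrite mul0r.
have Tp : 0 < T by rewrite lt_neqAle eq_sym T0 sumr_ge0.
apply: (@le_trans _ _ (\sum_(i < n) u i * T^-1)); last by rewrite -mulr_suml mulfV.
apply: ler_sum => i _; apply: ler_wpM2l => //.
have s0 : 0 <= \sum_(j < n | j != i) u j by exact: sumr_ge0.
rewrite lef_pV2 ?posrE ?ltr_wpDr// /T (bigD1 i)//= lerD2r.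
by case/andP : (u01 i).
Qed.

(** Pointwise form of Chebyshev's inequality, with [N] and [T] of mean [tau]. If [N < tau / 2] or
    [T > 2 tau], one of the squares pays for [w]; otherwise [J >= N / (1 + T)] is at least
    [20 / 81], hence at least 1/5. *)
Lemma count_bound {R : realFieldType} (J N T tau w : R) : 40 <= tau -> 0 <= w <= 1 ->
  0 <= J -> 0 <= T -> N <= J * (1 + T) ->
  w <= 5 * (J * w) + (4 / tau ^+ 2 * (N - tau) ^+ 2 + (tau ^+ 2)^-1 * (T - tau) ^+ 2).
Proof.
move=> t40 /andP[w0 w1] J0 T0 NJ.
have t2 : 0 < tau ^+ 2 by rewrite exprn_gt0//; lra.
have A0 : 0 <= 4 / tau ^+ 2 * (N - tau) ^+ 2.
  by rewrite mulr_ge0 ?sqr_ge0// divr_ge0// ltW.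
have B0 : 0 <= (tau ^+ 2)^-1 * (T - tau) ^+ 2.
  by rewrite mulr_ge0 ?sqr_ge0// invr_ge0 ltW.
have Jw : 0 <= J * w by exact: mulr_ge0.
have [N2|N2] := ltP N (tau / 2).
  suff : 1 <= 4 / tau ^+ 2 * (N - tau) ^+ 2 by lra.
  by rewrite mulrAC ler_pdivlMr// mul1r; nra.
have [T2|T2] := ltP (2 * tau) T.
  suff : 1 <= (tau ^+ 2)^-1 * (T - tau) ^+ 2 by lra.
  by rewrite mulrC ler_pdivlMr// mul1r; nra.
suff J5 : 1 <= 5 * J by have := ler_wpM2r w0 J5; lra.
rewrite leNgt; apply/negP => J5.
have : J * (1 + T) <= J * (1 + 2 * tau) by apply: ler_wpM2l => //; lra.
have : 5 * J * (1 + 2 * tau) < 1 * (1 + 2 * tau) by rewrite ltr_pM2r//; lra.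
by lra.
Qed.

Section anticoncentration.
Context {R : realType}.
Local Open Scope ereal_scope.
Variables (n : nat) (F : 'I_n -> R -> R) (gF : forall i, gauge (F i)).
Local Notation S := (gauge_sum F).
Local Notation Q := (gibbs_prod gF).
Variables (l v : R) (b : 'I_n -> R).
Hypotheses (b0 : forall i, (0 <= b i)%R) (Fb : forall i, F i (b i) = v).

Local Notation theta i := (shift_ratio (F i) (b i)).

(** Many coordinates can be shifted to reach the same point; these weights bound the total
    multiplicity by 1. They do not involve coordinate [i], hence are unchanged by its shift. *)
Definition jump_weight (i : 'I_n) (x : n.-tuple R) : R :=
  ((1 + \sum_(j < n | j != i) theta j (tnth x j))^-1)%R.

Let sum_theta_ge0 (P : pred 'I_n) x :
  (0 <= \sum_(j < n | P j) theta j (tnth x j))%R.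
Proof. by apply: sumr_ge0 => j _; exact: shift_ratio_ge0. Qed.

Let den_gt0 i x : (0 < 1 + \sum_(j < n | j != i) theta j (tnth x j))%R.
Proof. by have := sum_theta_ge0 (fun j => j != i) x; lra. Qed.

Let jump_weight_ge0 i x : (0 <= jump_weight i x)%R.
Proof. by rewrite invr_ge0 ltW. Qed.

Let mtheta i : measurable_fun setT (fun x : n.-tuple R => theta i (tnth x i)).
Proof.
apply: (measurableT_comp (measurable_shift_ratio (gF i) (b i))).
exact: measurable_tnth.
Qed.

Let measurable_jump_weight i : measurable_fun setT (jump_weight i).
Proof.
rewrite /jump_weight; under eq_fun do rewrite -powR_inv1 ?(ltW (den_gt0 _ _))//.
apply: (measurableT_comp (measurable_powR (-1)%R)).
apply: measurable_funD => //.
under eq_fun do rewrite big_mkcond.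
by apply: measurable_sum => j; case: (j != i).
Qed.

Let jump_weight_upd i x y : jump_weight i (upd x i y) = jump_weight i x.
Proof.
congr ((1 + _)^-1)%R; apply: eq_bigr => j /negbTE ji.
by rewrite tnth_upd ji.
Qed.

Lemma gauge_sum_upd x i y :
  S (upd x i y) = (F i y + \sum_(j < n | j != i) F j (tnth x j))%R.
Proof.
rewrite /gauge_sum (bigD1 i)//= tnth_upd eqxx; congr (_ + _)%R.
by apply: eq_bigr => j /negbTE ji; rewrite tnth_upd ji.
Qed.

Let mjump i s : measurable_fun setT (fun x => (jump_weight i x * soft s (S x))%:E).
Proof.
apply/measurable_EFinP; apply: measurable_funM.
  exact: measurable_jump_weight.
exact: (measurableT_comp (measurable_soft s) (measurable_gauge_sum gF)).
Qed.

Let mhit i : measurable_fun setT (fun x : n.-tuple R => ((b i <= tnth x i)%R%:R)%:E : \bar R).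
Proof.
apply/measurable_EFinP; apply: measurable_indb; apply: measurable_fun_ler => //.
exact: measurable_tnth.
Qed.

(** Subtracting [b i] from a coordinate that exceeds it lowers the sum by at least [F i (b i) = v],
    by superadditivity; the change of variables produces the density [theta i]. *)
Lemma jump_shift i :
  \int[Q]_x (((b i <= tnth x i)%R%:R)%:E * (jump_weight i x * soft l (S x))%:E) <=
  \int[Q]_x ((theta i (tnth x i))%:E * (jump_weight i x * soft (l - v) (S x))%:E).
Proof.
have p0 s x : 0 <= (jump_weight i x * soft s (S x))%:E.
  by rewrite lee_fin mulr_ge0// soft_ge0.
have m1 : measurable_fun setT (fun x : n.-tuple R =>
    ((b i <= tnth x i)%R%:R)%:E * (jump_weight i x * soft l (S x))%:E).
  exact: emeasurable_funM.
have m2 : measurable_fun setT (fun x : n.-tuple R =>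
    (theta i (tnth x i))%:E * (jump_weight i x * soft (l - v) (S x))%:E).
  by apply: emeasurable_funM => //; exact/measurable_EFinP.
have h1 (x : n.-tuple R) :
    0 <= ((b i <= tnth x i)%R%:R)%:E * (jump_weight i x * soft l (S x))%:E.
  by rewrite mule_ge0// lee_fin.
have h2 (x : n.-tuple R) :
    0 <= (theta i (tnth x i))%:E * (jump_weight i x * soft (l - v) (S x))%:E.
  by rewrite mule_ge0// lee_fin shift_ratio_ge0.
rewrite [leLHS](integral_resample i (gibbsT gF) m1 h1).
rewrite [leRHS](integral_resample i (gibbsT gF) m2 h2).
apply: le_integral_ge0 => x.
  by apply: integral_ge0 => y _; rewrite mule_ge0// lee_fin.
pose K (z : R) := (jump_weight i x * soft (l - v) (S (upd x i z)))%:E.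
have K0 z : 0 <= K z by rewrite lee_fin mulr_ge0// soft_ge0.
have mK : measurable_fun setT K.
  rewrite (_ : K = fun z => (jump_weight i (upd x i z) * soft (l - v) (S (upd x i z)))%:E).
    exact: (measurable_upd_section x i (mjump i (l - v)%R)).
  by apply/funext => z; rewrite jump_weight_upd.
apply: (@le_trans _ _ (\int[gibbs (gF i)]_y (((b i <= y)%R%:R)%:E * K (y - b i)%R))).
  apply: le_integral_ge0 => y; first by rewrite mule_ge0// lee_fin.
  rewrite tnth_upd eqxx; case: (leP (b i) y) => by_; last by rewrite !mul0e.
  rewrite !mul1e lee_fin jump_weight_upd; apply: ler_wpM2l => //.
  apply: soft_nd; rewrite !gauge_sum_upd.
  have yb : (0 <= y - b i)%R by lra.
  have := gauge_superadd (gF i) yb (b0 i); rewrite subrK Fb; lra.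
rewrite integral_gibbs_shift//; apply: le_integral_ge0 => y.
  by rewrite mule_ge0// lee_fin shift_ratio_ge0.
by rewrite tnth_upd eqxx muleC jump_weight_upd.
Qed.

Let sum_jump x : (\sum_(i < n) theta i (tnth x i) * jump_weight i x <= 1)%R.
Proof.
by apply: sum_leave_one_out => i; rewrite shift_ratio_ge0 shift_ratio_le1.
Qed.

Definition hits (x : n.-tuple R) : R := (\sum_(i < n) (b i <= tnth x i)%R%:R)%R.

(** Summing [jump_shift] over [i] loses nothing, because [sum_leave_one_out] bounds the sum of
    [theta i * jump_weight i] by 1. *)
Lemma hits_shift :
  \int[Q]_x ((\sum_(i < n) (b i <= tnth x i)%R%:R * jump_weight i x) * soft l (S x))%:E <=
  gmean gF (l - v).
Proof.
have mi i : measurable_fun setT (fun x : n.-tuple R =>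
    ((b i <= tnth x i)%R%:R)%:E * (jump_weight i x * soft l (S x))%:E).
  exact: emeasurable_funM.
have mt i : measurable_fun setT (fun x : n.-tuple R =>
    (theta i (tnth x i))%:E * (jump_weight i x * soft (l - v) (S x))%:E).
  by apply: emeasurable_funM => //; exact/measurable_EFinP.
have hi i x : 0 <= ((b i <= tnth x i)%R%:R)%:E * (jump_weight i x * soft l (S x))%:E.
  by rewrite mule_ge0// lee_fin// mulr_ge0// soft_ge0.
have ht i x : 0 <= (theta i (tnth x i))%:E * (jump_weight i x * soft (l - v) (S x))%:E.
  by rewrite mule_ge0// lee_fin ?shift_ratio_ge0// mulr_ge0// soft_ge0.
apply: (@le_trans _ _ (\int[Q]_x (\sum_(i < n)
    (((b i <= tnth x i)%R%:R)%:E * (jump_weight i x * soft l (S x))%:E)))).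
  rewrite le_eqVlt; apply/orP; left; apply/eqP; apply: eq_integral => x _.
  rewrite mulr_suml -sumEFin; apply: eq_bigr => i _.
  by rewrite -mulrA EFinM.
rewrite ge0_integral_sum//.
apply: (@le_trans _ _ (\sum_(i < n) \int[Q]_x
    ((theta i (tnth x i))%:E * (jump_weight i x * soft (l - v) (S x))%:E))).
  by apply: lee_sum => i _; exact: jump_shift.
rewrite -ge0_integral_sum//; apply: le_integral_ge0 => x.
  by apply: sume_ge0 => i _; exact: ht.
under eq_bigr do rewrite -EFinM mulrA.
rewrite sumEFin -mulr_suml lee_fin -[leRHS]mul1r.
by apply: ler_wpM2r => //; exact: soft_ge0.
Qed.

(** The number of hits and the sum of the [theta i] have the same mean [tau], by [gibbs_tail_eq],
    and variances at most [tau]. Integrating [count_bound] gives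
    [1/2 <= 5 * gmean (l - v) + 5 / tau] with [5 / tau <= 1/8], so the mean at [l - v] is at least
    3/40. *)
Lemma anticoncentration (tau : R) : (40 <= tau)%R -> 2^-1%:E <= gmean gF l ->
  \sum_(i < n) \int[gibbs (gF i)]_y ((b i <= y)%R%:R)%:E = tau%:E ->
  (20^-1)%:E <= gmean gF (l - v).
Proof.
move=> t40 Gl tauE.
have t0 : (0 < tau)%R by lra.
pose a i := fine (\int[gibbs (gF i)]_y ((b i <= y)%R%:R)%:E).
have aE i : \int[gibbs (gF i)]_y ((b i <= y)%R%:R)%:E = (a i)%:E.
  rewrite fineK// ge0_fin_numE; last by apply: integral_ge0 => y _; rewrite lee_fin.
  exact: le_lt_trans (gibbs_tail_le (gF i) (b0 i)) (ltry _).
have sa : (\sum_(i < n) a i = tau)%R.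
  by apply: EFin_inj; rewrite -tauE -sumEFin; apply: eq_bigr => i _; rewrite aE.
have g1 i := gibbsT gF i.
have mb i : measurable_fun setT (fun y : R => (b i <= y)%R%:R : R).
  by apply: measurable_indb; exact: measurable_fun_ler.
have mT i := measurable_shift_ratio (gF i) (b i).
have h01 i (y : R) : (0 <= ((b i <= y)%R%:R : R) <= 1)%R by rewrite ler0n lern1 leq_b1.
have t01 i (y : R) : (0 <= theta i y <= 1)%R by rewrite shift_ratio_ge0 shift_ratio_le1.
have tE i : \int[gibbs (gF i)]_y (theta i y)%:E = (a i)%:E.
  by rewrite -(gibbs_tail_eq (gF i) (b0 i)) aE.
have := variance_sum 0 g1 mb h01 aE; have := variance_sum 0 g1 mT t01 tE.
rewrite sa expr0n/= !add0r.
under eq_integral do rewrite add0r.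
under [in X in _ -> X -> _]eq_integral do rewrite add0r.
move=> V2 V1.
pose T (x : n.-tuple R) := (\sum_(i < n) theta i (tnth x i))%R.
pose J (x : n.-tuple R) := (\sum_(i < n) (b i <= tnth x i)%R%:R * jump_weight i x)%R.
have T0 x : (0 <= T x)%R by exact: (sum_theta_ge0 xpredT).
have J0 x : (0 <= J x)%R by apply: sumr_ge0 => i _; rewrite mulr_ge0.
have NJ x : (hits x <= J x * (1 + T x))%R.
  rewrite /hits /J mulr_suml; apply: ler_sum => i _; case: (b i <= tnth x i)%R; rewrite ?mul0r// mul1r.
  rewrite -ler_pdivrMr; last by have := T0 x; lra.
  rewrite mul1r lef_pV2 ?posrE//; last by have := T0 x; lra.
  by rewrite lerD2l /T [leRHS](bigD1 i)//= lerDr shift_ratio_ge0.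
have mhits : measurable_fun setT hits.
  apply: measurable_sum => i; apply: measurable_indb.
  by apply: measurable_fun_ler => //; exact: measurable_tnth.
have mTT : measurable_fun setT T by apply: measurable_sum => i; exact: mtheta.
have mJ : measurable_fun setT (fun x => (J x * soft l (S x))%:E).
  apply/measurable_EFinP; apply: measurable_funM.
    apply: measurable_sum => i; apply: measurable_funM => //.
    by apply: measurable_indb; apply: measurable_fun_ler => //; exact: measurable_tnth.
  exact: (measurableT_comp (measurable_soft l) (measurable_gauge_sum gF)).
have mq (h : n.-tuple R -> R) : measurable_fun setT h ->
    measurable_fun setT (fun x => ((h x - tau) ^+ 2)%:E).
  by move=> mh; apply/measurable_EFinP; apply: measurable_funX; exact: measurable_funB.
have q0 (h : n.-tuple R -> R) x : 0 <= ((h x - tau) ^+ 2)%:E by rewrite lee_fin sqr_ge0.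
have Js0 x : 0 <= (J x * soft l (S x))%:E by rewrite lee_fin mulr_ge0// soft_ge0.
have t2 : (0 < tau ^+ 2)%R by rewrite exprn_gt0.
have c1 : 0 <= (4 / tau ^+ 2)%:E by rewrite lee_fin divr_ge0// ltW.
have c2 : 0 <= ((tau ^+ 2)^-1)%:E by rewrite lee_fin invr_ge0 ltW.
have : gmean gF l <= 5%:E * gmean gF (l - v) + ((4 / tau ^+ 2)%:E * tau%:E + ((tau ^+ 2)^-1)%:E * tau%:E).
  apply: (@le_trans _ _ (\int[Q]_x (5%:E * (J x * soft l (S x))%:E +
      ((4 / tau ^+ 2)%:E * ((hits x - tau) ^+ 2)%:E +
       ((tau ^+ 2)^-1)%:E * ((T x - tau) ^+ 2)%:E)))).
    apply: le_integral_ge0 => x; first by rewrite lee_fin soft_ge0.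
    by rewrite -!EFinM -!EFinD lee_fin; apply: count_bound; rewrite ?soft_ge0 ?soft_le1.
  have A1 x : 0 <= 5%:E * (J x * soft l (S x))%:E by rewrite mule_ge0// lee_fin.
  have A2 x : 0 <= (4 / tau ^+ 2)%:E * ((hits x - tau) ^+ 2)%:E by rewrite mule_ge0.
  have A3 x : 0 <= ((tau ^+ 2)^-1)%:E * ((T x - tau) ^+ 2)%:E by rewrite mule_ge0.
  have B1 : measurable_fun setT (fun x => 5%:E * (J x * soft l (S x))%:E).
    exact: measurable_funeM.
  have B2 : measurable_fun setT (fun x => (4 / tau ^+ 2)%:E * ((hits x - tau) ^+ 2)%:E).
    by apply: measurable_funeM; exact: mq.
  have B3 : measurable_fun setT (fun x => ((tau ^+ 2)^-1)%:E * ((T x - tau) ^+ 2)%:E).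
    by apply: measurable_funeM; exact: mq.
  rewrite (ge0_integralD _ measurableT) //; last 2 first.
  - by move=> x _; rewrite adde_ge0.
  - exact: emeasurable_funD.
  rewrite (ge0_integralD _ measurableT) //.
  apply: leeD.
    rewrite ge0_integralZl//; apply: lee_wpmul2l => //; exact: hits_shift.
  apply: leeD.
    rewrite (ge0_integralZl _ measurableT (mq _ mhits))//.
    by apply: lee_wpmul2l.
  rewrite (ge0_integralZl _ measurableT (mq _ mTT))//.
  by apply: lee_wpmul2l.
rewrite -!EFinM -EFinD.
have -> : (4 / tau ^+ 2 * tau + (tau ^+ 2)^-1 * tau = 5 / tau)%R.
  by field; rewrite gt_eqF.
have t8 : (5 / tau <= 8^-1)%R by rewrite ler_pdivrMr//; lra.
move: Gl (gmean_ge0 gF (l - v)); case: (gmean gF l) => [G| |]//; case: (gmean gF (l - v)) => [G'| |]//.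
- by rewrite -EFinM -EFinD !lee_fin => *; lra.
all: by rewrite ?leey// -?EFinM -?EFinD.
Qed.

End anticoncentration.

Section threshold.
Context {R : realType}.
Local Open Scope ereal_scope.
Variables (n : nat) (F : 'I_n -> R -> R) (gF : forall i, gauge (F i)).

(** Events are written [v <= F i y] instead of [b i <= y], so that the sum depends on [v] alone and
    no choice of thresholds is involved. *)
Definition tail_sum (v : R) : \bar R :=
  \sum_(i < n) \int[gibbs (gF i)]_y ((v <= F i y)%R%:R)%:E.

Lemma gauge_leP (f : R -> R) b y : gauge f -> (0 < b)%R -> (f b <= f y)%R = (b <= y)%R.
Proof.
move=> gf b0; apply/idP/idP => [|yb]; last exact: gauge_nd.
apply: contraTT; rewrite -!ltNge => yb; have [y0|y0] := leP 0%R y.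
  exact: gauge_inc.
case: (gf) => f0 fp _; rewrite (f0 y) ?(ltW y0)//.
exact: fp.
Qed.

Lemma gauge_inv_gt0 (f : R -> R) b : gauge f -> (0 <= b)%R -> (0 < f b)%R -> (0 < b)%R.
Proof.
move=> gf b0 fb; rewrite lt_neqAle b0 andbT; apply/eqP => b0'.
by move: fb; rewrite -b0' (gauge0 gf) ltxx.
Qed.

Lemma tail_sumE v (b : 'I_n -> R) : (0 < v)%R -> (forall i, (0 <= b i)%R) ->
  (forall i, F i (b i) = v) ->
  tail_sum v = \sum_(i < n) \int[gibbs (gF i)]_y ((b i <= y)%R%:R)%:E.
Proof.
move=> v0 b0 Fb; apply: eq_bigr => i _; apply: eq_integral => y _.
rewrite -(Fb i) gauge_leP//; apply: (gauge_inv_gt0 (gF i)) => //.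
by rewrite Fb.
Qed.

Lemma tail_sum_ge0 v : 0 <= tail_sum v.
Proof.
apply: sume_ge0 => i _; apply: integral_ge0 => y _.
by rewrite lee_fin.
Qed.

Lemma tail_sum_le v : (0 < v)%R -> tail_sum v <= (n%:R * expR (- v))%:E.
Proof.
move=> v0; apply: (@le_trans _ _ (\sum_(i < n) (expR (- v))%:E)).
  by apply: lee_sum => i _; exact: gibbs_gauge_tail.
by rewrite sumEFin sumr_const card_ord mulr_natl.
Qed.

Lemma tail_sum_fin v : (0 < v)%R -> tail_sum v = (fine (tail_sum v))%:E.
Proof.
move=> v0; rewrite fineK// ge0_fin_numE ?tail_sum_ge0//.
exact: le_lt_trans (tail_sum_le v0) (ltry _).
Qed.

(** Multiplying [v] by [c] multiplies each threshold by at most [c], since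
    [c * F i b <= F i (c * b)]; [gibbs_tail_step] then applies to each coordinate. *)
Lemma tail_sum_step v c : (0 < v)%R -> (1 <= c)%R ->
  tail_sum v <= tail_sum (c * v) + (n%:R * (c - 1))%:E.
Proof.
move=> v0 c1; have cv0 : (0 < c * v)%R by rewrite mulr_gt0//; lra.
rewrite mulr_natl -[in leRHS](card_ord n) -sumr_const -sumEFin -big_split/=.
apply: lee_sum => i _.
have [b b0 Fb] := gauge_surj (gF i) (ltW v0).
have [b' b0' Fb'] := gauge_surj (gF i) (ltW cv0).
have bp : (0 < b)%R by apply: (gauge_inv_gt0 (gF i)); rewrite ?Fb.
have bp' : (0 < b')%R by apply: (gauge_inv_gt0 (gF i)); rewrite ?Fb'.
have bb' : (b <= b' <= c * b)%R.
  apply/andP; split.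
    by rewrite -(gauge_leP b' (gF i) bp) Fb Fb' ler_peMl ?(ltW v0).
  rewrite -(gauge_leP (c * b)%R (gF i) bp') Fb' -Fb.
  exact: gauge_scale.
have := gibbs_tail_step (gF i) bp c1 bb'.
have E (a : R) : (0 < a)%R ->
    \int[gibbs (gF i)]_y ((F i a <= F i y)%R%:R)%:E =
    \int[gibbs (gF i)]_x ((a <= x)%R%:R)%:E.
  by move=> a0; apply: eq_integral => y _; rewrite gauge_leP.
by rewrite -Fb' -{1}Fb !E.
Qed.

(** If the tail sum at 1/8 is at most 40, lowering [l] by 1/8 costs at most 1/8 of the mean.
    Otherwise [v] is the last level of a geometric grid of ratio [1 + 1/n] before the tail sum first
    drops to 40 or less. One step changes the sum by at most [n * (1 / n) = 1], so the sum at [v]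
    lies between 40, as [anticoncentration] requires, and 41. *)
Lemma exists_threshold l : (0 < n)%N -> 2^-1%:E <= gmean gF l ->
  exists v : R, exists b : 'I_n -> R,
    [/\ (8^-1 <= v)%R, forall i, (0 < b i)%R, forall i, F i (b i) = v,
      \sum_(i < n) \int[gibbs (gF i)]_y ((b i <= y)%R%:R)%:E <= 41%:E &
      (20^-1)%:E <= gmean gF (l - v)].
Proof.
move=> n0 Gl.
suff [v v8 [tv gv]] : exists2 v : R, (8^-1 <= v)%R &
    tail_sum v <= 41%:E /\ (20^-1)%:E <= gmean gF (l - v).
  have v0 : (0 < v)%R by lra.
  have [b b0 Fb] := fin_all_exists2 (fun i => gauge_surj (gF i) (ltW v0)).
  exists v, b; split => //; last by rewrite -(tail_sumE v0).
  by move=> i; apply: (gauge_inv_gt0 (gF i)); rewrite ?Fb.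
have k0 : (0 < 8^-1 :> R)%R by [].
have [t40|t40] := leP (tail_sum 8^-1) 40%:E.
  exists 8^-1%R => //; split.
    by apply: (le_trans t40); rewrite lee_fin; lra.
  have : gmean gF l <= gmean gF (l - 8^-1) + 8^-1%:E.
    have s0 x : 0 <= (soft (l - 8^-1) (gauge_sum F x))%:E by rewrite lee_fin soft_ge0.
    have ms := measurable_soft_sum gF (l - 8^-1)%R.
    rewrite -[X in _ + X](integral_gibbs_cst gF) -ge0_integralD//; last first.
      by move=> x _; rewrite /cst lee_fin ltW.
    apply: le_integral_ge0 => x; first by rewrite lee_fin soft_ge0.
    by rewrite /cst -EFinD lee_fin; apply: softB_le.
  move=> /(le_trans Gl); rewrite -leeBlDr// => /(le_trans _); apply.
  by rewrite -EFinB lee_fin; lra.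
have nR : (0 < n%:R :> R)%R by rewrite ltr0n.
pose x : R := (n%:R^-1)%R; have x0 : (0 < x)%R by rewrite invr_gt0.
pose vk k := (8^-1 * (1 + x) ^+ k)%R.
have vk8 k : (8^-1 <= vk k)%R.
  by rewrite /vk ler_peMr// exprn_ege1//; lra.
have vk0 k : (0 < vk k)%R by exact: lt_le_trans (vk8 k).
pose P k := tail_sum (vk k) <= 40%:E.
have exP : exists k, P k.
  have [k hk] := expr1D_unbounded (8 * n%:R)%R x0; exists k.
  apply: (le_trans (tail_sum_le (vk0 k))); rewrite lee_fin.
  have nv : (n%:R < vk k)%R by rewrite /vk; lra.
  have ev : (expR (- vk k) <= (vk k)^-1)%R.
    rewrite expRN lef_pV2 ?posrE ?expR_gt0//.
    by have := expR_ge1Dx (vk k); lra.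
  apply: (le_trans (ler_wpM2l (ltW nR) ev)).
  by rewrite ler_pdivrMr//; have := vk0 k; lra.
case: (ex_minnP exP) => k Pk kmin.
case: k Pk kmin => [|k] Pk kmin.
  by move: Pk; rewrite /P /vk expr0 mulr1 leNgt t40.
have tk : 40%:E < tail_sum (vk k).
  by rewrite ltNge; apply/negP => /kmin; rewrite ltnn.
have vkS : vk k.+1 = ((1 + x) * vk k)%R by rewrite /vk exprS; ring.
exists (vk k) => //; split.
  have c1 : (1 <= 1 + x)%R by lra.
  apply: (le_trans (tail_sum_step (vk0 k) c1)); rewrite -vkS.
  apply: (@le_trans _ _ (40%:E + 1%:E)); last by rewrite -EFinD lee_fin; lra.
  by apply: leeD => //; rewrite lee_fin /x [(1 + _)%R]addrC addrK mulfV// gt_eqF.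
have [b b0 Fb] := fin_all_exists2 (fun i => gauge_surj (gF i) (ltW (vk0 k))).
apply: (anticoncentration b0 Fb (tau := fine (tail_sum (vk k)))) => //.
  by rewrite -lee_fin -tail_sum_fin// ltW.
by rewrite -(tail_sumE (vk0 k))// -tail_sum_fin.
Qed.

End threshold.

(** * Comparison with the product of the marginals *)

Section comparison.
Context {R : realType}.
Local Open Scope ereal_scope.
Local Notation SFM := {sigma_finite_measure set R -> \bar R}.

(** The mass of [nu] beyond [b], where the truncated integrand is [g b], is charged to [[b / 2, b]],
    where [g (2 * y) >= g b]. The resulting factor [(1 + C1) / p] in front is moved into the
    argument by convexity at 0, which is what allows iteration over the coordinates. *)
Lemma compare1 (nu m : SFM) (b C1 p : R) (g : R -> \bar R) :
  nu setT = 1 -> m setT = 1 -> (0 <= b)%R -> (0 <= C1)%R -> (0 < p <= 1)%R ->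
  (forall phi : R -> \bar R, measurable_fun setT phi -> (forall x, 0 <= phi x) ->
    (forall x y, (0 <= x <= y)%R -> phi x <= phi y) ->
    p%:E * \int[nu]_y (phi y * ((y <= b)%R%:R)%:E) <= \int[m]_y phi y) ->
  \int[nu]_y ((b < y)%R%:R)%:E <= C1%:E * \int[nu]_y ((b / 2 <= y <= b)%R%:R)%:E ->
  measurable_fun setT g -> (forall x, 0 <= g x) ->
  (forall x y, (x <= y)%R -> g x <= g y) -> (forall x, (x <= 0)%R -> g x = g 0%R) ->
  (forall C x, (1 <= C)%R -> C%:E * g x <= g (C * x)%R + (C - 1)%:E * g 0%R) ->
  \int[nu]_y g (Num.min y b) <= \int[m]_y g (2 * ((1 + C1) / p) * y)%R.
Proof.
move=> nu1 m1 b0 C10 /andP[p0 p1] A B mg g0 gnd gneg gstar.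
set C0 := ((1 + C1) / p)%R.
have C01 : (1 <= C0)%R by rewrite /C0 ler_pdivlMr//; lra.
have gge x : g 0%R <= g x.
  by have [x0|x0] := leP x 0%R; [rewrite gneg|exact/gnd/ltW].
have mlin (k : R) : measurable_fun setT (fun y : R => (k * y)%R) by exact: measurable_funM.
(* An infinite [g 0] makes the right side infinite. Otherwise [g 0] is subtracted, and convexity
   becomes [C * G x <= G (C * x)]. *)
move: (gge) (g0 0%R) gstar; case Eg0 : (g 0%R) => [r| |]// gge' r0 gstar; last first.
  suff -> : \int[m]_y g (2 * C0 * y)%R = +oo by rewrite leey.
  rewrite -[RHS](integral_prob_cst _ m1); apply: eq_integral => y _.
  by apply/eqP; rewrite -leye_eq.
pose G (x : R) : \bar R := g x - r%:E.
have G0 x : 0 <= G x by rewrite sube_ge0.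
have mG : measurable_fun setT G by apply: emeasurable_funB.
have GE x : g x = r%:E + G x by rewrite /G addeC subeK.
have Gnd x y : (x <= y)%R -> G x <= G y by move=> xy; rewrite leeB// gnd.
have Gneg x : (x <= 0)%R -> G x = 0 by move=> x0; rewrite /G gneg// Eg0 subee.
have Gstar C x : (1 <= C)%R -> C%:E * G x <= G (C * x)%R.
  move=> C1'; have := gstar C x C1'; rewrite /G.
  case: (g (C * x)%R) (gge' (C * x)%R) => [w| |]//; last by move=> _ _; exact: leey.
  case: (g x) (gge' x) => [u| |]//.
    by rewrite !lee_fin => *; rewrite -/(C * u)%R; lra.
  by rewrite gt0_muley ?lte_fin ?(lt_le_trans ltr01 C1')// -EFinM -EFinD.
have mG2 : measurable_fun setT (fun y : R => G (2 * y)%R) by apply: measurableT_comp => //; exact: mlin.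
have mle : measurable_fun setT (fun y : R => ((y <= b)%R%:R)%:E : \bar R).
  by apply/measurable_EFinP; apply: measurable_indb; exact: measurable_fun_ler.
have mlt : measurable_fun setT (fun y : R => ((b < y)%R%:R)%:E : \bar R).
  by apply/measurable_EFinP; apply: measurable_indb; exact: measurable_fun_ltr.
have mh : measurable_fun setT (fun y : R => ((b / 2 <= y <= b)%R%:R)%:E : \bar R).
  apply/measurable_EFinP; apply: measurable_indb.
  by apply: measurable_and; exact: measurable_fun_ler.
have i0 (B' : bool) : 0 <= (B'%:R)%:E :> \bar R by rewrite lee_fin.
pose I := \int[nu]_y (G (2 * y)%R * ((y <= b)%R%:R)%:E).
have key : \int[nu]_y G (Num.min y b) <= (1 + C1)%:E * I.
  apply: (@le_trans _ _ (\int[nu]_y (G (2 * y)%R * ((y <= b)%R%:R)%:E +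
      G b * ((b < y)%R%:R)%:E))).
    apply: le_integral_ge0 => y //; case: (leP y b) => yb.
      rewrite mule1 mule0 adde0; have [y0|y0] := leP y 0%R.
        by rewrite Gneg.
      by apply: Gnd; lra.
    by rewrite mule0 mule1 add0e.
  rewrite ge0_integralD//; last 4 first.
  - by move=> y _; rewrite mule_ge0.
  - exact: emeasurable_funM.
  - by move=> y _; rewrite mule_ge0.
  - exact: measurable_funeM.
  rewrite EFinD ge0_muleDl ?lee_fin// mul1e leeD2l//.
  rewrite ge0_integralZl//; apply: (@le_trans _ _ (G b * (C1%:E * \int[nu]_y ((b / 2 <= y <= b)%R%:R)%:E))).
    exact: lee_wpmul2l.
  rewrite muleCA; apply: lee_wpmul2l; first by rewrite lee_fin.
  rewrite -ge0_integralZl//; apply: le_integral_ge0 => y; first by rewrite mule_ge0.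
  case: (boolP (b / 2 <= y <= b)%R) => [/andP[y1 y2]|_]; last by rewrite mule0 mule_ge0.
  by rewrite y2 !mule1; apply: Gnd; lra.
have I0 : 0 <= I by apply: integral_ge0 => y _; rewrite mule_ge0.
have AI : p%:E * I <= \int[m]_y G (2 * y)%R.
  by apply: A => // x y /andP[x0 xy]; apply: Gnd; lra.
have fin : \int[nu]_y G (Num.min y b) <= \int[m]_y G (2 * C0 * y)%R.
  apply: (le_trans key).
  apply: (@le_trans _ _ (C0%:E * \int[m]_y G (2 * y)%R)).
    have -> : ((1 + C1)%:E = C0%:E * p%:E) by rewrite -EFinM /C0 divfK// gt_eqF.
    by rewrite -muleA; apply: lee_wpmul2l => //; rewrite lee_fin; lra.
  have c0 : 0 <= C0%:E by rewrite lee_fin; lra.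
  rewrite -ge0_integralZl//; apply: le_integral_ge0 => y; first by rewrite mule_ge0.
  by rewrite (_ : 2 * C0 * y = C0 * (2 * y))%R ?Gstar//; ring.
have mGm : measurable_fun setT (fun y : R => G (Num.min y b)).
  by apply: (measurableT_comp mG); exact: measurable_minr.
have mGK : measurable_fun setT (fun y : R => G (2 * C0 * y)%R).
  by apply: measurableT_comp => //; exact: mlin.
have r0' : 0 <= r%:E by [].
under eq_integral do rewrite GE.
under [leRHS]eq_integral do rewrite GE.
have En : \int[nu]_y r%:E = r%:E by exact: (integral_prob_cst _ nu1).
have Em : \int[m]_y r%:E = r%:E by exact: (integral_prob_cst _ m1).
rewrite [leLHS]ge0_integralD//= [leRHS]ge0_integralD//= En Em.
exact: leeD2l.
Qed.

Definition tmin n (x : n.-tuple R) (b : 'I_n -> R) : n.-tuple R :=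
  [tuple Num.min (tnth x i) (b i) | i < n].

Definition tscale n (c : R) (x : n.-tuple R) : n.-tuple R :=
  [tuple (c * tnth x i)%R | i < n].

Lemma tmin_cons n (x : R) (t : n.-tuple R) b :
  tmin (tuple_cons (x, t)) b =
  tuple_cons (Num.min x (b ord0), tmin t (fun i => b (lift ord0 i))).
Proof.
apply: eq_from_tnth => i; rewrite tnth_mktuple.
by case: (unliftP ord0 i) => [j|] -> //; rewrite !tnthS tnth_mktuple.
Qed.

Lemma tscale_cons n c (x : R) (t : n.-tuple R) :
  tscale c (tuple_cons (x, t)) = tuple_cons ((c * x)%R, tscale c t).
Proof.
apply: eq_from_tnth => i; rewrite tnth_mktuple.
by case: (unliftP ord0 i) => [j|] -> //; rewrite !tnthS tnth_mktuple.
Qed.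

Lemma measurable_tmin n b : measurable_fun setT (fun x : n.-tuple R => tmin x b).
Proof.
apply/measurable_fun_tnthP => j.
apply: (eq_measurable_fun (fun x : n.-tuple R => Num.min (tnth x j) (b j))).
  by move=> x _; rewrite /= tnth_mktuple.
by apply: measurable_minr => //; exact: measurable_tnth.
Qed.

Lemma measurable_tscale n c : measurable_fun setT (fun x : n.-tuple R => tscale c x).
Proof.
apply/measurable_fun_tnthP => j.
apply: (eq_measurable_fun (fun x : n.-tuple R => (c * tnth x j)%R)).
  by move=> x _; rewrite /= tnth_mktuple.
by apply: measurable_funM => //; exact: measurable_tnth.
Qed.

(** The last clause is convexity in coordinate [i], for its value as a mean of 0 and [C] times
    itself, with the denominator cleared. It is linear in [h], hence survives integration over the
    other coordinates. *)
Definition coord_convex n (h : n.-tuple R -> \bar R) :=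
  [/\ forall x y, (forall i, (tnth x i <= tnth y i)%R) -> h x <= h y,
      forall x i y, (y <= 0)%R -> h (upd x i y) = h (upd x i 0%R) &
      forall x i C, (1 <= C)%R -> C%:E * h x <=
        h (upd x i (C * tnth x i)%R) + (C - 1)%:E * h (upd x i 0%R)].

Lemma coord_convex_cons n (h : n.+1.-tuple R -> \bar R) x :
  coord_convex h -> coord_convex (fun t => h (tuple_cons (x, t))).
Proof.
move=> [hnd hneg hstar]; split => [t t' tt'|t i y y0|t i C C1].
- by apply: hnd => i; case: (unliftP ord0 i) => [j|] ->; rewrite ?tnthS.
- by rewrite -!upd_consS hneg.
- by have := hstar (tuple_cons (x, t)) (lift ord0 i) C C1; rewrite !upd_consS tnthS.
Qed.

(** Once the other coordinates are replaced by the induction hypothesis and integrated out, what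
    remains is a function [H] of the first coordinate that [compare1] accepts. Each coordinate is
    dilated by the same factor, so nothing accumulates with [n]. *)
Lemma prod_compare n (nu m : 'I_n -> SFM) (b : 'I_n -> R) (C1 p : R) :
  (forall i, nu i setT = 1) -> (forall i, m i setT = 1) ->
  (forall i, (0 <= b i)%R) -> (0 <= C1)%R -> (0 < p <= 1)%R ->
  (forall i (phi : R -> \bar R), measurable_fun setT phi -> (forall x, 0 <= phi x) ->
    (forall x y, (0 <= x <= y)%R -> phi x <= phi y) ->
    p%:E * \int[nu i]_y (phi y * ((y <= b i)%R%:R)%:E) <= \int[m i]_y phi y) ->
  (forall i, \int[nu i]_y ((b i < y)%R%:R)%:E <=
    C1%:E * \int[nu i]_y ((b i / 2 <= y <= b i)%R%:R)%:E) ->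
  forall h : n.-tuple R -> \bar R, measurable_fun setT h -> (forall x, 0 <= h x) ->
  coord_convex h ->
  \int[mprod nu]_x h (tmin x b) <= \int[mprod m]_x h (tscale (2 * ((1 + C1) / p)) x).
Proof.
move=> + + + C10 p01.
elim: n nu m b => [|n ih] nu m b nu1 m1 b0 A B h mh h0 ch.
  have E (x : 0.-tuple R) : x = [tuple] by exact: tuple0.
  rewrite !integral_mprod0.
  - by rewrite (E (tmin _ _)) (E (tscale _ _)).
  - exact: (measurableT_comp mh (measurable_tscale _)).
  - exact: (measurableT_comp mh (measurable_tmin _)).
set K := (2 * ((1 + C1) / p))%R.
have mhb := measurableT_comp mh (measurable_tmin b).
have mhK := measurableT_comp mh (measurable_tscale (n := n.+1) K).
rewrite !integral_mprodS//.
pose H z := \int[mprod (fun i => m (lift ord0 i))]_t h (tuple_cons (z, tscale K t)).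
have mhz : measurable_fun setT (fun x : n.+1.-tuple R =>
    h (tuple_cons (tnth x ord0, tscale K [tuple of behead x]))).
  apply: (measurableT_comp mh); apply: (measurableT_comp (@measurable_tuple_cons R n)).
  apply: measurable_fun_pair; first exact: measurable_tnth.
  apply: (measurableT_comp (@measurable_tscale n K)).
  exact: measurable_behead.
have HE z : H z = \int[mprod (fun i => m (lift ord0 i))]_t
    h (tuple_cons (tnth (tuple_cons (z, t)) ord0, tscale K [tuple of behead (tuple_cons (z, t))])).
  apply: eq_integral => t _; congr (h (tuple_cons (_, tscale K _))).
  exact: val_inj.
have mH : measurable_fun setT H.
  rewrite (funext HE).
  exact: (measurable_cons_integral (mprod (fun i => m (lift ord0 i))) mhz).
have mhs z : measurable_fun setT (fun t : n.-tuple R => h (tuple_cons (z, tscale K t))).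
  exact: (measurableT_comp (measurable_cons_section z mh) (measurable_tscale K)).
have H0 z : 0 <= H z by exact: integral_ge0.
case: (ch) => hnd hneg hstar.
apply: (@le_trans _ _ (\int[nu ord0]_x H (Num.min x (b ord0)))).
  apply: le_integral_ge0 => x; first exact: integral_ge0.
  under eq_integral do rewrite /= tmin_cons.
  apply: (ih (fun i => nu (lift ord0 i)) (fun i => m (lift ord0 i)) _ _ _ _ _ _
    (fun t => h (tuple_cons (Num.min x (b ord0), t)))) => //.
  - by move=> i; exact: A.
  - exact: measurable_cons_section.
  - exact: coord_convex_cons.
apply: (@le_trans _ _ (\int[m ord0]_x H (K * x)%R)); last first.
  rewrite le_eqVlt; apply/orP; left; apply/eqP; apply: eq_integral => x _.
  by apply: eq_integral => t _; rewrite /= tscale_cons.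
apply: compare1 => //.
- exact: A.
- by move=> x y xy; apply: le_integral_ge0 => // t; apply: hnd => i;
    case: (unliftP ord0 i) => [j|] ->; rewrite ?tnthS.
- move=> x x0; apply: eq_integral => t _.
  by rewrite -(upd_cons0 _ 0%R x) hneg// upd_cons0.
- move=> C x C1'; have cc : 0 <= C%:E by rewrite lee_fin; lra.
  have cc1 : 0 <= (C - 1)%:E by rewrite lee_fin; lra.
  rewrite -!ge0_integralZl// -ge0_integralD//; last 2 first.
  + by move=> t _; rewrite mule_ge0.
  + by apply: measurable_funeM.
  apply: le_integral_ge0 => t; first by rewrite mule_ge0.
  by have := hstar (tuple_cons (x, tscale K t)) ord0 C C1'; rewrite !upd_cons0.
Qed.

End comparison.

(** * The part above the thresholds *)

Section big_part.
Context {R : realType}.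
Local Open Scope ereal_scope.
Local Notation SFM := {sigma_finite_measure set R -> \bar R}.

(** Let [D i] be the inverse of 1 plus the number of other coordinates above their thresholds. Each
    excess [xi i] is at most [h] times the indicator [I i], so the sum of [xi i * D i] is at most
    [h], by [sum_leave_one_out]. As [D i] is independent of coordinate [i] and has mean at least
    [1 / (1 + a)], it can be taken out of the expectation. *)
Lemma sum_excess_le n (m : 'I_n -> SFM) (b c : 'I_n -> R) (a : R) (h : n.-tuple R -> \bar R) :
  (forall i, m i setT = 1) -> (forall i, (0 <= b i)%R) -> (forall i, (0 <= c i)%R) ->
  (0 <= a)%R -> \sum_(i < n) \int[m i]_y ((b i <= y)%R%:R)%:E <= a%:E ->
  (forall x, 0 <= h x) -> (forall x i, (c i * Num.max 0 (tnth x i))%:E <= h x) ->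
  \sum_(i < n) \int[m i]_y (c i * Num.max 0 (y - b i))%:E <=
  (1 + a)%:E * \int[mprod m]_x h x.
Proof.
move=> m1 b0 c0 a0 tail h0 ch.
pose I i (y : R) : R := (b i <= y)%R%:R.
pose N i (x : n.-tuple R) : R := (\sum_(j < n | j != i) I j (tnth x j))%R.
pose D i (x : n.-tuple R) : R := ((1 + N i x)^-1)%R.
pose xi i (y : R) : R := (c i * Num.max 0 (y - b i))%R.
have I01 i y : (0 <= I i y <= 1)%R by rewrite /I; case: (b i <= y)%R; rewrite ?lexx ?ler01.
have I0 i y : (0 <= I i y)%R by case/andP : (I01 i y).
have N0 i x : (0 <= N i x)%R by exact: sumr_ge0.
have D0 i x : (0 <= D i x)%R by rewrite invr_ge0 addr_ge0.
have xi0 i y : (0 <= xi i y)%R by rewrite mulr_ge0// le_max lexx.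
have mI i : measurable_fun setT (I i) by apply: measurable_indb; exact: measurable_fun_ler.
have mxi i : measurable_fun setT (EFin \o xi i).
  apply/measurable_EFinP; apply: measurable_funM => //.
  by apply: measurable_maxr => //; exact: measurable_funB.
have mIt j : measurable_fun setT (fun x : n.-tuple R => I j (tnth x j)).
  by apply: (measurableT_comp (mI j)); exact: measurable_tnth.
have mN i : measurable_fun setT (N i).
  rewrite (_ : N i = fun x => \sum_(j < n) ((j != i)%:R * I j (tnth x j)))%R.
    by apply: measurable_sum => j; exact: measurable_funM.
  apply/funext => x; rewrite /N big_mkcond; apply: eq_bigr => j _.
  by case: (j != i); rewrite ?mul1r ?mul0r.
have mD i : measurable_fun setT (EFin \o D i).
  apply/measurable_EFinP.
  rewrite (_ : D i = fun x => ((1 + N i x) `^ (- 1))%R); last first.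
    by apply/funext => x; rewrite powR_inv1// addr_ge0.
  by apply: (measurableT_comp (measurable_powR _)); exact: measurable_funD.
have Du i x y : D i (upd x i y) = D i x.
  rewrite /D /N; congr (_ + _)^-1%R; apply: eq_bigr => j ji.
  by rewrite tnth_upd (negbTE ji).
have A0 : (0 < 1 + a)%R by lra.
have IN i : \int[mprod m]_x (1 + N i x)%:E <= (1 + a)%:E.
  apply: (@le_trans _ _
      (\int[mprod m]_x (cst 1 x + \sum_(j < n) (I j (tnth x j))%:E))).
    apply: le_integral_ge0 => x; first by rewrite lee_fin addr_ge0.
    by rewrite sumEFin -EFinD lee_fin lerD2l [leRHS](bigD1 i)//= lerDr.
  have mIE j : measurable_fun setT (fun x : n.-tuple R => (I j (tnth x j))%:E).
    exact/measurable_EFinP.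
  rewrite ge0_integralD//; last 2 first.
  - by move=> x _; apply: sume_ge0 => j _; rewrite lee_fin.
  - exact: emeasurable_sum.
  rewrite integral_mprod_cst// EFinD leeD2l// ge0_integral_sum//; last by move=> j x _; rewrite lee_fin.
  apply: le_trans tail.
  apply: lee_sum => j _.
  rewrite (integral_mprod_coord (g := EFin \o I j))//; last by move=> y; rewrite lee_fin.
  exact/measurable_EFinP.
have ID i : ((1 + a)^-1)%:E <= \int[mprod m]_x (D i x)%:E.
  set A := (1 + a)%R in A0 IN *.
  (* Jensen's inequality for [1 / z] through the tangent at [z = A]: integration gives
     [2 / A <= E D + A / A^2]. *)
  have pt x : (2 * A^-1 <= D i x + (A ^- 2) * (1 + N i x))%R.
    rewrite /D; set z := (1 + N i x)%R; have z0 : (0 < z)%R by rewrite /z; have := N0 i x; lra.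
    have <- : (2 * A^-1 + z * (z^-1 - A^-1) ^+ 2 = z^-1 + A ^- 2 * z)%R.
      by field; rewrite !gt_eqF.
    by rewrite lerDl mulr_ge0 ?sqr_ge0// ltW.
  have A2 : (0 <= A ^- 2)%R by rewrite invr_ge0 sqr_ge0.
  have k0 x : 0 <= (1 + N i x)%:E by rewrite lee_fin addr_ge0.
  have mk : measurable_fun setT (fun x => (1 + N i x)%:E).
    by apply/measurable_EFinP; exact: measurable_funD.
  have mk' : measurable_fun setT (fun x => (A ^- 2)%:E * (1 + N i x)%:E).
    exact: measurable_funeM.
  have k0' x : 0 <= (A ^- 2)%:E * (1 + N i x)%:E by rewrite mule_ge0.
  have d0 x : 0 <= (D i x)%:E by rewrite lee_fin.
  suff : (2 * A^-1)%:E <= \int[mprod m]_x (D i x)%:E + (A^-1)%:E.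
    by rewrite -leeBlDr// -EFinB (_ : 2 * A^-1 - A^-1 = A^-1)%R//; ring.
  apply: (@le_trans _ _ (\int[mprod m]_x ((D i x)%:E + (A ^- 2)%:E * (1 + N i x)%:E))).
    rewrite -[leLHS](integral_mprod_cst _ m1).
    apply: le_integral_ge0 => x; first by rewrite lee_fin mulr_ge0// invr_ge0 ltW.
    by rewrite -EFinM -EFinD lee_fin.
  have -> : \int[mprod m]_x ((D i x)%:E + (A ^- 2)%:E * (1 + N i x)%:E) =
      \int[mprod m]_x (D i x)%:E + \int[mprod m]_x ((A ^- 2)%:E * (1 + N i x)%:E).
    apply: ge0_integralD => //; exact: mD.
  have -> : \int[mprod m]_x ((A ^- 2)%:E * (1 + N i x)%:E) =
      (A ^- 2)%:E * \int[mprod m]_x (1 + N i x)%:E.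
    by apply: ge0_integralZl => //.
  rewrite leeD2l//; apply: (@le_trans _ _ ((A ^- 2)%:E * A%:E)).
    exact: lee_wpmul2l.
  by rewrite -EFinM lee_fin expr2 invfM mulfVK// gt_eqF.
have pt x : \sum_(i < n) (xi i (tnth x i))%:E * (D i x)%:E <= h x.
  case E : (h x) (h0 x) => [H| |]// H0; last exact: leey.
  under eq_bigr do rewrite -EFinM.
  rewrite sumEFin lee_fin.
  apply: (@le_trans _ _ (\sum_(i < n) H * (I i (tnth x i) * D i x))%R); last first.
    rewrite -mulr_sumr ler_piMr ?lee_fin//.
    exact: (@sum_leave_one_out R n (fun i => I i (tnth x i))).
  apply: ler_sum => i _; rewrite mulrA; apply: ler_wpM2r => //.
  have := ch x i; rewrite E lee_fin /xi /I; case: (leP (b i) (tnth x i)) => bx.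
    rewrite mulr1; apply: le_trans; apply: ler_wpM2l => //.
    by rewrite le_max2// lerBlDr lerDl.
  by move=> _; rewrite mulr0 max_l ?mulr0// subr_le0 ltW.
have e0 i y : 0 <= (xi i y)%:E by rewrite lee_fin.
have d0 i x : 0 <= (D i x)%:E by rewrite lee_fin.
have mxt i : measurable_fun setT (fun x : n.-tuple R => (xi i (tnth x i))%:E).
  by apply: (measurableT_comp (mxi i)); exact: measurable_tnth.
apply: (@le_trans _ _ ((1 + a)%:E *
    \int[mprod m]_x \sum_(i < n) (xi i (tnth x i))%:E * (D i x)%:E)); last first.
  apply: lee_wpmul2l; first by rewrite lee_fin ltW.
  by apply: le_integral_ge0 => // x; apply: sume_ge0 => i _; rewrite mule_ge0.
rewrite ge0_integral_sum//; last 2 first.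
- by move=> i; apply: emeasurable_funM; [exact: mxt|exact: mD].
- by move=> i x _; rewrite mule_ge0.
rewrite ge0_sume_distrr; last by move=> i _; apply: integral_ge0 => x _; rewrite mule_ge0.
apply: lee_sum => i _.
have -> : \int[mprod m]_x ((xi i (tnth x i))%:E * (D i x)%:E) =
    \int[m i]_y (xi i y)%:E * \int[mprod m]_x (D i x)%:E.
  apply: (integral_mprod_indep (g := EFin \o xi i) (k := EFin \o D i)) => //.
  - by move=> y; exact: e0.
  - by move=> x; exact: d0.
  - by move=> x y /=; rewrite Du.
have X0 : 0 <= \int[m i]_y (xi i y)%:E by exact: integral_ge0.
rewrite [X in _ <= X]muleCA -[leLHS]mule1; apply: lee_wpmul2l => //.
apply: (@le_trans _ _ ((1 + a)%:E * ((1 + a)^-1)%:E)).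
  by rewrite -EFinM mulfV// gt_eqF.
by apply: lee_wpmul2l (ID i); rewrite lee_fin ltW.
Qed.

End big_part.

(** * Sublevel sets against the Gibbs law, and the comparison for an abstract functional *)

Section core_lemmas.
Context {R : realType}.
Local Open Scope ereal_scope.
Local Notation SFM := {sigma_finite_measure set R -> \bar R}.

Lemma le_pmul2r_fin (x y : \bar R) (v : R) : (0 < v)%R -> x * v%:E <= y * v%:E -> x <= y.
Proof. by move=> v0; rewrite lee_pmul2r// lte_fin. Qed.

Section fixed.
Variables (n : nat) (F : 'I_n -> R -> R) (gF : forall i, gauge (F i)) (l : R).
Local Notation Q := (gibbs_prod gF).
Local Notation S := (gauge_sum F).

(** The factor 3 is the inverse of the lower bound 1/3 for the mean of [1 - soft l S]. *)
Lemma integral_sublevel_le_gibbs (g : n.-tuple R -> \bar R) :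
  gmean gF l <= (2 / 3)%:E -> measurable_fun setT g -> (forall x, 0 <= g x) ->
  increasing_on_ge0 g ->
  integral_sublevel F l g <= 3%:E * \int[Q]_x g x * sublevel_vol F l.
Proof.
move=> G mg g0 ig; have V0 : 0 <= sublevel_vol F l by exact: integral_sublevel_ge0.
have I0 : 0 <= integral_sublevel F l g by exact: integral_sublevel_ge0.
have [W vW WE] := sublevel_volP gF.
have third : (3^-1)%:E <= \int[Q]_x (1 - soft l (S x))%:E.
  have := gmeanC gF l; move: G (gmean_ge0 gF l).
  case: (gmean gF l) => // u; rewrite !lee_fin => u1 u0.
  have : 0 <= \int[Q]_x (1 - soft l (S x))%:E.
    by apply: integral_ge0 => x _; rewrite lee_fin subr_ge0 soft_le1.
  by case: (\int[Q]_x _) => // w _; rewrite -EFinD => -[]; rewrite lee_fin; lra.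
have := uniform_le_gibbs gF l mg g0 ig; move: third.
have : \int[Q]_x (g x * (1 - soft l (S x))%:E) <= \int[Q]_x g x.
  apply: le_integral_ge0 => x; first by rewrite mule_ge0// lee_fin subr_ge0 soft_le1.
  by rewrite -[leRHS]mule1; apply: lee_wpmul2l => //; rewrite lee_fin gerBl soft_ge0.
move: (\int[Q]_x (1 - _)%:E) (\int[Q]_x (g x * _)) (\int[Q]_x g x) => a b c bc ta ab.
rewrite -muleA -[leLHS]mul1e (_ : 1 = 3%:E * (3^-1)%:E); last by rewrite -EFinM mulfV.
rewrite -muleA; apply: lee_wpmul2l; first by rewrite lee_fin.
apply: (le_trans (lee_wpmul2r I0 ta)); apply: (le_trans ab).
exact: lee_wpmul2r.
Qed.

(** Where coordinate [i] is at most [b] it contributes at most [v] to the sum, so [soft l S]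
    dominates [soft (l - v) T], [T] being the sum over the other coordinates. That factor is
    independent of coordinate [i], and its mean is at least 1/20 because [T <= S]. *)
Lemma gibbs_truncated_le_uniform (v b : R) i (phi : R -> \bar R) :
  F i b = v -> (20^-1)%:E <= gmean gF (l - v) ->
  measurable_fun setT phi -> (forall x, 0 <= phi x) ->
  (forall x y, (0 <= x <= y)%R -> phi x <= phi y) ->
  (20^-1)%:E * \int[gibbs (gF i)]_y (phi y * ((y <= b)%R%:R)%:E) * sublevel_vol F l <=
  integral_sublevel F l (fun x => phi (tnth x i)).
Proof.
move=> Fb G mphi phi0 iphi.
have V0 : 0 <= sublevel_vol F l by exact: integral_sublevel_ge0.
pose T (x : n.-tuple R) := (\sum_(j < n | j != i) F j (tnth x j))%R.
pose k (x : n.-tuple R) := (soft (l - v) (T x))%:E.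
have Tu x y : T (upd x i y) = T x.
  by apply: eq_bigr => j ji; rewrite tnth_upd (negbTE ji).
have ST x : S x = (F i (tnth x i) + T x)%R by rewrite /gauge_sum (bigD1 i).
have k0 x : 0 <= k x by rewrite lee_fin soft_ge0.
have mT : measurable_fun setT T.
  rewrite (_ : T = fun x => \sum_(j < n) ((j != i)%:R * F j (tnth x j)))%R.
    apply: measurable_sum => j; apply: measurable_funM => //.
    by apply: (measurableT_comp (measurable_gauge (gF j))); exact: measurable_tnth.
  apply/funext => x; rewrite /T big_mkcond; apply: eq_bigr => j _.
  by case: (j != i); rewrite ?mul1r ?mul0r.
have mk : measurable_fun setT k.
  by apply/measurable_EFinP; exact: (measurableT_comp (measurable_soft _)).
have Gk : (20^-1)%:E <= \int[Q]_x k x.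
  apply: (le_trans G); apply: le_integral_ge0 => x; first by rewrite lee_fin soft_ge0.
  rewrite lee_fin; apply: soft_nd; rewrite ST.
  by have := gauge_ge0 (tnth x i) (gF i); lra.
pose psi (y : R) := phi y * ((y <= b)%R%:R)%:E.
have mpsi : measurable_fun setT psi.
  apply: emeasurable_funM => //; apply/measurable_EFinP; apply: measurable_indb.
  exact: measurable_fun_ler.
have psi0 y : 0 <= psi y by rewrite mule_ge0// lee_fin.
have ind := integral_mprod_indep (i := i) (gibbsT gF) mpsi psi0 mk k0
  (fun x y => congr1 (fun t => (soft (l - v) t)%:E) (Tu x y)).
have le1 : \int[Q]_x (psi (tnth x i) * k x) <=
    \int[Q]_x (phi (tnth x i) * (soft l (S x))%:E).
  apply: le_integral_ge0 => x; first by rewrite mule_ge0.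
  rewrite /psi; case: (leP (tnth x i) b) => xb; last first.
    by rewrite mule0 mul0e mule_ge0// lee_fin soft_ge0.
  rewrite mule1; apply: lee_wpmul2l => //; rewrite lee_fin; apply: soft_nd.
  by rewrite ST -Fb; have := gauge_nd (gF i) xb; lra.
have mp : measurable_fun setT (fun x : n.-tuple R => phi (tnth x i)).
  by apply: (measurableT_comp mphi); exact: measurable_tnth.
have ip : increasing_on_ge0 (fun x : n.-tuple R => phi (tnth x i)).
  by move=> x y xy; apply: iphi.
have le2 := gibbs_le_uniform gF l mp (fun x => phi0 (tnth x i)) ip.
have G1 : \int[Q]_x (soft l (S x))%:E <= 1.
  rewrite -[leRHS](integral_gibbs_cst gF); apply: le_integral_ge0 => x.
    by rewrite lee_fin soft_ge0.
  by rewrite lee_fin soft_le1.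
have I0 : 0 <= integral_sublevel F l (fun x => phi (tnth x i)).
  exact: integral_sublevel_ge0.
have P0 : 0 <= \int[gibbs (gF i)]_y psi y by exact: integral_ge0.
rewrite -/psi; apply: (@le_trans _ _ (\int[Q]_x (psi (tnth x i) * k x) * sublevel_vol F l)).
  apply: lee_wpmul2r => //; rewrite [leRHS]ind muleC.
  exact: lee_wpmul2l.
apply: (le_trans (lee_wpmul2r V0 le1)); apply: (le_trans le2).
rewrite -[leRHS]mul1e; exact: lee_wpmul2r.
Qed.

End fixed.

Lemma sublevel_scale n (f : 'I_n -> R -> R) (l : R) : (0 < l)%R ->
  sublevel (fun i x => l * f i x)%R l = sublevel f 1.
Proof.
move=> l0; apply/funext => x; rewrite /sublevel /gauge_sum -mulr_sumr.
by rewrite -{2}[l]mulr1 ler_pM2l.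
Qed.

End core_lemmas.

Section core.
Context {R : realType}.
Local Open Scope ereal_scope.
Local Notation SFM := {sigma_finite_measure set R -> \bar R}.

(** The dilation of [compare1] for [p = 1/20] and [C1 = 16], the bound for the factor [2 / v] of
    [gibbs_tail_half] when [v >= 1/8]. *)
Definition cmp_scale : R := (2 * ((1 + 16) / 20^-1))%R.
(** The first term pays for the truncated vector, the second for the excess; [3 * 41] bounds the
    mean number of coordinates of the product of marginals above their thresholds. *)
Definition cmp_const : R := (3 * cmp_scale + (1 + 3 * 41))%R.

Lemma cmp_scale_gt0 : (0 < cmp_scale)%R.
Proof. by rewrite /cmp_scale mulr_gt0// divr_gt0// ?invr_gt0// addr_gt0. Qed.

Lemma cmp_const_gt0 : (0 < cmp_const)%R.
Proof. by rewrite addr_gt0// ?mulr_gt0 ?cmp_scale_gt0// addr_gt0// mulr_gt0. Qed.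

(** The hypotheses on [h] list what is used of the supremum, [c i] standing for the supremum of the
    coordinates [t i]. Expectations over the body appear multiplied by its volume, which avoids
    dividing integrals. *)
Lemma sublevel_comparison n (f : 'I_n -> R -> R) (m : 'I_n -> SFM)
    (h : n.-tuple R -> \bar R) (c : 'I_n -> R) :
  (0 < n)%N -> (forall i, gauge (f i)) -> (forall i, m i setT = 1) ->
  (forall i (g : R -> \bar R), measurable_fun setT g -> (forall x, 0 <= g x) ->
    \int[m i]_y g y * sublevel_vol f 1 =
    integral_sublevel f 1 (fun x => g (tnth x i))) ->
  measurable_fun setT h -> (forall x, 0 <= h x) -> coord_convex h ->
  (forall i, (0 <= c i)%R) ->
  (forall x b, (forall i, 0 <= b i)%R -> h x <= h (tmin x b) +
    (\sum_(i < n) c i * Num.max 0 (tnth x i - b i))%:E) ->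
  (forall x i, (c i * Num.max 0 (tnth x i))%:E <= h x) ->
  (forall x k, (0 < k)%R -> h (tscale k x) = k%:E * h x) ->
  integral_sublevel f 1 h <=
  cmp_const%:E * \int[mprod m]_x h x * sublevel_vol f 1.
Proof.
move=> n0 gf m1 marg mh h0 ch c0 htri hc hhom.
have [l l0 [gF [G1 G2]]] := exists_level n0 gf.
have [v [b [v8 bpos Fb tail G20]]] := exists_threshold n0 (ltW G1).
have b0 i : (0 <= b i)%R by exact/ltW/bpos.
set F := (fun i x => l * f i x)%R in gF G1 G2 Fb tail G20.
have ISE g : integral_sublevel F l g = integral_sublevel f 1 g.
  by rewrite /integral_sublevel (sublevel_scale f l0).
have VE : sublevel_vol F l = sublevel_vol f 1 by exact: ISE.
have [W [_ Wpos _ _] WE] := sublevel_volP gf.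
have W1 : (0 < W 1)%R by exact: Wpos.
set Q := gibbs_prod gF.
have A i (phi : R -> \bar R) : measurable_fun setT phi -> (forall x, 0 <= phi x) ->
    (forall x y, (0 <= x <= y)%R -> phi x <= phi y) ->
    (20^-1)%:E * \int[gibbs (gF i)]_y (phi y * ((y <= b i)%R%:R)%:E) <= \int[m i]_y phi y.
  move=> mphi phi0 iphi; apply: (le_pmul2r_fin W1).
  have := gibbs_truncated_le_uniform (Fb i) G20 mphi phi0 iphi.
  by rewrite VE ISE -(marg i)// WE.
have v0 : (0 < v)%R by exact: lt_le_trans v8.
have B i : \int[gibbs (gF i)]_y ((b i < y)%R%:R)%:E <=
    16%:E * \int[gibbs (gF i)]_y ((b i / 2 <= y <= b i)%R%:R)%:E.
  apply: (le_trans (gibbs_tail_half (gF i) (bpos i))).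
  apply: lee_wpmul2r; first by apply: integral_ge0 => y _; rewrite lee_fin.
  by rewrite lee_fin Fb ler_pdivrMr//; lra.
have mhb : measurable_fun setT (fun x => h (tmin x b)).
  exact: (measurableT_comp mh (measurable_tmin b)).
have hnd : forall x y, (forall i, (tnth x i <= tnth y i)%R) -> h x <= h y by case: ch.
have J0 : 0 <= \int[mprod m]_x h x by exact: integral_ge0.
have V0 : 0 <= sublevel_vol f 1 by exact: integral_sublevel_ge0.
have small : integral_sublevel f 1 (fun x => h (tmin x b)) <=
    (3 * cmp_scale)%:E * \int[mprod m]_x h x * sublevel_vol f 1.
  rewrite -ISE -VE.
  apply: (le_trans (integral_sublevel_le_gibbs G2 mhb (fun x => h0 _) _)).
    move=> x y xy; apply: hnd => i; rewrite !tnth_mktuple.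
    have /andP[_ xyi] := xy i; by rewrite le_min !ge_min xyi lexx orbT.
  rewrite VE; apply: lee_wpmul2r => //.
  rewrite EFinM -muleA; apply: lee_wpmul2l; first by rewrite lee_fin.
  have p01 : (0 < (20^-1 : R) <= 1)%R by apply/andP; split; lra.
  have := prod_compare (gibbsT gF) m1 b0 (ler0n R 16) p01 A B mh h0 ch.
  rewrite -/cmp_scale.
  under [leRHS]eq_integral do rewrite (hhom _ _ cmp_scale_gt0).
  have <- : \int[mprod m]_x (cmp_scale%:E * h x) = cmp_scale%:E * \int[mprod m]_x h x.
    by apply: ge0_integralZl => //; rewrite lee_fin ltW// cmp_scale_gt0.
  exact.
pose xi i (y : R) : \bar R := (c i * Num.max 0 (y - b i))%:E.
have xi0 i y : 0 <= xi i y by rewrite lee_fin mulr_ge0// le_max lexx.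
have mxi i : measurable_fun setT (xi i).
  apply/measurable_EFinP; apply: measurable_funM => //.
  by apply: measurable_maxr => //; exact: measurable_funB.
(* Exceeding a threshold is an increasing event, so its probability under the marginal is at most 3
   times that under the Gibbs law. *)
have tailm : \sum_(i < n) \int[m i]_y ((b i <= y)%R%:R)%:E <= (3 * 41)%:E.
  apply: (@le_trans _ _ (3%:E * \sum_(i < n) \int[gibbs (gF i)]_y ((b i <= y)%R%:R)%:E)).
    rewrite ge0_sume_distrr; last first.
      by move=> i _; apply: integral_ge0 => y _; rewrite lee_fin.
    apply: lee_sum => i _; apply: (le_pmul2r_fin W1).
    pose I (y : R) : \bar R := ((b i <= y)%R%:R)%:E.
    have I0 y : 0 <= I y by rewrite lee_fin.
    have mI : measurable_fun setT I.
      by apply/measurable_EFinP; apply: measurable_indb; exact: measurable_fun_ler.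
    rewrite -WE (marg i I)// -ISE -VE.
    have mIt : measurable_fun setT (fun x : n.-tuple R => I (tnth x i)).
      by apply: (measurableT_comp mI); exact: measurable_tnth.
    apply: (le_trans (integral_sublevel_le_gibbs G2 mIt (fun x => I0 _) _)).
      move=> x y /(_ i)/andP[_ xy]; rewrite lee_fin /I.
      by case: (leP (b i) (tnth x i)) => // bx; rewrite (le_trans bx xy).
    by rewrite (gibbs_coord gF).
  by rewrite EFinM; apply: lee_wpmul2l => //; rewrite lee_fin.
have a0 : (0 <= (3 * 41 : R))%R by rewrite mulr_ge0.
have big := sum_excess_le m1 b0 c0 a0 tailm h0 hc.
have mxt i : measurable_fun setT (fun x : n.-tuple R => xi i (tnth x i)).
  by apply: (measurableT_comp (mxi i)); exact: measurable_tnth.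
have split : integral_sublevel f 1 h <=
    integral_sublevel f 1 (fun x => h (tmin x b)) +
    \sum_(i < n) integral_sublevel f 1 (fun x => xi i (tnth x i)).
  have s0 x : 0 <= (sublevel f 1 x)%:R%:E :> \bar R by rewrite lee_fin.
  rewrite /integral_sublevel -ge0_integral_sum//; last 2 first.
  - by move=> i; exact: measurable_fun_sublevel.
  - by move=> i x _; rewrite mule_ge0.
  rewrite -ge0_integralD//; last 4 first.
  - by move=> x _; rewrite mule_ge0.
  - exact: measurable_fun_sublevel.
  - by move=> x _; apply: sume_ge0 => i _; rewrite mule_ge0.
  - by apply: emeasurable_sum => i; exact: measurable_fun_sublevel.
  apply: le_integral_ge0 => x; first by rewrite mule_ge0.
  rewrite -ge0_sume_distrl// -ge0_muleDl//; last exact: sume_ge0.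
  by apply: lee_wpmul2r => //; rewrite sumEFin; exact: htri.
apply: (le_trans split).
have -> : \sum_(i < n) integral_sublevel f 1 (fun x => xi i (tnth x i)) =
    (\sum_(i < n) \int[m i]_y xi i y) * sublevel_vol f 1.
  rewrite ge0_sume_distrl; last by move=> i _; exact: integral_ge0.
  by apply: eq_bigr => i _; rewrite marg.
apply: (@le_trans _ _ ((3 * cmp_scale)%:E * \int[mprod m]_x h x * sublevel_vol f 1 +
    (1 + 3 * 41)%:E * \int[mprod m]_x h x * sublevel_vol f 1)).
  by apply: leeD => //; apply: lee_wpmul2r.
move: (\int[mprod m]_x h x) J0 => J J0.
have k1 : 0 <= (3 * cmp_scale)%:E :> \bar R by rewrite lee_fin mulr_ge0// ltW// cmp_scale_gt0.
have k2 : 0 <= (1 + 3 * 41)%:E :> \bar R by rewrite lee_fin addr_ge0.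
rewrite -ge0_muleDl; [|exact: mule_ge0..].
by rewrite -ge0_muleDl.
Qed.

End core.

(** * Suprema of nonnegative linear functionals *)

Section sup_pos.
Context {R : realType}.
Local Open Scope ereal_scope.

Definition dot_pos n (t x : n.-tuple R) : R :=
  (\sum_(i < n) tnth t i * Num.max 0 (tnth x i))%R.

(** Positive parts make the supremum nonnegative and monotone on the whole space, for nonempty [T]
    with nonnegative entries. At nonnegative vectors it agrees with [sup_linear]. *)
Definition sup_pos n (T : set (n.-tuple R)) (x : n.-tuple R) : \bar R :=
  sup_linear T (fun i => Num.max 0 (tnth x i))%R.

Section fixed.
Variables (n : nat) (T : set (n.-tuple R)).
Hypothesis T0 : forall t, T t -> forall i, (0 <= tnth t i)%R.

Let p0 (y : R) : (0 <= Num.max 0 y)%R. Proof. by rewrite le_max lexx. Qed.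

Let hub t x : T t -> (dot_pos t x)%:E <= sup_pos T x.
Proof. by move=> Tt; apply: ereal_sup_ubound; exists t. Qed.

Let hle x z : (forall t, T t -> (dot_pos t x)%:E <= z) -> sup_pos T x <= z.
Proof. by move=> H; apply: ge_ereal_sup => _ [t Tt <-]; exact: H. Qed.

Lemma sup_pos_gtP x (r : R) : r%:E < sup_pos T x <-> exists2 t, T t & (r < dot_pos t x)%R.
Proof.
split=> [/ereal_sup_gt[_ [t Tt <-]]|[t Tt rt]].
  by rewrite lte_fin; exists t.
by apply: lt_le_trans (hub x Tt); rewrite lte_fin.
Qed.

Lemma sup_pos_nd x y : (forall i, (tnth x i <= tnth y i)%R) -> sup_pos T x <= sup_pos T y.
Proof.
move=> xy; apply: hle => t Tt; apply: le_trans (hub y Tt); rewrite lee_fin.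
apply: ler_sum => i _; apply: ler_wpM2l; first exact: T0.
by rewrite ge_max p0/= le_max xy orbT.
Qed.

(* [{x | r < h x}] is a union of orthants with rational corners, since each
   functional in the supremum is monotone and lower semicontinuous. *)
Lemma measurable_sup_pos : measurable_fun setT (sup_pos T).
Proof.
apply: (measurability _ (ErealGenOInfty.measurableE R)) => //= _ [_ [r ->] <-].
rewrite setTI preimage_itvoy.
pose O (q : n.-tuple rat) : set (n.-tuple R) :=
  if `[< r%:E < sup_pos T [tuple ratr (tnth q i) | i < n] >]
  then [set x | forall i, (ratr (tnth q i) <= tnth x i)%R] else set0.
rewrite (_ : [set x | _] = \bigcup_q O q); last first.
  apply/seteqP; split => [x /= /sup_pos_gtP[t Tt rt]|x [q _]]; last first.
    rewrite /O; case: asboolP => // rq qx /=; apply: (lt_le_trans rq).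
    by apply: sup_pos_nd => i; rewrite tnth_mktuple.
  pose s := (1 + \sum_(i < n) tnth t i)%R.
  have s0 : (0 < s)%R by rewrite ltr_pwDl// sumr_ge0// => i _; exact: T0.
  pose e := ((dot_pos t x - r) / s)%R.
  have e0 : (0 < e)%R by rewrite divr_gt0// subr_gt0.
  have /fin_all_exists[q qx] i : exists q : rat, (tnth x i - e < ratr q < tnth x i)%R.
    have /rat_in_itvoo[q] : (tnth x i - e < tnth x i)%R by rewrite ltrBlDr ltrDl.
    by rewrite in_itv/=; exists q.
  exists [tuple q i | i < n] => //; rewrite /O; case: asboolP => [_ i|].
    by rewrite /= tnth_mktuple ltW//; case/andP : (qx i).
  case; apply/sup_pos_gtP; exists t => //.
  apply: (@lt_le_trans _ _ (\sum_(i < n) tnth t i * (Num.max 0 (tnth x i) - e))%R).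
    under eq_bigr do rewrite mulrBr.
    rewrite sumrB -/(dot_pos t x) -mulr_suml ltrBrDr -ltrBrDl.
    rewrite [ltRHS](_ : _ = e * s)%R; last by rewrite /e divfK// gt_eqF.
    by rewrite mulrC ltr_pM2l// /s ltrDr.
  apply: ler_sum => i _; apply: ler_wpM2l; first exact: T0.
  rewrite !tnth_mktuple; case/andP : (qx i) => q1 _.
  rewrite lerBlDr ge_max !addr_ge0 ?(ltW e0)//=.
  by apply: (@le_trans _ _ (ratr (q i) + e)%R); [lra|rewrite lerD2r le_max lexx orbT].
apply: countable_bigcupT_measurable; first exact: countableP.
move=> q; rewrite /O; case: asboolP => // _.
rewrite (_ : [set x | _] = \bigcap_(i in [set: 'I_n])
    ((@tnth n R)^~ i @^-1` `[ratr (tnth q i), +oo[%classic)); last first.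
  apply/seteqP; split => x /= H i; first by move=> _; rewrite /= in_itv/= andbT.
  by have := H i I; rewrite /= in_itv/= andbT.
apply: fin_bigcap_measurable => // i _.
by rewrite -[X in measurable X]setTI; exact: measurable_tnth.
Qed.

Hypothesis Tn : T !=set0.

Lemma sup_pos_ge0 x : 0 <= sup_pos T x.
Proof.
case: Tn => t Tt; apply: le_trans (hub x Tt); rewrite lee_fin.
by apply: sumr_ge0 => i _; rewrite mulr_ge0// T0.
Qed.

Lemma sup_pos_scale x k : (0 < k)%R -> sup_pos T (tscale k x) = k%:E * sup_pos T x.
Proof.
move=> k0.
have E c t y : (0 < c)%R -> dot_pos t (tscale c y) = (c * dot_pos t y)%R.
  move=> c0; rewrite /dot_pos mulr_sumr; apply: eq_bigr => i _.
  by rewrite tnth_mktuple [RHS]mulrCA (maxr_pMr _ _ (ltW c0)) mulr0.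
have H c y : (0 < c)%R -> sup_pos T (tscale c y) <= c%:E * sup_pos T y.
  move=> c0; apply: hle => t Tt; rewrite E// EFinM; apply: lee_wpmul2l.
    by rewrite lee_fin ltW.
  exact: hub.
apply/eqP; rewrite eq_le H//=.
have kV0 : (0 < k^-1)%R by rewrite invr_gt0.
have := H _ (tscale k x) kV0.
have -> : tscale k^-1 (tscale k x) = x.
  by apply: eq_from_tnth => i; rewrite !tnth_mktuple mulKf// gt_eqF.
have kE : 0 <= k%:E by rewrite lee_fin ltW.
move=> /(lee_wpmul2l kE)/le_trans; apply.
by rewrite muleA -EFinM mulfV ?gt_eqF// mul1e.
Qed.

(** For a single [t] the last clause is an equality: coordinate [i] contributes only to the first
    term, and the others contribute [1 + (C - 1)] times their value. By homogeneity
    [C * sup_pos T x] is the supremum at the dilated vector. *)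
Lemma coord_convex_sup_pos : coord_convex (sup_pos T).
Proof.
split => [||x i C C1]; first exact: sup_pos_nd.
  move=> x i y y0; congr (sup_linear T _); apply/funext => j.
  by rewrite !tnth_upd; case: eqP => // _; rewrite maxxx max_l.
have C0 : (0 < C)%R by lra.
rewrite -(@sup_pos_scale _ _ C0); apply: hle => t Tt.
apply: (@le_trans _ _ ((dot_pos t (upd x i (C * tnth x i)))%:E +
    (C - 1)%:E * (dot_pos t (upd x i 0%R))%:E)); last first.
  apply: leeD; first exact: hub.
  by apply: lee_wpmul2l; [rewrite lee_fin; lra|exact: hub].
rewrite -EFinM -EFinD lee_fin /dot_pos mulr_sumr -big_split/=.
apply: ler_sum => j _; rewrite tnth_mktuple !tnth_upd.
have -> : (Num.max 0 (C * tnth x j) = C * Num.max 0 (tnth x j))%R.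
  by rewrite (maxr_pMr _ _ (ltW C0)) mulr0.
case: eqP => [->|_]; first by rewrite maxxx (maxr_pMr _ _ (ltW C0)) !mulr0 addr0.
by rewrite le_eqVlt; apply/orP; left; apply/eqP; ring.
Qed.

Variable K : R.
Hypothesis TK : forall t, T t -> forall i, (tnth t i <= K)%R.

Definition coord_sup i : R := fine (ereal_sup [set (tnth t i)%:E | t in T]).

Lemma coord_supE i : ereal_sup [set (tnth t i)%:E | t in T] = (coord_sup i)%:E.
Proof.
rewrite fineK// ge0_fin_numE.
  apply: (@le_lt_trans _ _ K%:E); last exact: ltry.
  by apply: ge_ereal_sup => _ [t Tt <-]; rewrite lee_fin TK.
case: Tn => t Tt; apply: (@le_trans _ _ (tnth t i)%:E); first by rewrite lee_fin T0.
by apply: ereal_sup_ubound; exists t.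
Qed.

Lemma coord_sup_ub t i : T t -> (tnth t i <= coord_sup i)%R.
Proof.
by move=> Tt; rewrite -lee_fin -coord_supE; apply: ereal_sup_ubound; exists t.
Qed.

Lemma coord_sup_ge0 i : (0 <= coord_sup i)%R.
Proof. by case: Tn => t Tt; apply: le_trans (coord_sup_ub i Tt); exact: T0. Qed.

Lemma sup_pos_tmin x b : (forall i, 0 <= b i)%R ->
  sup_pos T x <= sup_pos T (tmin x b) +
    (\sum_(i < n) coord_sup i * Num.max 0 (tnth x i - b i))%:E.
Proof.
move=> b0; apply: hle => t Tt; apply: (@le_trans _ _ ((dot_pos t (tmin x b))%:E +
    (\sum_(i < n) coord_sup i * Num.max 0 (tnth x i - b i))%:E)).
  rewrite -EFinD lee_fin /dot_pos -big_split/=; apply: ler_sum => i _.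
  rewrite tnth_mktuple.
  apply: (@le_trans _ _ (tnth t i * Num.max 0 (Num.min (tnth x i) (b i)) +
      tnth t i * Num.max 0 (tnth x i - b i))%R).
    rewrite -mulrDr; apply: ler_wpM2l; first exact: T0.
    rewrite ge_max addr_ge0//=; case: (leP (tnth x i) (b i)) => xb.
      by rewrite ler_wpDr// le_max lexx orbT.
    have xb0 : (0 <= tnth x i - b i)%R by rewrite subr_ge0 ltW.
    by rewrite (max_r (b0 i)) (max_r xb0); lra.
  by rewrite lerD2l; apply: ler_wpM2r => //; exact: coord_sup_ub.
by apply: leeD => //; exact: hub.
Qed.

Lemma coord_sup_le_sup_pos x i : (coord_sup i * Num.max 0 (tnth x i))%:E <= sup_pos T x.
Proof.
set M := (Num.max 0 (tnth x i))%R.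
have dt t : T t -> (tnth t i * M <= dot_pos t x)%R.
  move=> Tt; rewrite /dot_pos (bigD1 i)//= lerDl sumr_ge0// => j _.
  by rewrite mulr_ge0// T0.
have [M0|M0] := eqVneq M 0%R; first by rewrite M0 mulr0; exact: sup_pos_ge0.
have Mp : (0 < M)%R by rewrite lt_neqAle eq_sym M0 p0.
case E : (sup_pos T x) (sup_pos_ge0 x) => [s| |]// _; last exact: leey.
rewrite lee_fin -ler_pdivlMr// -lee_fin -coord_supE.
apply: ge_ereal_sup => _ [t Tt <-]; rewrite lee_fin ler_pdivlMr//.
by apply: (le_trans (dt t Tt)); rewrite -lee_fin -E; exact: hub.
Qed.

End fixed.
End sup_pos.

(** * Laws of the random vectors *)

Section laws.
Context {R : realType}.
Local Open Scope ereal_scope.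
Local Notation SFM := {sigma_finite_measure set R -> \bar R}.

Definition box n (A : 'I_n -> set R) : set (n.-tuple R) :=
  [set t | forall i, A i (tnth t i)].

Lemma measurable_box n (A : 'I_n -> set R) :
  (forall i, measurable (A i)) -> measurable (box A).
Proof.
move=> mA.
rewrite (_ : box A = \bigcap_(i in [set: 'I_n]) ((@tnth n R)^~ i @^-1` A i)).
  apply: fin_bigcap_measurable => // i _.
  by rewrite -[X in measurable X]setTI; exact: measurable_tnth.
by apply/seteqP; split => t /= h i => [_|]; exact: h.
Qed.

Lemma mprod_box n (m : 'I_n -> SFM) (A : 'I_n -> set R) :
  (forall i, measurable (A i)) -> mprod m (box A) = \prod_(i < n) m i (A i).
Proof.
elim: n m A => [|n ih] m A mA.
  by rewrite big_ord0 /= diracE mem_set//= => -[].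
rewrite big_ord_recl -ih// /= /mcons /pushforward.
rewrite -product_measure1E//; last exact: measurable_box.
congr (_ _); apply/seteqP; split => [[x t] /= h|[x t] [/= h0 h] i].
  split; first exact: (h ord0).
  by move=> i; have := h (lift ord0 i); rewrite tnthS.
by case: (unliftP ord0 i) => [j|] ->; rewrite ?tnthS//; exact: h.
Qed.

Definition boxes n : set (set (n.-tuple R)) :=
  [set B | exists2 A, (forall i, measurable (A i)) & B = box A].

Lemma measurable_boxes n : @measurable _ (n.-tuple R) = <<s @boxes n >>.
Proof.
apply/seteqP; split; last first.
  apply: smallest_sub; first exact: sigma_algebra_measurable.
  by move=> _ [A mA ->]; exact: measurable_box.
apply: smallest_sub; first exact: smallest_sigma_algebra.
move=> B; rewrite -bigcup_seq/= => -[i _ [C mC <-]].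
apply: sub_sigma_algebra; exists (fun j => if j == i then C else setT).
  by move=> j; case: ifP.
rewrite setTI; apply/seteqP; split => t /=.
  by move=> Ct j; case: eqP => // ->.
by move=> /(_ i); rewrite eqxx.
Qed.

Section independent.
Context d (T : measurableType d) (P : probability T R) n (X : 'I_n -> {RV P >-> R}).
Hypothesis indX : mutually_independent X.

Definition tuple_of_rv (w : T) : n.-tuple R := [tuple X i w | i < n].

Lemma measurable_tuple_of_rv : measurable_fun setT tuple_of_rv.
Proof.
apply/measurable_fun_tnthP => i.
rewrite (_ : _ \o _ = X i)//; apply/funext => w.
by rewrite /= tnth_mktuple.
Qed.

HB.instance Definition _ :=
  isMeasurableFun.Build _ _ _ _ tuple_of_rv measurable_tuple_of_rv.

(** Boxes form a generating family stable under intersection, and on boxes mutual independence is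
    the product formula. *)
Lemma tuple_law (A : set (n.-tuple R)) : measurable A ->
  distribution P tuple_of_rv A = mprod (fun i => distribution P (X i)) A.
Proof.
apply: (measure_unique (@boxes n) (fun=> setT)).
- exact: measurable_boxes.
- move=> _ _ [C mC ->] [B mB ->]; exists (fun i => C i `&` B i).
    by move=> i; exact: measurableI.
  apply/seteqP; split => t /=; first by move=> [a b] i; split.
  by move=> ab; split => i; case: (ab i).
- by move=> _; exists (fun=> setT) => //; apply/seteqP; split.
- by rewrite bigcup_const//; exists 0%N.
- move=> _ [B mB ->]; rewrite -[RHS]/(mprod (fun i => distribution P (X i)) (box B)) mprod_box//.
  transitivity (P (\bigcap_(i in [set j | j \in [set: 'I_n]%SET]) (X i @^-1` B i))).
    congr (P _); apply/seteqP; split => w /=.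
      by move=> Bw i _; have := Bw i; rewrite tnth_mktuple.
    by move=> Bw i; rewrite tnth_mktuple; apply: Bw; rewrite /= inE.
  by rewrite indX//; apply: eq_bigl => i; rewrite inE.
- by move=> _; rewrite (le_lt_trans (probability_le1 _ _)) ?ltry.
Qed.

Lemma integral_tuple_law (h : n.-tuple R -> \bar R) : measurable_fun setT h ->
  (forall x, 0 <= h x) ->
  \int[P]_w h (tuple_of_rv w) = \int[mprod (fun i => distribution P (X i))]_x h x.
Proof.
move=> mh h0; rewrite -(ge0_integral_distribution tuple_of_rv mh h0).
by apply: eq_measure_integral => A mA _; exact: tuple_law.
Qed.

End independent.
End laws.

Section uniform.
Context {R : realType}.

Definition pos_ext (f : R -> R) (x : R) : R := f (Num.max 0 x).

(** The positive part is convex and [f] is nondecreasing and convex on the half-line, so the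
    composition is convex. *)
Lemma gauge_pos_ext (f : R -> R) :
  convex_function (E := R^o) `[0, +oo[ f ->
  {in `[0, +oo[ &, {homo f : x y / x < y}} -> f 0 = 0 -> gauge (pos_ext f).
Proof.
move=> cf incf f0.
have i0 x : 0 <= x -> x \in `[0, +oo[ by move=> x0; rewrite in_itv/= x0.
have fnd x y : 0 <= x -> x <= y -> f x <= f y.
  move=> x0; rewrite le_eqVlt => /predU1P[->//|xy]; apply/ltW/incf => //; apply: i0 => //.
  exact: le_trans (ltW xy).
have p0 x : 0 <= Num.max 0 x :> R by rewrite le_max lexx.
split => [x x0|x x0|x y t t0 t1]; rewrite /pos_ext.
- by rewrite max_l.
- by rewrite max_r ?ltW// -{1}f0; apply: incf => //; apply: i0 => //; exact: ltW.
have s0 : 0 <= 1 - t by rewrite subr_ge0.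
apply: (@le_trans _ _ (f (t * Num.max 0 x + (1 - t) * Num.max 0 y))).
  apply: fnd => //; rewrite ge_max addr_ge0 ?mulr_ge0//=.
  by apply: lerD; apply: ler_wpM2l => //; rewrite le_max lexx orbT.
have := cf (Itv01 t0 t1) (Num.max 0 x) (Num.max 0 y).
rewrite !convRE /=; apply; rewrite inE/= ?in_itv/= ?p0//.
Qed.

Local Open Scope ereal_scope.

Lemma orlicz_body_sublevel n (f : 'I_n -> R -> R) x :
  orlicz_body f x <-> sublevel (fun i => pos_ext (f i)) 1 x.
Proof.
have E : (forall i, (0 <= tnth x i)%R) ->
    gauge_sum (fun i => pos_ext (f i)) x = (\sum_(i < n) f i (tnth x i))%R.
  by move=> x0; apply: eq_bigr => i _; rewrite /pos_ext max_r.
split => [[x0 s1]|/andP[/forallP x0]].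
  by apply/andP; split; [exact/forallP|rewrite E].
by rewrite E.
Qed.

Lemma integral_orlicz_body n (f : 'I_n -> R -> R) (g : n.-tuple R -> \bar R) :
  (forall i, gauge (pos_ext (f i))) -> measurable_fun setT g -> (forall x, 0 <= g x) ->
  \int[lebesgue_measure_tuple R n]_(x in orlicz_body f) g x =
  integral_sublevel (fun i => pos_ext (f i)) 1 g.
Proof.
move=> gf mg g0; rewrite integral_mkcond /integral_sublevel -integral_lebesgue_tuple.
- apply: eq_integral => x _; rewrite patchE; case: ifPn => xB.
    by move: xB; rewrite inE => /orlicz_body_sublevel ->; rewrite mule1.
  case: (boolP (sublevel _ _ _)) => [/orlicz_body_sublevel xB'|]; last by rewrite mule0.
  by move: xB; rewrite notin_setE => /(_ xB').
- exact: measurable_fun_sublevel.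
- by move=> x; rewrite mule_ge0// lee_fin.
Qed.

Lemma measurable_orlicz_body n (f : 'I_n -> R -> R) :
  (forall i, gauge (pos_ext (f i))) -> measurable (orlicz_body f).
Proof.
move=> gf.
have mf := measurable_sublevel (n := n) 1 gf.
rewrite (_ : orlicz_body f =
    (fun x => (sublevel (fun i => pos_ext (f i)) 1 x)%:R%:E) @^-1` [set 1 : \bar R]).
  by rewrite -[X in measurable X]setTI; apply: mf => //; exact: emeasurable_set1.
apply/seteqP; split => x /=; first by move=> /orlicz_body_sublevel ->.
case: (boolP (sublevel _ _ _)) => [/orlicz_body_sublevel //|_] [].
by move=> /eqP; rewrite eq_sym oner_eq0.
Qed.

Lemma integral_uniform_on n (f : 'I_n -> R -> R) d (Omega : measurableType d)
    (P : probability Omega R) (X : {RV P >-> n.-tuple R}) (g : n.-tuple R -> \bar R) :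
  (forall i, gauge (pos_ext (f i))) -> uniform_on (orlicz_body f) X ->
  measurable_fun setT g -> (forall x, 0 <= g x) ->
  \int[P]_w g (X w) * sublevel_vol (fun i => pos_ext (f i)) 1 =
  integral_sublevel (fun i => pos_ext (f i)) 1 g.
Proof.
move=> gf uX mg g0.
set B := orlicz_body f in uX *; have mB : measurable B by exact: measurable_orlicz_body.
set la := lebesgue_measure_tuple R n in uX *.
have [W [_ Wpos _ _] WE] := sublevel_volP gf.
have W1 : (0 < W 1)%R by exact: Wpos.
have VE : la B = (W 1)%:E.
  rewrite -WE /sublevel_vol -integral_orlicz_body//.
  by rewrite integral_cst// mul1e.
have k0 : (0 <= (W 1)^-1)%R by rewrite invr_ge0 ltW.
have uE A : measurable A -> distribution P X A = la (A `&` B) * ((W 1)^-1)%:E.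
  by move=> mA; rewrite uX// VE inver gt_eqF.
rewrite -(ge0_integral_distribution X mg g0).
have mNB : measurable (~` B) by exact: measurableC.
have NB : distribution P X (~` B) = 0 by rewrite uE// setICl measure0 mul0e.
rewrite (ge0_negligible_integral mNB measurableT mg (fun x _ => g0 x) NB).
rewrite setTD setCK.
rewrite (eq_measure_integral (mscale (NngNum k0) la)); last first.
  move=> A mA AB; transitivity (la A * ((W 1)^-1)%:E); last by rewrite muleC.
  by rewrite -{2}(setIidl AB); exact: uE.
rewrite ge0_integral_mscale//=; last exact: measurable_funTS.
rewrite integral_orlicz_body// WE muleC muleA -EFinM mulfV ?mul1e// gt_eqF//.
Qed.

End uniform.

(** * Return to the random vectors, and truncation of [T] *)

Section transfer.
Context {R : realType}.
Local Open Scope ereal_scope.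

Section negative_part.
Context d (T : measurableType d) (P : probability T R).

(** Dropping the negative part of [g] increases its integral, and its positive part is below [h].
    This passes from [sup_linear] to [sup_pos] on the side of [X]. *)
Lemma integral_le_ge0 (g h : T -> \bar R) : (forall x, 0 <= h x) ->
  (forall x, g x <= h x) -> \int[P]_x g x <= \int[P]_x h x.
Proof.
move=> h0 gh; rewrite integralE; apply: (@le_trans _ _ (\int[P]_x g^\+ x - 0)).
  by apply: leeB => //; apply: integral_ge0.
rewrite sube0; apply: le_integral_ge0 => x; first exact: funepos_ge0.
by rewrite funeposE ge_max gh h0.
Qed.

(** For the way back to [sup_linear] on the side of [X'], whose coordinates are nonnegative only
    almost surely. The negative part of [g] vanishes on [A], and bounding it by [+oo] elsewhere
    costs nothing on a null set. *)
Lemma integral_ge_ae (g h : T -> \bar R) (A : set T) : measurable A -> P A = 1 ->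
  measurable_fun setT h -> (forall x, 0 <= h x) -> (forall x, A x -> g x = h x) ->
  \int[P]_x h x <= \int[P]_x g x.
Proof.
move=> mA PA mh h0 gh.
have mNA : measurable (~` A) by exact: measurableC.
have NA : P (~` A) = 0 by rewrite probability_setC// PA subee.
have neg0 : \int[P]_x g^\- x = 0.
  apply/eqP; rewrite eq_le integral_ge0 ?andbT//.
  apply: (@le_trans _ _ (\int[P]_(x in ~` A) cst +oo x)); last first.
    by rewrite integral_cst// -[X in _ * X]/(P (~` A)) NA mule0.
  rewrite [leRHS]integral_mkcond; apply: le_integral_ge0 => x; first exact: funeneg_ge0.
  rewrite patchE; case: ifPn => xA; first exact: leey.
  move: xA; rewrite notin_setE/= => /contrapT/gh E.
  by rewrite funenegE E ge_max lexx andbT oppe_le0.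
rewrite [leRHS]integralE neg0 sube0.
rewrite (ge0_negligible_integral mNA measurableT mh (fun x _ => h0 x) NA).
rewrite setTD setCK integral_mkcond; apply: le_integral_ge0 => x.
  by rewrite patchE; case: ifP.
rewrite patchE; case: ifPn => xA; last exact: funepos_ge0.
by move: xA; rewrite inE funeposE => /gh ->; rewrite le_max lexx.
Qed.

End negative_part.

Definition coord_rv d (Omega : measurableType d) (P : probability Omega R) (n : nat)
  (X : {RV P >-> n.-tuple R}) (i : 'I_n) (w : Omega) : R := tnth (X w) i.

Section coord_rv.
Context d (Omega : measurableType d) (P : probability Omega R) (n : nat).
Variables (X : {RV P >-> n.-tuple R}) (i : 'I_n).

Let mcoord : measurable_fun setT (coord_rv X i).
Proof. by apply: (measurableT_comp (measurable_tnth i)); exact: measurable_funPT. Qed.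

HB.instance Definition _ := isMeasurableFun.Build _ _ _ _ (coord_rv X i) mcoord.
End coord_rv.

Variables (n : nat) (f : 'I_n -> R -> R).
Hypotheses (n0 : (0 < n)%N) (gf : forall i, gauge (pos_ext (f i))).
Variables (d d' : measure_display) (Omega : measurableType d) (P : probability Omega R).
Variables (X : {RV P >-> n.-tuple R}).
Hypothesis uX : uniform_on (orlicz_body f) X.
Variables (Omega' : measurableType d') (P' : probability Omega' R).
Variable X' : 'I_n -> {RV P' >-> R}.
Hypothesis indX : mutually_independent X'.
Hypothesis sameX : forall i, same_distribution P' P (X' i) (fun w => tnth (X w) i).

Lemma marginal_law i (g : R -> \bar R) : measurable_fun setT g -> (forall x, 0 <= g x) ->
  \int[distribution P' (X' i)]_y g y * sublevel_vol (fun i => pos_ext (f i)) 1 =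
  integral_sublevel (fun i => pos_ext (f i)) 1 (fun x => g (tnth x i)).
Proof.
move=> mg g0.
have mgt : measurable_fun setT (fun x : n.-tuple R => g (tnth x i)).
  by apply: (measurableT_comp mg); exact: measurable_tnth.
rewrite -(integral_uniform_on gf uX mgt (fun x => g0 _)); congr (_ * _).
transitivity (\int[distribution P (coord_rv X i)]_y g y).
  by apply: eq_measure_integral => A mA _; exact: sameX.
by rewrite (ge0_integral_distribution (coord_rv X i) mg g0).
Qed.

Lemma bounded_comparison (T : set (n.-tuple R)) (K : R) :
  (forall t, T t -> forall i, (0 <= tnth t i)%R) -> T !=set0 ->
  (forall t, T t -> forall i, (tnth t i <= K)%R) ->
  \int[P]_w sup_pos T (X w) <= cmp_const%:E * \int[P']_w sup_pos T (tuple_of_rv X' w).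
Proof.
move=> T0 Tn TK.
have mT := measurable_sup_pos T0; have h0 := sup_pos_ge0 T0 Tn.
have [W [_ Wpos _ _] WE] := sublevel_volP gf.
have W1 : (0 < W 1)%R by exact: Wpos.
apply: (le_pmul2r_fin W1); rewrite -WE (integral_uniform_on gf uX)//.
rewrite (integral_tuple_law indX)//.
apply: (sublevel_comparison (c := coord_sup T)) => //.
- by move=> i; exact: probability_setT.
- exact: marginal_law.
- exact: coord_convex_sup_pos.
- exact: (coord_sup_ge0 T0 Tn TK).
- exact: (sup_pos_tmin T0 Tn TK).
- exact: (coord_sup_le_sup_pos T0 Tn TK).
- exact: sup_pos_scale.
Qed.

Section truncation.
Variable T : set (n.-tuple R).
Hypotheses (T0 : forall t, T t -> forall i, (0 <= tnth t i)%R) (Tn : T !=set0).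

(** Cutting the entries of [t] at [k] supplies the bound that [bounded_comparison] asks for; the
    suprema increase to the one over [T], so monotone convergence applies. *)
Definition truncated (k : nat) : set (n.-tuple R) := [set tmin t (fun=> k%:R) | t in T].

Let trunc0 k t : truncated k t -> forall i, (0 <= tnth t i)%R.
Proof. by move=> [s Ts <-] i; rewrite tnth_mktuple le_min T0//=. Qed.

Let truncn k : truncated k !=set0.
Proof. by case: Tn => t Tt; exists (tmin t (fun=> k%:R)), t. Qed.

Let p0 (y : R) : (0 <= Num.max 0 y)%R. Proof. by rewrite le_max lexx. Qed.

Let trunc_le k t x : T t -> (dot_pos (tmin t (fun=> k%:R)) x <= dot_pos t x)%R.
Proof.
move=> Tt; apply: ler_sum => i _; apply: ler_wpM2r => //.
by rewrite tnth_mktuple ge_min lexx.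
Qed.

Let trunc_nd x : {homo (fun k => sup_pos (truncated k) x) : k l / (k <= l)%N >-> k <= l}.
Proof.
move=> k l kl; apply: ge_ereal_sup => _ [_ [t Tt <-] <-].
apply: (@le_trans _ _ (dot_pos (tmin t (fun=> l%:R)) x)%:E).
  rewrite lee_fin; apply: ler_sum => i _; apply: ler_wpM2r => //.
  by rewrite !tnth_mktuple le_min !ge_min lexx/= ler_nat kl orbT.
by apply: ereal_sup_ubound; exists (tmin t (fun=> l%:R)) => //; exists t.
Qed.

Lemma sup_pos_truncated k x : sup_pos (truncated k) x <= sup_pos T x.
Proof.
apply: ge_ereal_sup => _ [_ [t Tt <-] <-].
apply: (@le_trans _ _ (dot_pos t x)%:E); first by rewrite lee_fin trunc_le.
by apply: ereal_sup_ubound; exists t.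
Qed.

Lemma lim_sup_pos_truncated x : limn (fun k => sup_pos (truncated k) x) = sup_pos T x.
Proof.
have cv := ereal_nondecreasing_cvgn (@trunc_nd x).
rewrite (cvg_lim _ cv)//; apply/eqP; rewrite eq_le; apply/andP; split.
  by apply: ge_ereal_sup => _ [k _ <-]; exact: sup_pos_truncated.
apply: ge_ereal_sup => _ [t Tt <-].
(* This [k] is above every entry of [t], so the cut leaves [t] unchanged. *)
pose k := (\sum_(i < n) (Num.truncn (tnth t i)).+1)%N.
apply: (@le_trans _ _ (sup_pos (truncated k) x)); last first.
  by apply: ereal_sup_ubound; exists k.
apply: ereal_sup_ubound; exists t => //; exists t => //.
apply: eq_from_tnth => i; rewrite tnth_mktuple; apply/min_idPl.
apply: (@le_trans _ _ (Num.truncn (tnth t i)).+1%:R); first exact/ltW/truncnS_gt.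
by rewrite ler_nat /k (bigD1 i)//= leq_addr.
Qed.

Lemma sup_pos_comparison :
  \int[P]_w sup_pos T (X w) <= cmp_const%:E * \int[P']_w sup_pos T (tuple_of_rv X' w).
Proof.
have mX k : measurable_fun setT (fun w => sup_pos (truncated k) (X w)).
  by apply: (measurableT_comp (measurable_sup_pos (@trunc0 k))); exact: measurable_funPT.
have ge0 k w : 0 <= sup_pos (truncated k) (X w) by exact: (sup_pos_ge0 (@trunc0 k) (truncn k)).
have nd w : {homo (fun k => sup_pos (truncated k) (X w)) : k l / (k <= l)%N >-> k <= l}.
  exact: trunc_nd.
under eq_integral do rewrite -lim_sup_pos_truncated.
rewrite (monotone_convergence P measurableT mX (fun k w _ => ge0 k w) (fun w _ => nd w)).
apply: lime_le.
  apply: ereal_nondecreasing_is_cvgn => k l kl.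
  by apply: le_integral_ge0 => w; [exact: ge0|exact: nd].
near=> k; apply: (@le_trans _ _
    (cmp_const%:E * \int[P']_w sup_pos (truncated k) (tuple_of_rv X' w))).
  apply: (@bounded_comparison _ k%:R) => //; first exact: trunc0.
  by move=> _ [t Tt <-] i; rewrite tnth_mktuple ge_min lexx orbT.
apply: lee_wpmul2l; first by rewrite lee_fin ltW// cmp_const_gt0.
apply: le_integral_ge0 => w; first exact: (sup_pos_ge0 (@trunc0 k) (truncn k)).
exact: sup_pos_truncated.
Unshelve. all: by end_near. Qed.

End truncation.

(** Each [X' i] has the law of a coordinate of a point of the body, where coordinates are
    nonnegative; the product formula on boxes joins the coordinates. *)
Lemma ae_nonneg : P' (tuple_of_rv X' @^-1` box (fun=> `[0%R, +oo[%classic)) = 1.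
Proof.
have mI (i : 'I_n) : measurable (`[0%R, +oo[%classic : set R) by [].
rewrite -[LHS]/(distribution P' (tuple_of_rv X') _) (tuple_law indX); last exact: measurable_box.
rewrite mprod_box//; apply: big1 => i _.
have [W [_ Wpos _ _] WE] := sublevel_volP gf.
have W1 : (0 < W 1)%R by exact: Wpos.
pose g (y : R) : \bar R := ((0 <= y)%R%:R)%:E.
have mg : measurable_fun setT g.
  by apply/measurable_EFinP; apply: measurable_indb; exact: measurable_fun_ler.
have gE : \int[distribution P' (X' i)]_y g y = distribution P' (X' i) `[0%R, +oo[%classic.
  rewrite -[RHS]mul1e -integral_cst// [RHS]integral_mkcond; apply: eq_integral => y _.
  by rewrite patchE mem_setE in_itv/= andbT /g; case: (0 <= y)%R.
have g0 y : 0 <= g y by rewrite lee_fin.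
transitivity (\int[distribution P' (X' i)]_y g y); first exact/esym/gE.
have := marginal_law i mg g0.
have -> : integral_sublevel (fun i => pos_ext (f i)) 1 (fun x => g (tnth x i)) =
    sublevel_vol (fun i => pos_ext (f i)) 1.
  apply: eq_integral => x _; rewrite /g.
  case: (boolP (sublevel _ _ _)) => [/andP[/forallP/(_ i) ->]//|_].
  by rewrite !mule0.
rewrite WE => H; apply/eqP; rewrite eq_le; apply/andP; split;
  by apply: (le_pmul2r_fin W1); rewrite H mul1e.
Qed.

End transfer.

Theorem theorem2p4 (R : realType) :
  exists L : R, 0 < L /\
    forall (d : nat) (f : 'I_d -> R -> R),
      (0 < d)%N ->
      (forall i x, 0 <= x -> 0 <= f i x) ->
      (forall i, convex_function (E := R^o) `[0, +oo[ (f i)) ->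
      (forall i, {in `[0, +oo[ &, {homo f i : x y / x < y}}) ->
      (forall i, f i 0 = 0) ->
    forall (disp : measure_display) (Omega : measurableType disp)
      (P : probability Omega R) (X : {RV P >-> d.-tuple R}),
      uniform_on (orlicz_body f) X ->
    forall (disp' : measure_display) (Omega' : measurableType disp')
      (P' : probability Omega' R) (X' : 'I_d -> {RV P' >-> R}),
      mutually_independent X' ->
      (forall i,
        same_distribution P' P (X' i) (fun w => tnth (X w) i)) ->
    forall T : set (d.-tuple R),
      (forall t, T t -> forall i, 0 <= tnth t i) ->
      (\int[P]_w sup_linear T (fun i => tnth (X w) i) <=
       L%:E * \int[P']_w sup_linear T (fun i => X' i w))%E.
Proof.
exists cmp_const; split; first exact: cmp_const_gt0.
move=> d f d0 _ cf incf f0 disp Omega P X uX disp' Omega' P' X' indX sameX T T0.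
have gf i : gauge (pos_ext (f i)) by exact: gauge_pos_ext.
(* For empty [T] the supremum is [-oo], and so is the left side, [P] having total mass 1. *)
have [->|/set0P Tn] := eqVneq T set0.
  have E (x : 'I_d -> R) : sup_linear set0 x = -oo%E.
    by rewrite /sup_linear image_set0 ereal_sup0.
  under eq_integral do rewrite E.
  rewrite [leLHS](_ : _ = -oo%E) ?leNye// integral_cst//.
  by rewrite -[X in (_ * X)%E]/(P setT) probability_setT mule1.
(* Positive parts can only increase the left side; on the right side they are removed by the almost
   sure nonnegativity of [X']. *)
apply: (@le_trans _ _ (\int[P]_w sup_pos T (X w))%E).
  apply: integral_le_ge0 => w; first exact: sup_pos_ge0.
  apply: ge_ereal_sup => _ [t Tt <-].
  apply: (@le_trans _ _ (dot_pos t (X w))%:E); last by apply: ereal_sup_ubound; exists t.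
  rewrite lee_fin; apply: ler_sum => i _; apply: ler_wpM2l; first exact: T0.
  by rewrite le_max lexx orbT.
apply: (le_trans (sup_pos_comparison d0 gf uX indX sameX T0 Tn)).
apply: lee_wpmul2l; first by rewrite lee_fin ltW// cmp_const_gt0.
apply: (@integral_ge_ae _ _ _ _ _ _
  (tuple_of_rv X' @^-1` box (fun=> `[0%R, +oo[%classic))).
- rewrite -[X in measurable X]setTI; apply: measurable_tuple_of_rv => //.
  exact: measurable_box.
- exact: (ae_nonneg gf uX indX sameX).
- exact: (measurableT_comp (measurable_sup_pos T0) (measurable_tuple_of_rv X')).
- by move=> w; exact: sup_pos_ge0.
- move=> w Aw; congr (sup_linear T _); apply/funext => i.
  have := Aw i; rewrite /= tnth_mktuple in_itv/= andbT => X0.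
  by rewrite max_r.
Qed.
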